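(* Let $M=\mathbb{CP}^1$ (as a Riemann surface) and let $X:M\to\mathbf{CP}^3$ be any pseudoholomorphic curve in the nearly Kähler manifold $\mathbf{CP}^3$. Then $X$ is one of the vertical fibers (i.e. $X$ is vertical, its image being a fiber of the twistor fibration $T:\mathbf{CP}^3\to\mathbf{HP}^1$), or $X$ is horizontal, or $X$ has null-torsion.
   Context: **Quaternions and frames.** $\mathbf H$ is the quaternions; each $q\in\mathbf H$ is uniquely $q=z+jw$ with $z,w\in\mathbf C$, $j^2=-1$, $zj=j\bar z$. $\mathbf H^2$ is a right $\mathbf H$-module, hence a right complex vector space, identified with $\mathbf C^4$ by $(z_1,z_2,z_3,z_4)\leftrightarrow(z_1+jz_2,z_3+jz_4)$. Put $\langle(q_1,q_2),(p_1,p_2)\rangle=\bar q_1p_1+\bar q_2p_2$. Let $\mathfrak F$ ($\cong Sp(2)$) be the set of pairs $f=(e_1,e_2)$ in $\mathbf H^2$ with $\langle e_1,e_1\rangle=\langle e_2,e_2\rangle=1$, $\langle e_1,e_2\rangle=0$. There are unique quaternion-valued 1-forms $\phi^b_a$ on $\mathfrak F$ with $de_a=e_b\phi^b_a$; they satisfy $d\phi^a_b+\phi^a_c\wedge\phi^c_b=0$, $\phi^a_b+\overline{\phi^b_a}=0$. Write $$\phi^1_1=i\rho_1+j\overline{\omega_3},\quad \phi^1_2=-\tfrac{\overline{\omega_1}}{\sqrt2}+j\tfrac{\omega_2}{\sqrt2},\quad \phi^2_1=\tfrac{\omega_1}{\sqrt2}+j\tfrac{\omega_2}{\sqrt2},\quad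 \phi^2_2=i\rho_2+j\tau,$$ with $\rho_1,\rho_2$ real and $\omega_1,\omega_2,\omega_3,\tau$ complex-valued 1-forms. Set $\kappa_{1\bar1}=i(\rho_2-\rho_1)$, $\kappa_{1\bar2}=-\bar\tau$, $\kappa_{2\bar1}=\tau$, $\kappa_{2\bar2}=-i(\rho_1+\rho_2)$, $\kappa_{3\bar3}=2i\rho_1$. **Nearly Kähler $\mathbf{CP}^3$.** The map $C_1:\mathfrak F\to\mathbf{CP}^3$, $f\mapsto e_1\mathbf C$, is an $S^1\times S^3$-bundle (action $(e_1,e_2)(z,q)=(e_1z,e_2q)$). $\mathbf{CP}^3$ denotes the complex projective 3-space with the (nonintegrable) nearly Kähler almost Hermitian structure for which $\omega_1,\omega_2,\omega_3$ are unitary and of type $(1,0)$. The twistor fibration is $T:\mathbf{CP}^3\to\mathbf{HP}^1$, $v\mathbf C\mapsto v\mathbf H$, with fibers $\mathbb{CP}^1$. For $f\in\mathfrak F$, $f_{\bar1},f_{\bar2},f_{\bar3}$ denotes the basis of the complex tangent space of $\mathbf{CP}^3$ at $C_1(f)$ dual to $\omega_1,\omega_2,\omega_3$. Then $T\mathbf{CP}^3=\mathcal H\oplus\mathcal V$, with $\mathcal H$ (horizontal, rank 2) spanned by $f_{\bar1},f_{\bar2}$ and $\mathcal V$ (vertical, rank 1, tangent to the fibers of $T$) spanned by $f_{\bar3}$. **Curves.** For a connected Riemann surface $M$, a pseudoholomorphic curve is a nonconstant map $X:M\to\mathbf{CP}^3$ whose differential commutes with the almost complex structures. Let $\mathfrak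 F_X,\mathcal H_X,\mathcal V_X$ be the pullbacks to $M$ of $\mathfrak F\to\mathbf{CP}^3$, $\mathcal H$, $\mathcal V$; pulled-back forms keep their names. $\mathcal H_X$ and $\mathcal V_X$ carry the Hermitian connections $\nabla(f_{\bar i}s_i)=f_{\bar i}\otimes(ds_i+\kappa_{i\bar j}s_j)$ ($i,j\in\{1,2\}$) and $\nabla(f_{\bar3}s_3)=f_{\bar3}\otimes(ds_3+\kappa_{3\bar3}s_3)$, and the induced holomorphic structures $\bar\partial=\nabla^{0,1}$. $T^*M$ is the holomorphic line bundle of $(1,0)$-forms. Define $\mathbf I_1=f_{\bar1}\otimes\omega_1+f_{\bar2}\otimes\omega_2$ (a section of $\mathcal H_X\otimes T^*M$) and $\mathbf I_2=f_{\bar3}\otimes\omega_3$ (a section of $\mathcal V_X\otimes T^*M$); both are holomorphic. $X$ is *vertical* if $\mathbf I_1\equiv0$ and *horizontal* if $\mathbf I_2\equiv0$. **Null-torsion.** Suppose $\mathbf I_1\not\equiv0$. There is a unique holomorphic line subbundle $L\subset\mathcal H_X$ such that $\mathbf I_1$ is a section of $L\otimes T^*M$; put $N_X=\mathcal H_X/L$. Let $\mathfrak F_X^{(1)}\subset\mathfrak F_X$ be the $U(1)\times U(1)$-subbundle of those $(x,f)$ with $f_{\bar2}\in L_x$; on it $\omega_1=0$ and $\kappa_{1\bar2}$ is of type $(1,0)$. Let $(f_{\bar1})$ be the class of $f_{\bar1}$ in $N_X$, $f_2$ the dual of $f_{\bar2}$, and $\mathbf{II}=(f_{\bar1})\otimes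 f_2\otimes\kappa_{1\bar2}$, a section of $N_X\otimes L^*\otimes T^*M$. $X$ has *null-torsion* if $\mathbf I_1\not\equiv 0$ and $\mathbf{II}\equiv0$. *)

(* Defs.v *)
From Stdlib Require Import Reals FunctionalExtensionality PropExtensionality.
From Coquelicot Require Import Coquelicot.

Open Scope C_scope.

(** * Quaternions and the right module H^2 *)

(** The pair [(z, w)] is the quaternion z + j w, with j^2 = -1 and z j = j (conj z). *)
Definition quat : Type := (C * C)%type.

Definition qmul (p q : quat) : quat :=
  (fst p * fst q - Cconj (snd p) * snd q,
   snd p * fst q + Cconj (fst p) * snd q).

Definition qconj (q : quat) : quat := (Cconj (fst q), - snd q).

Definition qadd (p q : quat) : quat := (fst p + fst q, snd p + snd q).

Definition qzero : quat := (RtoC 0, RtoC 0).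
Definition qone : quat := (RtoC 1, RtoC 0).

(** Inclusion of C in the quaternions. *)
Definition qC (z : C) : quat := (z, RtoC 0).

Definition H2 : Type := (quat * quat)%type.

Definition hmulr (v : H2) (q : quat) : H2 := (qmul (fst v) q, qmul (snd v) q).

Definition herm (v w : H2) : quat :=
  qadd (qmul (qconj (fst v)) (fst w)) (qmul (qconj (snd v)) (snd w)).

(** H^2 = C^4 by ((z1, z2), (z3, z4)) = (z1 + j z2, z3 + j z4).  Coquelicot's [scal]
    on [H2_C] multiplies the four coordinates; it is right multiplication by a
    complex number (lemma [hmulr_qC]). *)
Definition C2 : ModuleSpace C_Ring := prod_ModuleSpace C_Ring C_ModuleSpace C_ModuleSpace.
Definition H2_C : ModuleSpace C_Ring := prod_ModuleSpace C_Ring C2 C2.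

Lemma qmul_assoc (p q r : quat) : qmul p (qmul q r) = qmul (qmul p q) r.
Proof.
  destruct p as [[a b] [c d]], q as [[a' b'] [c' d']], r as [[a'' b''] [c'' d'']].
  unfold qmul, Cconj, Cmult, Cminus, Cplus, Copp; simpl.
  repeat apply injective_projections; simpl; ring.
Qed.

Lemma hmulr_assoc (v : H2) (q r : quat) : hmulr v (qmul q r) = hmulr (hmulr v q) r.
Proof. unfold hmulr; simpl; now rewrite !qmul_assoc. Qed.

Lemma hmulr_qC (v : H2) (c : C) : hmulr v (qC c) = (scal c (v : H2_C) : H2_C).
Proof.
  destruct v as [[[a b] [a1 b1]] [[a2 b2] [a3 b3]]], c as [x y].
  repeat apply injective_projections; simpl;
    unfold scal, mult; simpl; unfold mult; simpl; ring.
Qed.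

Lemma qmul_1_r (p : quat) : qmul p qone = p.
Proof.
  destruct p as [[a b] [c d]].
  repeat apply injective_projections; simpl; ring.
Qed.

Lemma hmulr_1 (v : H2) : hmulr v qone = v.
Proof. destruct v; unfold hmulr; simpl; now rewrite !qmul_1_r. Qed.

(** * Projective spaces, the Riemann sphere and the twistor map *)

Definition Cspan {V : ModuleSpace C_Ring} (v : V) : V -> Prop :=
  fun w => exists c : C, w = scal c v.

Definition Projective (V : ModuleSpace C_Ring) : Type :=
  { l : V -> Prop | exists v : V, v <> zero /\ l = Cspan v }.

Definition line {V : ModuleSpace C_Ring} (v : V) (hv : v <> zero) : Projective V :=
  exist _ (Cspan v) (ex_intro _ v (conj hv eq_refl)).

Definition CP1 : Type := Projective C2.
Definition CP3 : Type := Projective H2_C.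

Definition chart_rep (k : bool) (z : C) : C2 := if k then (z, RtoC 1) else (RtoC 1, z).

Lemma chart_rep_neq0 (k : bool) (z : C) : chart_rep k z <> zero.
Proof.
  destruct k; intro h; [apply (f_equal snd) in h | apply (f_equal fst) in h];
    apply (f_equal fst) in h; simpl in h; exact (R1_neq_R0 h).
Qed.

(** The holomorphic atlas of CP^1: the parametrizations z |-> [1 : z] and w |-> [w : 1],
    each defined on all of C, with transition w = 1/z. *)
Definition chart (k : bool) (z : C) : CP1 := line (chart_rep k z) (chart_rep_neq0 k z).

Definition Hspan (v : H2) : H2 -> Prop := fun w => exists q : quat, w = hmulr v q.

Definition HP1 : Type := { P : H2 -> Prop | exists v : H2, v <> (zero : H2_C) /\ P = Hspan v }.

Definition Hsaturate (l : H2 -> Prop) : H2 -> Prop :=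
  fun w => exists v : H2, l v /\ Hspan v w.

Lemma Hsaturate_Cspan (v : H2) : Hsaturate (Cspan (v : H2_C)) = Hspan v.
Proof.
  apply functional_extensionality; intro w; apply propositional_extensionality; split.
  - intros [u [[c ->] [q ->]]]; rewrite <- hmulr_qC, <- hmulr_assoc.
    now exists (qmul (qC c) q).
  - intro hw; exists v; split; [exists (RtoC 1) | exact hw].
    rewrite <- hmulr_qC; symmetry; apply hmulr_1.
Qed.

Lemma twistor_subproof (p : CP3) :
  exists v : H2, v <> (zero : H2_C) /\ Hsaturate (proj1_sig p) = Hspan v.
Proof.
  destruct p as [l [v [hv ->]]]; exists v; split; [exact hv | apply Hsaturate_Cspan].
Qed.

(** T : CP^3 -> HP^1, v C |-> v H. *)
Definition twistor (p : CP3) : HP1 := exist _ (Hsaturate (proj1_sig p)) (twistor_subproof p).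

(** * Smooth maps on open subsets of C, regarded as R^2 *)

Definition dR (f : C -> R) (z v : C) : R :=
  Derive (fun t : R => f ((fst z + t * fst v)%R, (snd z + t * snd v)%R)) 0%R.

Definition ex_dR (f : C -> R) (z v : C) : Prop :=
  ex_derive (fun t : R => f ((fst z + t * fst v)%R, (snd z + t * snd v)%R)) 0%R.

(** [U] is meant to be open. *)
Fixpoint Cn_on (n : nat) (U : C -> Prop) (f : C -> R) : Prop :=
  match n with
  | O => forall z : C, U z -> continuous f z
  | S m => forall v : C, (forall z : C, U z -> ex_dR f z v) /\ Cn_on m U (fun z => dR f z v)
  end.

Definition smoothR (U : C -> Prop) (f : C -> R) : Prop := forall n : nat, Cn_on n U f.

Definition smoothC (U : C -> Prop) (f : C -> C) : Prop :=
  smoothR U (fun z => Re (f z)) /\ smoothR U (fun z => Im (f z)).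

Definition smoothQ (U : C -> Prop) (f : C -> quat) : Prop :=
  smoothC U (fun z => fst (f z)) /\ smoothC U (fun z => snd (f z)).

Definition smoothH2 (U : C -> Prop) (f : C -> H2) : Prop :=
  smoothQ U (fun z => fst (f z)) /\ smoothQ U (fun z => snd (f z)).

(** The differential at [z] applied to the real tangent vector [v]. *)
Definition dC (f : C -> C) (z v : C) : C :=
  (dR (fun u => Re (f u)) z v, dR (fun u => Im (f u)) z v).

Definition dQ (f : C -> quat) (z v : C) : quat :=
  (dC (fun u => fst (f u)) z v, dC (fun u => snd (f u)) z v).

Definition dH2 (f : C -> H2) (z v : C) : H2 :=
  (dQ (fun u => fst (f u)) z v, dQ (fun u => snd (f u)) z v).

(** A complex-valued real-linear form on the tangent space C of a chart is of type (1,0)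
    if it is complex linear. *)
Definition type10 (alpha : C -> C) : Prop := forall v : C, alpha (Ci * v) = Ci * alpha v.

(** * Frames and the forms on the frame bundle *)

(** Frames, and also tangent vectors (de_1, de_2) to the space of frames, are elements
    of [H2 * H2]. *)
Definition frame : Type := (H2 * H2)%type.
Definition e1 (f : frame) : H2 := fst f.
Definition e2 (f : frame) : H2 := snd f.

Definition is_frame (f : frame) : Prop :=
  herm (e1 f) (e1 f) = qone /\ herm (e2 f) (e2 f) = qone /\ herm (e1 f) (e2 f) = qzero.

(** The frame [f] lies over [p], i.e. C_1(f) = e_1 C = p. *)
Definition over (p : CP3) (f : frame) : Prop :=
  is_frame f /\ proj1_sig p = Cspan (e1 f : H2_C).

(** Right action of S^1 x S^3. *)
Definition act (f : frame) (z : C) (q : quat) : frame :=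
  (hmulr (e1 f) (qC z), hmulr (e2 f) q).

(** Forms on the frame bundle: [alpha f xi] is the value at [f] on the tangent vector
    [xi].  Pairing de_a = e_b phi^b_a with the orthonormal frame e_1, e_2 gives
    phi^b_a = <e_b, de_a>. *)
Definition phi11 (f xi : frame) : quat := herm (e1 f) (e1 xi).
Definition phi21 (f xi : frame) : quat := herm (e2 f) (e1 xi).
Definition phi22 (f xi : frame) : quat := herm (e2 f) (e2 xi).

Definition rho1 (f xi : frame) : R := Im (fst (phi11 f xi)).
Definition rho2 (f xi : frame) : R := Im (fst (phi22 f xi)).
Definition tau (f xi : frame) : C := snd (phi22 f xi).
Definition omega1 (f xi : frame) : C := RtoC (sqrt 2) * fst (phi21 f xi).
Definition omega2 (f xi : frame) : C := RtoC (sqrt 2) * snd (phi21 f xi).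
Definition omega3 (f xi : frame) : C := Cconj (snd (phi11 f xi)).

Definition kappa11 (f xi : frame) : C := Ci * RtoC (rho2 f xi - rho1 f xi)%R.
Definition kappa12 (f xi : frame) : C := - Cconj (tau f xi).
Definition kappa21 (f xi : frame) : C := tau f xi.
Definition kappa22 (f xi : frame) : C := - (Ci * RtoC (rho1 f xi + rho2 f xi)%R).

Definition pullback (alpha : frame -> frame -> C) (F : C -> frame) (z v : C) : C :=
  alpha (F z) (dH2 (fun u => e1 (F u)) z v, dH2 (fun u => e2 (F u)) z v).

(** * Pseudoholomorphic curves CP^1 -> CP^3 *)

(** Existence of smooth local homogeneous lifts. *)
Definition smooth_map (X : CP1 -> CP3) : Prop :=
  forall (k : bool) (z0 : C), exists (U : C -> Prop) (v : C -> H2),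
    open U /\ U z0 /\ smoothH2 U v /\
    (forall z : C, U z -> v z <> (zero : H2_C) /\
                          proj1_sig (X (chart k z)) = Cspan (v z : H2_C)).

(** [F] is a smooth section over the open set [U] of the chart [k] of the pulled-back
    frame bundle of [X]. *)
Definition local_frame (X : CP1 -> CP3) (k : bool) (U : C -> Prop) (F : C -> frame) : Prop :=
  open U /\ smoothH2 U (fun z => e1 (F z)) /\ smoothH2 U (fun z => e2 (F z)) /\
  (forall z : C, U z -> over (X (chart k z)) (F z)).

(** The values of omega_1, omega_2, omega_3 are the coordinates of dX(v) in the basis
    dual to them at the frame, and the almost complex structure of CP^3 is multiplication
    by i in these coordinates; so each component below says dX(iv) = J dX(v). *)
Definition pseudoholomorphic (X : CP1 -> CP3) : Prop :=
  smooth_map X /\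
  (exists x y : CP1, X x <> X y) /\
  (forall k U F, local_frame X k U F -> forall z : C, U z ->
     type10 (pullback omega1 F z) /\
     type10 (pullback omega2 F z) /\
     type10 (pullback omega3 F z)).

(** I_1 = 0. *)
Definition vertical (X : CP1 -> CP3) : Prop :=
  forall k U F, local_frame X k U F -> forall z : C, U z ->
    forall v : C, pullback omega1 F z v = 0 /\ pullback omega2 F z v = 0.

(** I_2 = 0. *)
Definition horizontal (X : CP1 -> CP3) : Prop :=
  forall k U F, local_frame X k U F -> forall z : C, U z ->
    forall v : C, pullback omega3 F z v = 0.

Definition image_is_twistor_fiber (X : CP1 -> CP3) : Prop :=
  exists P : HP1, forall p : CP3, (exists x : CP1, X x = p) <-> twistor p = P.

(** * Line subbundles of the horizontal bundle and null-torsion *)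

(** The horizontal bundle is associated to the frame bundle: given a frame [f] over X(x),
    a horizontal vector f_1bar s_1 + f_2bar s_2 is given by its coordinates (s_1, s_2) : C2.
    These change with the frame like the values of (omega_1, omega_2): since phi^2_1 for
    the frame (e_1 z, e_2 q) is qbar phi^2_1 z, the coordinates s_1 + j s_2 become
    qbar (s_1 + j s_2) z.  A subset of each fibre is thus a predicate [L x f s],
    invariant under simultaneous change of [f] and [s]. *)
Definition subset_H : Type := CP1 -> frame -> C2 -> Prop.

(** Local sections f_ibar s_i, with coordinates [s] in the frame [F], satisfying
    nabla^{0,1} = 0. *)
Definition holomorphic_section (U : C -> Prop) (F : C -> frame) (s : C -> C2) : Prop :=
  smoothQ U s /\
  (forall z : C, U z ->
     type10 (fun v => dC (fun u => fst (s u)) z v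
                      + pullback kappa11 F z v * fst (s z)
                      + pullback kappa12 F z v * snd (s z)) /\
     type10 (fun v => dC (fun u => snd (s u)) z v
                      + pullback kappa21 F z v * fst (s z)
                      + pullback kappa22 F z v * snd (s z))).

Definition holomorphic_line_subbundle (X : CP1 -> CP3) (L : subset_H) : Prop :=
  (forall x f, over (X x) f -> exists s : C2, s <> zero /\ L x f = Cspan s) /\
  (forall x f, over (X x) f -> forall (z : C) (q : quat),
     qmul (qconj (qC z)) (qC z) = qone -> qmul (qconj q) q = qone ->
     forall s : C2, L x f s <-> L x (act f z q) (qmul (qmul (qconj q) s) (qC z))) /\
  (forall (k : bool) (z0 : C), exists U F s,
     local_frame X k U F /\ U z0 /\ holomorphic_section U F s /\
     (forall z : C, U z -> s z <> zero /\ L (chart k z) (F z) (s z))).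

(** I_1 is a section of L (x) T^*M. *)
Definition contains_I1 (X : CP1 -> CP3) (L : subset_H) : Prop :=
  forall k U F, local_frame X k U F -> forall z : C, U z ->
    forall v : C, L (chart k z) (F z) (pullback omega1 F z v, pullback omega2 F z v).

(** Local sections of the bundle of adapted frames: those with f_2bar in L. *)
Definition adapted_frame (X : CP1 -> CP3) (L : subset_H) (k : bool) (U : C -> Prop)
    (F : C -> frame) : Prop :=
  local_frame X k U F /\
  (forall z : C, U z -> L (chart k z) (F z) (RtoC 0, RtoC 1)).

(** II = (f_1bar) (x) f_2 (x) kappa_12bar vanishes. *)
Definition II_zero (X : CP1 -> CP3) (L : subset_H) : Prop :=
  forall k U F, adapted_frame X L k U F -> forall z : C, U z ->
    forall v : C, pullback kappa12 F z v = 0.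

Definition null_torsion (X : CP1 -> CP3) : Prop :=
  ~ vertical X /\
  exists L : subset_H,
    holomorphic_line_subbundle X L /\ contains_I1 X L /\ II_zero X L.

(* Main.v *)
From Stdlib Require Import Reals Lra Lia Psatz Classical ClassicalEpsilon FunctionalExtensionality PropExtensionality ProofIrrelevance.
From Coquelicot Require Import Coquelicot.
Require Import Defs.

(** The map T o X : CP^1 -> HP^1 = S^4 is a conformal harmonic map (a possibly branched
minimal sphere), and the theorem is a consequence of Calabi's argument for minimal
spheres.  Write Phi for the coordinates of T o X in R^5, G for the complex bilinear
extension of the scalar product, and put Q = G(Phi_zz, Phi_zz).

- Conformality G(Phi_z, Phi_z) = 0 and harmonicity Phi_{z zbar} = nu Phi give
  dbar Q = 0 ([quartic_holomorphic]).  Changing the chart of CP^1 shows that Q dz^4 is a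
  holomorphic quartic differential on the sphere, so Q = 0 by Liouville ([quartic_zero]).
- In a frame with omega_1 = 0, that is with f_2bar in the line L spanned by I_1, a
  computation gives Q dz^4 = 2 omega_2^2 omega_3 kappa_12, the product of I_1^2, I_2 and
  II up to a constant ([quartic_adapted]).  Hence, at every point, one of I_1, I_2, II
  vanishes.

To conclude that one of them vanishes identically one needs unique continuation.  In a
local frame the coefficients of I_1, and those of I_2, solve a linear system
dbar f = A f with smooth A ([dbar_cf1], [dbar_cf2], [dbar_bef]).  For such systems an
Almgren type frequency function is monotone up to a bounded error ([frequency_ode],
[pair_frequency]); so a solution that does not vanish identically near a point has finite
order of vanishing there, and the set of points near which it vanishes is open and closed.
If X is neither vertical nor horizontal, I_1 and I_2 are therefore both nonzero on a dense
set, on which II = 0, and II = 0 everywhere by continuity ([lineL_II]).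

The definition of null-torsion also asks for the holomorphic line bundle L across the
zeros of I_1.  At such a zero p the system can be divided by z - p: iterating Hadamard's
lemma with the equation gives expansions f = (z - p) G + conj(z - p)^N H for all N, so that
f / (z - p) is smooth, and it solves the same system ([dbar_divide]).  The finite order
of vanishing bounds the number of divisions, whence I_1 = (z - p)^m b with b a nowhere zero
local holomorphic section ([system_factor]); it spans L.

Finally, if X is vertical then Phi_z = 0, so conj Phi is holomorphic and constant, and the
image of X lies in one fiber of T.  If it missed a point of this fiber, the conjugate of an
affine coordinate of X on the fiber minus that point would be holomorphic on CP^1, hence
constant, although X is not ([vertical_fiber]). *)

(** * Functions of class C^k on open subsets of the plane *)

Local Open Scope R_scope.

(** The plane with the product norm, so that the differentiability rules for products apply; its topology is that of [C]. *)
Definition R2 : NormedModule R_AbsRing :=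
  prod_NormedModule R_AbsRing R_NormedModule R_NormedModule.

Ltac intro2 x y := let h := fresh in intros h; change (R * R)%type in h; destruct h as [x y].
(** [ring] on the reals after unfolding the module operations left by the rules for differentials. *)
Ltac Rring := simpl; unfold scal, plus, mult, zero; simpl; unfold mult; simpl; match goal with |- @eq _ ?a ?b => change (@eq R a b) end; ring.

(** Total differentiability with partial derivatives [a] and [b].  The directional derivatives [dR] obey no chain rule; this notion does, and it agrees with [dR] for smooth functions. *)
Definition is_dR (f : C -> R) (z : C) (a b : R) : Prop :=
  filterdiff (U := R2) (V := R_NormedModule) f (locally (T := R2) z)
    (fun h : R2 => fst h * a + snd h * b).

Lemma is_dR_ext_lin f z a b a' b' : is_dR f z a b -> a = a' -> b = b' -> is_dR f z a' b'.
Proof. now intros h -> ->. Qed.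

Lemma is_dR_ext_loc f g z a b :
  locally z (fun u => f u = g u) -> is_dR f z a b -> is_dR g z a b.
Proof. intros h; apply filterdiff_ext_locally; exact h. Qed.

Lemma is_dR_continuous f z a b : is_dR f z a b -> continuous f z.
Proof. intros h; apply (filterdiff_continuous (K := R_AbsRing) (U := R2) (V := R_NormedModule));
  eexists; exact h. Qed.

Lemma is_dR_comp1 (g : R -> R) f z a b l :
  is_dR f z a b -> is_derive g (f z) l -> is_dR (fun u => g (f u)) z (a * l) (b * l).
Proof.
  intros hf hg.
  unfold is_dR.
  eapply filterdiff_ext_lin.
  { exact (filterdiff_comp' (U := R2) (V := R_NormedModule) (W := R_NormedModule) _ _ _ _ _ hf hg). }
  intro2 x y; Rring.
Qed.

Lemma is_dR_comp2 (g : C -> R) (p q : C -> R) z a b pa pb qa qb :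
  is_dR p z pa pb -> is_dR q z qa qb -> is_dR g (p z, q z) a b ->
  is_dR (fun u => g (p u, q u)) z (a * pa + b * qa) (a * pb + b * qb).
Proof.
  intros hp hq hg.
  unfold is_dR.
  eapply filterdiff_ext_lin.
  { refine (filterdiff_comp'_2 (T := R2) (U := R_NormedModule) (V := R_NormedModule) (W := R_NormedModule) p q (fun x y => g (x, y)) z _ _ (fun x y => x * a + y * b) hp hq _).
    eapply filterdiff_ext; [| exact hg]. now intros [x y]. }
  intro2 x y; Rring.
Qed.

Lemma is_dR_curve (g : C -> R) (p q : R -> R) t a b pa qa :
  is_derive p t pa -> is_derive q t qa -> is_dR g (p t, q t) a b ->
  is_derive (fun u => g (p u, q u)) t (a * pa + b * qa).
Proof.
  intros hp hq hg.
  unfold is_derive.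
  eapply filterdiff_ext_lin.
  { refine (filterdiff_comp'_2 p q (fun x y => g (x, y)) t _ _ (fun x y => x * a + y * b) hp hq _).
    eapply filterdiff_ext; [| exact hg]. now intros [x y]. }
  intros x; change R in x; Rring.
Qed.

Lemma is_dR_dir f z a b v : is_dR f z a b ->
  is_derive (fun t : R => f ((fst z + t * fst v)%R, (snd z + t * snd v)%R)) 0 (a * fst v + b * snd v).
Proof.
  intros h. apply (is_dR_curve f (fun t => fst z + t * fst v) (fun t => snd z + t * snd v)).
  - auto_derive; [easy | ring].
  - auto_derive; [easy | ring].
  - rewrite !Rmult_0_l, !Rplus_0_r, <- surjective_pairing; exact h.
Qed.

Lemma is_dR_dR f z a b v : is_dR f z a b -> dR f z v = a * fst v + b * snd v.
Proof. intros h; apply is_derive_unique, is_dR_dir, h. Qed.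

Lemma is_dR_ex_dR f z a b v : is_dR f z a b -> ex_dR f z v.
Proof. intros h; eexists; apply is_dR_dir, h. Qed.

Lemma is_dR_const c z : is_dR (fun _ => c) z 0 0.
Proof.
  eapply filterdiff_ext_lin; [apply (filterdiff_const (U := R2) (V := R_NormedModule)) |].
  intro2 x y; Rring.
Qed.

Lemma is_dR_fst z : is_dR fst z 1 0.
Proof.
  eapply filterdiff_ext_lin; [apply (filterdiff_linear (U := R2) (V := R_NormedModule)), is_linear_fst |].
  intro2 x y; Rring.
Qed.

Lemma is_dR_snd z : is_dR snd z 0 1.
Proof.
  eapply filterdiff_ext_lin; [apply (filterdiff_linear (U := R2) (V := R_NormedModule)), is_linear_snd |].
  intro2 x y; Rring.
Qed.

Lemma is_dR_plus f g z a b a' b' : is_dR f z a b -> is_dR g z a' b' ->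
  is_dR (fun u => f u + g u) z (a + a') (b + b').
Proof.
  intros hf hg.
  eapply filterdiff_ext_lin; [exact (filterdiff_plus_fct (U := R2) (V := R_NormedModule) _ _ _ _ hf hg) |].
  intro2 x y; Rring.
Qed.

Lemma is_dR_mult f g z a b a' b' : is_dR f z a b -> is_dR g z a' b' ->
  is_dR (fun u => f u * g u) z (a * g z + f z * a') (b * g z + f z * b').
Proof.
  intros hf hg.
  eapply filterdiff_ext_lin; [exact (filterdiff_mult_fct (K := R_AbsRing) (U := R2) _ _ _ _ _ Rmult_comm hf hg) |].
  intro2 x y; Rring.
Qed.

(** Continuity of one partial derivative is enough: the increment splits into a step in each direction, and the mean value theorem is only applied to one of the two. *)
Lemma is_dR_of_partials f z :
  locally z (fun u => ex_dR f u (RtoC 1)) -> ex_dR f z Ci ->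
  continuous (fun u => dR f u (RtoC 1)) z ->
  is_dR f z (dR f z (RtoC 1)) (dR f z Ci).
Proof.
  intros h1 h2 h3. destruct z as [x y].
  pose proof (is_derive_filterdiff (fun a b => f (a, b)) x y
     (fun a b => dR f (a, b) (RtoC 1)) (dR f (x, y) Ci)) as H.
  unfold is_dR. apply (filterdiff_ext (U := R2) (V := R_NormedModule)
    (fun u : R2 => f (fst u, snd u))); [now intros [a b] |].
  apply H; clear H; simpl.
  - apply filter_imp with (2 := h1). intros [a b] hd; simpl.
    apply Derive_correct in hd; simpl in hd.
    apply (is_derive_ext (fun s => (fun t => f (a + t * 1, b + t * 0)) (s - a))).
    { intros t; f_equal; f_equal; ring. }
    replace (dR f (a, b) 1) with (1 * Derive (fun t : R_AbsRing => f (a + t * 1, b + t * 0)) 0)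
      by (unfold dR; simpl; ring).
    apply (is_derive_comp (fun t => f (a + t * 1, b + t * 0)) (fun s => s - a)).
    + replace (a - a) with 0 by ring. exact hd.
    + auto_derive; [easy | ring].
  - apply Derive_correct in h2; simpl in h2.
    apply (is_derive_ext (fun s => (fun t => f (x + t * 0, y + t * 1)) (s - y))).
    { intros t; f_equal; f_equal; ring. }
    replace (dR f (x, y) Ci) with (1 * Derive (fun t : R_AbsRing => f (x + t * 0, y + t * 1)) 0)
      by (unfold dR; simpl; ring).
    apply (is_derive_comp (fun t => f (x + t * 0, y + t * 1)) (fun s => s - y)).
    + replace (y - y) with 0 by ring. exact h2.
    + auto_derive; [easy | ring].
  - apply (continuous_ext (fun u => dR f u (RtoC 1))); [now intros [a b] | exact h3].
Qed.

(** [Cn_on] refers to all directional derivatives and is awkward to propagate through products and compositions.  Two partial derivatives of a total differential suffice, and the two notions agree on open sets. *)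
Fixpoint Ck (n : nat) (U : C -> Prop) (f : C -> R) : Prop :=
  match n with
  | O => forall z, U z -> continuous f z
  | S m => exists fx fy, (forall z, U z -> is_dR f z (fx z) (fy z)) /\ Ck m U fx /\ Ck m U fy
  end.

Lemma Ck_continuous n U f z : Ck n U f -> U z -> continuous f z.
Proof.
  destruct n; simpl; [auto |].
  intros [fx [fy [h _]]] hz; eapply is_dR_continuous, h, hz.
Qed.

Lemma Ck_le_S n U f : Ck (S n) U f -> Ck n U f.
Proof.
  revert f; induction n as [|n IH]; intros f h.
  - intros z hz; eapply Ck_continuous; eauto.
  - destruct h as [fx [fy [h1 [h2 h3]]]]. exists fx, fy; auto.
Qed.

Lemma Ck_sub n (U V : C -> Prop) f : (forall z, V z -> U z) -> Ck n U f -> Ck n V f.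
Proof.
  intros hV; revert f; induction n as [|n IH]; simpl; intros f h; [intros z hz; auto |].
  destruct h as [fx [fy [h1 [h2 h3]]]]. exists fx, fy; auto.
Qed.

Lemma Ck_ext n (U : C -> Prop) f g : open U -> (forall z, U z -> f z = g z) -> Ck n U f -> Ck n U g.
Proof.
  intros hU e; destruct n as [|n]; simpl; intros h.
  - intros z hz. apply (continuous_ext_loc g f); [| auto].
    generalize (hU z hz); apply filter_imp; auto.
  - destruct h as [fx [fy [h1 [h2 h3]]]]. exists fx, fy; split; [| auto].
    intros z hz. apply is_dR_ext_loc with f; [| auto].
    generalize (hU z hz); apply filter_imp; auto.
Qed.

Lemma Ck_const n U c : Ck n U (fun _ => c).
Proof.
  revert c; induction n as [|n IH]; simpl; intros c.
  - intros z _; apply continuous_const.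
  - exists (fun _ => 0), (fun _ => 0); split; [| auto].
    intros z _; apply is_dR_const.
Qed.

Lemma Ck_fst n U : Ck n U fst.
Proof.
  destruct n as [|n]; simpl.
  - intros z _; eapply is_dR_continuous, is_dR_fst.
  - exists (fun _ => 1), (fun _ => 0); split; [| split; apply Ck_const].
    intros z _; apply is_dR_fst.
Qed.

Lemma Ck_snd n U : Ck n U snd.
Proof.
  destruct n as [|n]; simpl.
  - intros z _; eapply is_dR_continuous, is_dR_snd.
  - exists (fun _ => 0), (fun _ => 1); split; [| split; apply Ck_const].
    intros z _; apply is_dR_snd.
Qed.

Lemma Ck_plus n U f g : Ck n U f -> Ck n U g -> Ck n U (fun z => f z + g z).
Proof.
  revert f g; induction n as [|n IH]; intros f g hf hg.
  - intros z hz; apply (continuous_plus f g); auto.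
  - destruct hf as [fx [fy [f1 [f2 f3]]]], hg as [gx [gy [g1 [g2 g3]]]].
    exists (fun z => fx z + gx z), (fun z => fy z + gy z); split; [| auto].
    intros z hz; apply is_dR_plus; auto.
Qed.

Lemma Ck_mult n U f g : Ck n U f -> Ck n U g -> Ck n U (fun z => f z * g z).
Proof.
  revert f g; induction n as [|n IH]; intros f g hf hg.
  - intros z hz; apply (continuous_mult f g); auto.
  - pose proof (Ck_le_S _ _ _ hf) as hf'. pose proof (Ck_le_S _ _ _ hg) as hg'.
    destruct hf as [fx [fy [f1 [f2 f3]]]], hg as [gx [gy [g1 [g2 g3]]]].
    exists (fun z => fx z * g z + f z * gx z), (fun z => fy z * g z + f z * gy z).
    split; [| split; apply Ck_plus; auto].
    intros z hz; apply is_dR_mult; auto.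
Qed.

Lemma Ck_opp n U f : Ck n U f -> Ck n U (fun z => - f z).
Proof.
  intros h. assert (H := Ck_mult n U _ f (Ck_const n U (-1)) h).
  replace (fun z => - f z) with (fun z => -1 * f z); [exact H |].
  apply functional_extensionality; intros; ring.
Qed.

Lemma Ck_inv n U f : (forall z, U z -> f z <> 0) -> Ck n U f -> Ck n U (fun z => / f z).
Proof.
  intros h0; induction n as [|n IH]; intros hf.
  - intros z hz. apply (continuous_comp f Rinv); [auto | apply continuous_Rinv; auto].
  - pose proof (Ck_le_S _ _ _ hf) as hf'.
    destruct hf as [fx [fy [f1 [f2 f3]]]].
    exists (fun z => fx z * (- (/ f z * / f z))), (fun z => fy z * (- (/ f z * / f z))).
    split; [| split; apply Ck_mult; auto; apply Ck_opp, Ck_mult; auto].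
    intros z hz; apply (is_dR_comp1 Rinv); [auto |].
    specialize (h0 z hz).
    replace (- (/ f z * / f z)) with (-1 / f z ^ 2) by (field; auto).
    apply (is_derive_inv (fun x => x)); [apply (is_derive_id (K:=R_AbsRing)) | auto].
Qed.

Lemma Ck_sqrt n U f : (forall z, U z -> 0 < f z) -> Ck n U f -> Ck n U (fun z => sqrt (f z)).
Proof.
  intros h0; induction n as [|n IH]; intros hf.
  - intros z hz. apply (continuous_comp f sqrt); [auto | apply continuous_sqrt].
  - pose proof (Ck_le_S _ _ _ hf) as hf'.
    destruct hf as [fx [fy [f1 [f2 f3]]]].
    assert (hs : Ck n U (fun z => / (2 * sqrt (f z)))).
    { apply Ck_inv; [| apply Ck_mult; [apply Ck_const | auto]].
      intros z hz; specialize (sqrt_lt_R0 _ (h0 z hz)); lra. }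
    exists (fun z => fx z * / (2 * sqrt (f z))), (fun z => fy z * / (2 * sqrt (f z))).
    split; [| split; apply Ck_mult; auto].
    intros z hz; apply (is_dR_comp1 sqrt); [auto |].
    eapply filterdiff_ext_lin; [apply filterdiff_sqrt; auto |]. reflexivity.
Qed.

Lemma continuous_pair_C (p q : C -> R) (z : C) : continuous p z -> continuous q z ->
  continuous (fun u => (p u, q u) : C) z.
Proof.
  intros hp hq.
  apply (continuous_comp_2 p q (fun x y => (x, y) : C)); auto.
  apply continuous_ext with (fun u : R * R => u); [now intros [? ?] | apply continuous_id].
Qed.

Lemma Ck_comp2 n (U V : C -> Prop) g p q : (forall z, U z -> V (p z, q z)) ->
  Ck n U p -> Ck n U q -> Ck n V g -> Ck n U (fun z => g (p z, q z)).
Proof.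
  intros hV; revert g p q hV; induction n as [|n IH]; intros g p q hV hp hq hg.
  - intros z hz. apply (continuous_comp (fun u => (p u, q u) : C) g); [| now apply hg, hV].
    apply continuous_pair_C; auto.
  - pose proof (Ck_le_S _ _ _ hp) as hp'. pose proof (Ck_le_S _ _ _ hq) as hq'.
    destruct hp as [px [py [p1 [p2 p3]]]], hq as [qx [qy [q1 [q2 q3]]]], hg as [gx [gy [g1 [g2 g3]]]].
    exists (fun z => gx (p z, q z) * px z + gy (p z, q z) * qx z),
           (fun z => gx (p z, q z) * py z + gy (p z, q z) * qy z).
    split; [intros z hz; apply is_dR_comp2; auto |].
    split; apply Ck_plus; apply Ck_mult; auto.
Qed.

Lemma Cn_on_Ck n U f : open U -> Cn_on n U f -> Ck n U f.
Proof.
  intros hU; revert f; induction n as [|n IH]; intros f h; [exact h |].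
  exists (fun z => dR f z (RtoC 1)), (fun z => dR f z Ci).
  split; [| split; apply IH, h].
  intros z hz; apply is_dR_of_partials.
  - generalize (hU z hz); apply filter_imp; intros u hu; now apply h.
  - now apply h.
  - eapply Ck_continuous; [apply IH, h | auto].
Qed.

Lemma Cn_on_ext n (U : C -> Prop) f g : open U -> (forall z, U z -> f z = g z) -> Cn_on n U f -> Cn_on n U g.
Proof.
  intros hU; revert f g; induction n as [|n IH]; intros f g e h.
  - exact (Ck_ext 0 U f g hU e h).
  - assert (hloc : forall z v, U z -> locally 0 (fun t : R => f ((fst z + t * fst v)%R, (snd z + t * snd v)%R) = g ((fst z + t * fst v)%R, (snd z + t * snd v)%R))).
    { intros z v hz.
      assert (hc : continuous (fun t : R => ((fst z + t * fst v)%R, (snd z + t * snd v)%R) : C) 0).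
      { apply (continuous_comp_2 (fun t : R => fst z + t * fst v) (fun t : R => snd z + t * snd v) (fun x y => (x, y) : C)).
        - apply (ex_derive_continuous (fun t : R => fst z + t * fst v)); auto_derive; easy.
        - apply (ex_derive_continuous (fun t : R => snd z + t * snd v)); auto_derive; easy.
        - apply continuous_ext with (fun u : R * R => u); [now intros [? ?] | apply continuous_id]. }
      assert (hl : locally z (fun u => f u = g u)) by (generalize (hU z hz); apply filter_imp; auto).
      apply (hc (fun u => f u = g u)). rewrite !Rmult_0_l, !Rplus_0_r, <- surjective_pairing. exact hl. }
    intros v; destruct (h v) as [h1 h2]; split.
    + intros z hz. eapply ex_derive_ext_loc; [apply hloc, hz | apply h1, hz].
    + eapply IH; [| exact h2]. intros z hz. apply Derive_ext_loc, hloc, hz.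
Qed.

Lemma Ck_Cn_on n U f : open U -> Ck n U f -> Cn_on n U f.
Proof.
  intros hU; revert f; induction n as [|n IH]; intros f h; [exact h |].
  destruct h as [fx [fy [h1 [h2 h3]]]]. intros v; split.
  - intros z hz; eapply is_dR_ex_dR, h1, hz.
  - apply (Cn_on_ext _ _ (fun z => fx z * fst v + fy z * snd v) _ hU).
    + intros z hz; symmetry; apply is_dR_dR, h1, hz.
    + apply IH, Ck_plus; apply Ck_mult; auto; apply Ck_const.
Qed.

Lemma smoothR_Ck U f : open U -> smoothR U f <-> (forall n, Ck n U f).
Proof.
  intros hU; split; intros h n; [apply Cn_on_Ck | apply Ck_Cn_on]; auto.
Qed.

Lemma smoothR_is_dR U f z : open U -> smoothR U f -> U z -> is_dR f z (dR f z (RtoC 1)) (dR f z Ci).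
Proof.
  intros hU h hz. destruct (Cn_on_Ck _ _ _ hU (h 1%nat)) as [fx [fy [h1 _]]].
  pose proof (h1 z hz) as H.
  rewrite (is_dR_dR _ _ _ _ (RtoC 1) H), (is_dR_dR _ _ _ _ Ci H).
  eapply is_dR_ext_lin; [exact H | |]; simpl; ring.
Qed.

Lemma smoothR_dR U f v : smoothR U f -> smoothR U (fun z => dR f z v).
Proof. intros h n; exact (proj2 (h (S n) v)). Qed.

Lemma smoothR_continuous U f z : open U -> smoothR U f -> U z -> continuous f z.
Proof. intros hU h hz; exact (h 0%nat z hz). Qed.

Lemma smoothR_ext U f g : open U -> (forall z, U z -> f z = g z) -> smoothR U f -> smoothR U g.
Proof. intros hU e h n; eapply Cn_on_ext; eauto. Qed.

Lemma smoothR_sub (U V : C -> Prop) f : open U -> open V -> (forall z, V z -> U z) -> smoothR U f -> smoothR V f.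
Proof. intros hU hV s; rewrite !smoothR_Ck by auto; intros h n; eapply Ck_sub; eauto. Qed.

Lemma smoothR_loc U f : open U ->
  (forall z, U z -> exists V : C -> Prop, open V /\ V z /\ smoothR V f) -> smoothR U f.
Proof.
  intros hU h n. revert f h; induction n as [|n IH]; intros f h.
  - intros z hz; destruct (h z hz) as [V [hV [hz' hs]]]. exact (hs 0%nat z hz').
  - intros v; split.
    + intros z hz; destruct (h z hz) as [V [hV [hz' hs]]]. exact (proj1 (hs 1%nat v) z hz').
    + apply IH; intros z hz; destruct (h z hz) as [V [hV [hz' hs]]].
      exists V; repeat split; auto. now apply smoothR_dR.
Qed.

Lemma smoothR_const U c : open U -> smoothR U (fun _ => c).
Proof. intros hU; apply smoothR_Ck; auto; intros; apply Ck_const. Qed.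
Lemma smoothR_plus U f g : open U -> smoothR U f -> smoothR U g -> smoothR U (fun z => f z + g z).
Proof. intros hU; rewrite !smoothR_Ck by auto; intros h h' n; apply Ck_plus; auto. Qed.
Lemma smoothR_mult U f g : open U -> smoothR U f -> smoothR U g -> smoothR U (fun z => f z * g z).
Proof. intros hU; rewrite !smoothR_Ck by auto; intros h h' n; apply Ck_mult; auto. Qed.
Lemma smoothR_opp U f : open U -> smoothR U f -> smoothR U (fun z => - f z).
Proof. intros hU; rewrite !smoothR_Ck by auto; intros h n; apply Ck_opp; auto. Qed.
Lemma smoothR_minus U f g : open U -> smoothR U f -> smoothR U g -> smoothR U (fun z => f z - g z).
Proof. intros hU h h'; apply smoothR_plus; [| | apply smoothR_opp]; auto. Qed.
Lemma smoothR_inv U f : open U -> (forall z, U z -> f z <> 0) -> smoothR U f -> smoothR U (fun z => / f z).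
Proof. intros hU h0; rewrite !smoothR_Ck by auto; intros h n; apply Ck_inv; auto. Qed.
Lemma smoothR_sqrt U f : open U -> (forall z, U z -> 0 < f z) -> smoothR U f -> smoothR U (fun z => sqrt (f z)).
Proof. intros hU h0; rewrite !smoothR_Ck by auto; intros h n; apply Ck_sqrt; auto. Qed.
Lemma smoothR_fst U : open U -> smoothR U fst.
Proof. intros hU; apply smoothR_Ck; auto; intros; apply Ck_fst. Qed.
Lemma smoothR_snd U : open U -> smoothR U snd.
Proof. intros hU; apply smoothR_Ck; auto; intros; apply Ck_snd. Qed.
Lemma smoothR_comp (U V : C -> Prop) g (p : C -> C) : open U -> open V -> (forall z, U z -> V (p z)) ->
  smoothC U p -> smoothR V g -> smoothR U (fun z => g (p z)).
Proof.
  intros hU hV s [h1 h2] h3. unfold Re, Im in *.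
  rewrite smoothR_Ck in h1, h2, h3 |- * by auto.
  intros n.
  replace (fun z => g (p z)) with (fun z => g (fst (p z), snd (p z)))
    by (apply functional_extensionality; intros z; now rewrite <- surjective_pairing).
  apply Ck_comp2 with V; auto.
  intros z hz; rewrite <- surjective_pairing; auto.
Qed.

Lemma dR_linear U f z v : open U -> smoothR U f -> U z ->
  dR f z v = dR f z (RtoC 1) * fst v + dR f z Ci * snd v.
Proof. intros hU h hz; apply is_dR_dR, (smoothR_is_dR U); auto. Qed.

Lemma dR_ext_loc f g z v : locally z (fun u => f u = g u) -> dR f z v = dR g z v.
Proof.
  intros h; apply Derive_ext_loc.
  assert (hc : continuous (fun t : R => ((fst z + t * fst v)%R, (snd z + t * snd v)%R) : C) 0).
  { apply (continuous_comp_2 (fun t : R => fst z + t * fst v) (fun t : R => snd z + t * snd v) (fun x y => (x, y) : C)).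
    - apply (ex_derive_continuous (fun t : R => fst z + t * fst v)); auto_derive; easy.
    - apply (ex_derive_continuous (fun t : R => snd z + t * snd v)); auto_derive; easy.
    - apply continuous_ext with (fun u : R * R => u); [now intros [? ?] | apply continuous_id]. }
  apply (hc (fun u => f u = g u)). rewrite !Rmult_0_l, !Rplus_0_r, <- surjective_pairing. exact h.
Qed.

(** * Wirtinger derivatives *)

Local Open Scope C_scope.

(** [df = p dz + q dzbar], that is [p] and [q] are the Wirtinger derivatives of [f]. *)
Definition is_W (f : C -> C) (z p q : C) : Prop :=
  is_dR (fun u => fst (f u)) z (fst p + fst q)%R (snd q - snd p)%R /\
  is_dR (fun u => snd (f u)) z (snd p + snd q)%R (fst p - fst q)%R.

(** The Wirtinger derivative (d/dx - i d/dy) / 2. *)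
Definition Dz (f : C -> C) (z : C) : C :=
  (((dR (fun u => fst (f u)) z (RtoC 1) + dR (fun u => snd (f u)) z Ci) / 2)%R,
   ((dR (fun u => snd (f u)) z (RtoC 1) - dR (fun u => fst (f u)) z Ci) / 2)%R).

(** The Cauchy-Riemann operator (d/dx + i d/dy) / 2. *)
Definition Dzb (f : C -> C) (z : C) : C :=
  (((dR (fun u => fst (f u)) z (RtoC 1) - dR (fun u => snd (f u)) z Ci) / 2)%R,
   ((dR (fun u => snd (f u)) z (RtoC 1) + dR (fun u => fst (f u)) z Ci) / 2)%R).

Lemma is_W_eq f z p q p' q' : is_W f z p q -> p = p' -> q = q' -> is_W f z p' q'.
Proof. now intros h -> ->. Qed.

Lemma is_W_ext_loc f g z p q : locally z (fun u => f u = g u) -> is_W f z p q -> is_W g z p q.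
Proof.
  intros e [h1 h2]; split; [apply is_dR_ext_loc with (2 := h1) | apply is_dR_ext_loc with (2 := h2)];
    apply filter_imp with (2 := e); intros u hu; now rewrite hu.
Qed.

Lemma is_W_dC f z p q v : is_W f z p q -> dC f z v = p * v + q * Cconj v.
Proof.
  intros [h1 h2]; unfold dC, Re, Im.
  rewrite (is_dR_dR _ _ _ _ v h1), (is_dR_dR _ _ _ _ v h2).
  destruct p, q, v; apply injective_projections; simpl; ring.
Qed.

Lemma is_W_unique f z p q : is_W f z p q -> Dz f z = p /\ Dzb f z = q.
Proof.
  intros [h1 h2]; unfold Dz, Dzb.
  rewrite (is_dR_dR _ _ _ _ (RtoC 1) h1), (is_dR_dR _ _ _ _ (RtoC 1) h2).
  rewrite (is_dR_dR _ _ _ _ Ci h1), (is_dR_dR _ _ _ _ Ci h2).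
  destruct p, q; split; apply injective_projections; simpl; field.
Qed.

Lemma is_W_Dz f z p q : is_W f z p q -> Dz f z = p.
Proof. intros h; apply (is_W_unique _ _ _ _ h). Qed.
Lemma is_W_Dzb f z p q : is_W f z p q -> Dzb f z = q.
Proof. intros h; apply (is_W_unique _ _ _ _ h). Qed.

Lemma is_W_continuous f z p q : is_W f z p q -> continuous f z.
Proof.
  intros [h1 h2].
  apply continuous_ext with (fun u => (fst (f u), snd (f u)) : C);
    [intros; now rewrite <- surjective_pairing |].
  apply continuous_pair_C; eapply is_dR_continuous; eassumption.
Qed.

Lemma is_W_const c z : is_W (fun _ => c) z 0 0.
Proof. split; (eapply is_dR_ext_lin; [apply is_dR_const | |]; simpl; ring). Qed.

Lemma is_W_id z : is_W (fun u => u) z 1 0.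
Proof.
  split; (eapply is_dR_ext_lin; [first [apply is_dR_fst | apply is_dR_snd] | |]; simpl; ring).
Qed.

Lemma is_W_plus f g z p q p' q' : is_W f z p q -> is_W g z p' q' ->
  is_W (fun u => f u + g u) z (p + p') (q + q').
Proof.
  intros [f1 f2] [g1 g2]; split; simpl.
  - eapply is_dR_ext_lin; [apply (is_dR_plus _ _ _ _ _ _ _ f1 g1) | |]; simpl; ring.
  - eapply is_dR_ext_lin; [apply (is_dR_plus _ _ _ _ _ _ _ f2 g2) | |]; simpl; ring.
Qed.

Lemma is_dR_scal c f z a b : is_dR f z a b -> is_dR (fun u => c * f u)%R z (c * a)%R (c * b)%R.
Proof.
  intros h. eapply is_dR_ext_lin; [apply (is_dR_mult _ _ _ _ _ _ _ (is_dR_const c z) h) | |]; simpl; ring.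
Qed.

Lemma is_dR_opp f z a b : is_dR f z a b -> is_dR (fun u => - f u)%R z (- a)%R (- b)%R.
Proof.
  intros h. apply is_dR_ext_loc with (fun u => -1 * f u)%R.
  - apply filter_forall; intros; ring.
  - eapply is_dR_ext_lin; [apply is_dR_scal, h | |]; simpl; ring.
Qed.

Lemma is_W_opp f z p q : is_W f z p q -> is_W (fun u => - f u) z (- p) (- q).
Proof.
  intros [f1 f2]; split; simpl.
  - eapply is_dR_ext_lin; [apply (is_dR_opp _ _ _ _ f1) | |]; simpl; ring.
  - eapply is_dR_ext_lin; [apply (is_dR_opp _ _ _ _ f2) | |]; simpl; ring.
Qed.

Lemma is_W_minus f g z p q p' q' : is_W f z p q -> is_W g z p' q' ->
  is_W (fun u => f u - g u) z (p - p') (q - q').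
Proof. intros hf hg; apply is_W_plus; [| apply is_W_opp]; assumption. Qed.

Lemma is_W_conj f z p q : is_W f z p q -> is_W (fun u => Cconj (f u)) z (Cconj q) (Cconj p).
Proof.
  intros [f1 f2]; split; simpl.
  - eapply is_dR_ext_lin; [apply f1 | |]; simpl; ring.
  - eapply is_dR_ext_lin; [apply (is_dR_opp _ _ _ _ f2) | |]; simpl; ring.
Qed.

Lemma is_W_mult f g z p q p' q' : is_W f z p q -> is_W g z p' q' ->
  is_W (fun u => f u * g u) z (p * g z + f z * p') (q * g z + f z * q').
Proof.
  intros [f1 f2] [g1 g2]; split; simpl.
  - eapply is_dR_ext_lin;
      [apply (is_dR_plus _ _ _ _ _ _ _ (is_dR_mult _ _ _ _ _ _ _ f1 g1)
               (is_dR_opp _ _ _ _ (is_dR_mult _ _ _ _ _ _ _ f2 g2))) | |]; simpl; ring.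
  - eapply is_dR_ext_lin;
      [apply (is_dR_plus _ _ _ _ _ _ _ (is_dR_mult _ _ _ _ _ _ _ f1 g2)
               (is_dR_mult _ _ _ _ _ _ _ f2 g1)) | |]; simpl; ring.
Qed.

Lemma is_W_comp f g z p q a b : is_W g z a b -> is_W f (g z) p q ->
  is_W (fun u => f (g u)) z (p * a + q * Cconj b) (p * b + q * Cconj a).
Proof.
  intros [g1 g2] [f1 f2].
  assert (e : (fun u => f (g u)) = fun u => f (fst (g u), snd (g u)))
    by (apply functional_extensionality; intros u; now rewrite <- surjective_pairing).
  rewrite e. rewrite (surjective_pairing (g z)) in f1, f2.
  split; simpl.
  - eapply is_dR_ext_lin;
      [apply (is_dR_comp2 (fun x => fst (f x)) _ _ _ _ _ _ _ _ _ g1 g2 f1) | |]; simpl; ring.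
  - eapply is_dR_ext_lin;
      [apply (is_dR_comp2 (fun x => snd (f x)) _ _ _ _ _ _ _ _ _ g1 g2 f2) | |]; simpl; ring.
Qed.

Lemma is_dR_inv f z a b : f z <> 0%R -> is_dR f z a b ->
  is_dR (fun u => / f u)%R z (- a / (f z * f z))%R (- b / (f z * f z))%R.
Proof.
  intros h0 h. eapply is_dR_ext_lin.
  - apply (is_dR_comp1 Rinv f z a b (- 1 / (f z) ^ 2)%R h).
    apply (is_derive_inv (fun x => x)); [apply (is_derive_id (K:=R_AbsRing)) | auto].
  - field; auto.
  - field; auto.
Qed.

Lemma sqnorm_neq0 (z : C) : z <> 0 -> (fst z ^ 2 + snd z ^ 2 <> 0)%R.
Proof.
  intros h e; apply h. destruct z as [x y]; simpl in e.
  assert (x = 0 /\ y = 0)%R as [-> ->] by (split; nra). reflexivity.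
Qed.

Lemma is_W_inv (f : C -> C) z p q : f z <> 0 -> is_W f z p q ->
  is_W (fun u => / f u) z (- p / (f z * f z)) (- q / (f z * f z)).
Proof.
  intros h0 [f1 f2]. pose proof (sqnorm_neq0 _ h0) as h2.
  assert (hn := is_dR_plus _ _ _ _ _ _ _ (is_dR_mult _ _ _ _ _ _ _ f1 f1) (is_dR_mult _ _ _ _ _ _ _ f2 f2)).
  simpl in hn.
  assert (hn0 : (fst (f z) * fst (f z) + snd (f z) * snd (f z) <> 0)%R) by (intro; apply h2; simpl; lra).
  assert (hi := is_dR_inv _ _ _ _ hn0 hn); simpl in hi.
  assert (h3 : ((fst (f z) * fst (f z) - snd (f z) * snd (f z)) * (fst (f z) * fst (f z) - snd (f z) * snd (f z)) +
      (fst (f z) * snd (f z) + snd (f z) * fst (f z)) * (fst (f z) * snd (f z) + snd (f z) * fst (f z)) <> 0)%R).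
  { replace (_ + _)%R with ((fst (f z) * fst (f z) + snd (f z) * snd (f z)) *(fst (f z) * fst (f z) + snd (f z) * snd (f z)))%R by ring.
    now apply Rmult_integral_contrapositive. }
  split.
  - apply is_dR_ext_loc with (fun u => fst (f u) * / (fst (f u) * fst (f u) + snd (f u) * snd (f u)))%R.
    { apply filter_forall; intros u; unfold Cinv, Rdiv; simpl. now rewrite !Rmult_1_r. }
    eapply is_dR_ext_lin; [apply (is_dR_mult _ _ _ _ _ _ _ f1 hi) | |]; simpl; field; rewrite ?Rmult_1_r; auto.
  - apply is_dR_ext_loc with (fun u => (- snd (f u)) * / (fst (f u) * fst (f u) + snd (f u) * snd (f u)))%R.
    { apply filter_forall; intros u; unfold Cinv, Rdiv; simpl. now rewrite !Rmult_1_r. }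
    eapply is_dR_ext_lin; [apply (is_dR_mult _ _ _ _ _ _ _ (is_dR_opp _ _ _ _ f2) hi) | |]; simpl; field; rewrite ?Rmult_1_r; auto.
Qed.

Lemma smoothC_W U f z : open U -> smoothC U f -> U z -> is_W f z (Dz f z) (Dzb f z).
Proof.
  intros hU [h1 h2] hz; split.
  - eapply is_dR_ext_lin; [apply (smoothR_is_dR U _ _ hU h1 hz) | |]; unfold Dz, Dzb, Re, Im; simpl; field.
  - eapply is_dR_ext_lin; [apply (smoothR_is_dR U _ _ hU h2 hz) | |]; unfold Dz, Dzb, Re, Im; simpl; field.
Qed.

Lemma smoothC_continuous U f z : open U -> smoothC U f -> U z -> continuous f z.
Proof. intros hU h hz; eapply is_W_continuous, smoothC_W; eauto. Qed.

Lemma smoothC_ext U f g : open U -> (forall z, U z -> f z = g z) -> smoothC U f -> smoothC U g.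
Proof.
  intros hU e [h1 h2]; split.
  - eapply smoothR_ext; [exact hU | | exact h1]; intros z hz; simpl; now rewrite e.
  - eapply smoothR_ext; [exact hU | | exact h2]; intros z hz; simpl; now rewrite e.
Qed.
Lemma smoothC_sub (U V : C -> Prop) f : open U -> open V -> (forall z, V z -> U z) -> smoothC U f -> smoothC V f.
Proof. intros hU hV s [h1 h2]; split; apply (smoothR_sub U); auto. Qed.
Lemma smoothC_loc U f : open U ->
  (forall z, U z -> exists V : C -> Prop, open V /\ V z /\ smoothC V f) -> smoothC U f.
Proof.
  intros hU h; split; apply smoothR_loc; auto; intros z hz; destruct (h z hz) as [V [h1 [h2 [h3 h4]]]]; exists V; auto.
Qed.
Lemma smoothC_const U c : open U -> smoothC U (fun _ => c).
Proof. intros hU; split; now apply smoothR_const. Qed.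
Lemma smoothC_id U : open U -> smoothC U (fun z => z).
Proof. intros hU; split; [now apply smoothR_fst | now apply smoothR_snd]. Qed.
Lemma smoothC_plus U f g : open U -> smoothC U f -> smoothC U g -> smoothC U (fun z => f z + g z).
Proof. intros hU [] []; split; now apply smoothR_plus. Qed.
Lemma smoothC_opp U f : open U -> smoothC U f -> smoothC U (fun z => - f z).
Proof. intros hU []; split; now apply smoothR_opp. Qed.
Lemma smoothC_minus U f g : open U -> smoothC U f -> smoothC U g -> smoothC U (fun z => f z - g z).
Proof. intros hU ? ?; apply smoothC_plus; [| | apply smoothC_opp]; auto. Qed.
Lemma smoothC_conj U f : open U -> smoothC U f -> smoothC U (fun z => Cconj (f z)).
Proof. intros hU []; split; [| apply smoothR_opp]; auto. Qed.
Lemma smoothC_mult U f g : open U -> smoothC U f -> smoothC U g -> smoothC U (fun z => f z * g z).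
Proof.
  intros hU [] []; split; [apply smoothR_minus | apply smoothR_plus]; auto; apply smoothR_mult; auto.
Qed.
Lemma smoothC_inv U (f : C -> C) : open U -> (forall z, U z -> f z <> 0) -> smoothC U f -> smoothC U (fun z => / f z).
Proof.
  intros hU h0 [h1 h2].
  assert (hn : smoothR U (fun z => / (Re (f z) * Re (f z) + Im (f z) * Im (f z)))%R).
  { apply smoothR_inv; auto.
    - intros z hz. specialize (sqnorm_neq0 _ (h0 z hz)). unfold Re, Im. simpl. now rewrite !Rmult_1_r.
    - apply smoothR_plus; auto; apply smoothR_mult; auto. }
  split.
  - eapply smoothR_ext; [auto | | apply (smoothR_mult U _ _ hU h1 hn)].
    intros z hz; unfold Cinv, Rdiv, Re, Im; simpl; now rewrite !Rmult_1_r.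
  - eapply smoothR_ext; [auto | | apply (smoothR_mult U _ _ hU (smoothR_opp U _ hU h2) hn)].
    intros z hz; unfold Cinv, Rdiv, Re, Im; simpl; now rewrite !Rmult_1_r.
Qed.
Lemma smoothC_comp (U V : C -> Prop) g p : open U -> open V -> (forall z, U z -> V (p z)) ->
  smoothC U p -> smoothC V g -> smoothC U (fun z => g (p z)).
Proof.
  intros hU hV s hp [g1 g2]; split.
  - now apply (smoothR_comp U V (fun z => Re (g z))).
  - now apply (smoothR_comp U V (fun z => Im (g z))).
Qed.
Lemma smoothC_RtoC U f : open U -> smoothR U f -> smoothC U (fun z => RtoC (f z)).
Proof. intros hU h; split; [exact h | exact (smoothR_const U 0%R hU)]. Qed.

Lemma smoothC_Dz U f : open U -> smoothC U f -> smoothC U (Dz f).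
Proof.
  intros hU [h1 h2].
  assert (h : smoothR U (fun _ => / 2)%R) by now apply smoothR_const.
  split.
  - exact (smoothR_mult U _ _ hU (smoothR_plus U _ _ hU (smoothR_dR _ _ (RtoC 1) h1) (smoothR_dR _ _ Ci h2)) h).
  - exact (smoothR_mult U _ _ hU (smoothR_minus U _ _ hU (smoothR_dR _ _ (RtoC 1) h2) (smoothR_dR _ _ Ci h1)) h).
Qed.
Lemma smoothC_Dzb U f : open U -> smoothC U f -> smoothC U (Dzb f).
Proof.
  intros hU [h1 h2].
  assert (h : smoothR U (fun _ => / 2)%R) by now apply smoothR_const.
  split.
  - exact (smoothR_mult U _ _ hU (smoothR_minus U _ _ hU (smoothR_dR _ _ (RtoC 1) h1) (smoothR_dR _ _ Ci h2)) h).
  - exact (smoothR_mult U _ _ hU (smoothR_plus U _ _ hU (smoothR_dR _ _ (RtoC 1) h2) (smoothR_dR _ _ Ci h1)) h).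
Qed.

Lemma dR_Derive_x f (u v : R) : dR f (u, v) (RtoC 1) = Derive (fun t => f (t, v)) u.
Proof.
  unfold dR; simpl. unfold Derive. f_equal. apply Lim_ext. intros y.
  replace (u + (0 + y) * 1)%R with (u + y)%R by ring.
  replace (v + (0 + y) * 0)%R with v by ring.
  replace (u + 0 * 1)%R with u by ring.
  now replace (v + 0 * 0)%R with v by ring.
Qed.
Lemma dR_Derive_y f (u v : R) : dR f (u, v) Ci = Derive (fun t => f (u, t)) v.
Proof.
  unfold dR; simpl. unfold Derive. f_equal. apply Lim_ext. intros y.
  replace (v + (0 + y) * 1)%R with (v + y)%R by ring.
  replace (u + (0 + y) * 0)%R with u by ring.
  replace (v + 0 * 1)%R with v by ring.
  now replace (u + 0 * 0)%R with u by ring.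
Qed.

Lemma is_dR_derive_x f (x y : R) a b : is_dR f (x, y) a b -> is_derive (fun t => f (t, y)) x a.
Proof.
  intros h. replace a with (a * 1 + b * 0)%R by ring.
  apply (is_dR_curve f (fun t => t) (fun _ => y)); [apply (is_derive_id (K:=R_AbsRing)) | apply (is_derive_const (K:=R_AbsRing) (V:=R_NormedModule)) | exact h].
Qed.
Lemma is_dR_derive_y f (x y : R) a b : is_dR f (x, y) a b -> is_derive (fun t => f (x, t)) y b.
Proof.
  intros h. replace b with (a * 0 + b * 1)%R by ring.
  apply (is_dR_curve f (fun _ => x) (fun t => t)); [apply (is_derive_const (K:=R_AbsRing) (V:=R_NormedModule)) | apply (is_derive_id (K:=R_AbsRing)) | exact h].
Qed.

(** Symmetry of second derivatives; all the d-bar equations below come from it. *)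
Lemma dR_comm U f z : open U -> smoothR U f -> U z ->
  dR (fun u => dR f u (RtoC 1)) z Ci = dR (fun u => dR f u Ci) z (RtoC 1).
Proof.
  intros hU hf hz. destruct z as [x y].
  rewrite dR_Derive_x, dR_Derive_y.
  rewrite (Derive_ext (fun t => dR f (x, t) 1) (fun t => Derive (fun s => f (s, t)) x))
    by (intros t; apply dR_Derive_x).
  rewrite (Derive_ext (fun t => dR f (t, y) Ci) (fun t => Derive (fun s => f (t, s)) y))
    by (intros t; apply dR_Derive_y).
  symmetry. apply (Schwarz (fun a b => f (a, b)) x y).
  - apply locally_2d_locally. apply filter_imp with (2 := hU _ hz).
    intros [u v] huv; simpl.
    pose proof (smoothR_is_dR U f _ hU hf huv) as H0.
    pose proof (smoothR_is_dR U _ _ hU (smoothR_dR U f (RtoC 1) hf) huv) as H1.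
    pose proof (smoothR_is_dR U _ _ hU (smoothR_dR U f Ci hf) huv) as H2.
    repeat split.
    + eexists; eapply is_dR_derive_x, H0.
    + eexists; eapply is_dR_derive_y, H0.
    + apply (ex_derive_ext (fun t => dR f (t, v) Ci)); [intros; apply dR_Derive_y |].
      eexists; eapply (is_dR_derive_x (fun w => dR f w Ci)), H2.
    + apply (ex_derive_ext (fun t => dR f (u, t) (RtoC 1))); [intros; apply dR_Derive_x |].
      eexists; eapply (is_dR_derive_y (fun w => dR f w (RtoC 1))), H1.
  - apply continuity_2d_pt_filterlim.
    apply (continuous_ext (fun w => dR (fun u => dR f u Ci) w (RtoC 1))).
    + intros [u v]; simpl. rewrite dR_Derive_x. apply Derive_ext; intros; apply dR_Derive_y.
    + apply (smoothR_continuous U); auto. now apply smoothR_dR, smoothR_dR.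
  - apply continuity_2d_pt_filterlim.
    apply (continuous_ext (fun w => dR (fun u => dR f u (RtoC 1)) w Ci)).
    + intros [u v]; simpl. rewrite dR_Derive_y. apply Derive_ext; intros; apply dR_Derive_x.
    + apply (smoothR_continuous U); auto. now apply smoothR_dR, smoothR_dR.
Qed.

Lemma Dz_Dzb_comm U f z : open U -> smoothC U f -> U z -> Dz (Dzb f) z = Dzb (Dz f) z.
Proof.
  intros hU [h1 h2] hz. unfold Re, Im in *.
  set (a := fun z => dR (fun u => fst (f u)) z (RtoC 1)).
  set (b := fun z => dR (fun u => fst (f u)) z Ci).
  set (c := fun z => dR (fun u => snd (f u)) z (RtoC 1)).
  set (d := fun z => dR (fun u => snd (f u)) z Ci).
  assert (ha := smoothR_is_dR U a z hU (smoothR_dR U _ _ h1) hz).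
  assert (hb := smoothR_is_dR U b z hU (smoothR_dR U _ _ h1) hz).
  assert (hc := smoothR_is_dR U c z hU (smoothR_dR U _ _ h2) hz).
  assert (hd := smoothR_is_dR U d z hU (smoothR_dR U _ _ h2) hz).
  assert (e1 := dR_comm U _ z hU h1 hz). assert (e2 := dR_comm U _ z hU h2 hz).
  fold a b c d in e1, e2.
  change (dR a z Ci = dR b z (RtoC 1)) in e1. change (dR c z Ci = dR d z (RtoC 1)) in e2.
  set (ax := dR a z (RtoC 1)) in *. set (ay := dR a z Ci) in *.
  set (bx := dR b z (RtoC 1)) in *. set (by' := dR b z Ci) in *.
  set (cx := dR c z (RtoC 1)) in *. set (cy := dR c z Ci) in *.
  set (dx := dR d z (RtoC 1)) in *. set (dy := dR d z Ci) in *.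
  assert (k1 : is_dR (fun u => / 2 * (a u + d u))%R z (/ 2 * (ax + dx)) (/ 2 * (ay + dy)))
    by now apply is_dR_scal, is_dR_plus.
  assert (k2 : is_dR (fun u => / 2 * (c u + - b u))%R z (/ 2 * (cx + - bx)) (/ 2 * (cy + - by')))
    by now apply is_dR_scal, is_dR_plus; [| apply is_dR_opp].
  assert (k3 : is_dR (fun u => / 2 * (a u + - d u))%R z (/ 2 * (ax + - dx)) (/ 2 * (ay + - dy)))
    by now apply is_dR_scal, is_dR_plus; [| apply is_dR_opp].
  assert (k4 : is_dR (fun u => / 2 * (c u + b u))%R z (/ 2 * (cx + bx)) (/ 2 * (cy + by')))
    by now apply is_dR_scal, is_dR_plus.
  assert (w1 : is_W (Dz f) z (((ax + dx + cy + - by') / 4)%R, ((cx + - bx - ay - dy)/4)%R)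
                            (((ax + dx - cy - - by') / 4)%R, ((cx + - bx + ay + dy)/4)%R)).
  { split.
      apply is_dR_ext_loc with (fun u => / 2 * (a u + d u))%R.
      { apply filter_forall; intros; unfold Dz, a, d; simpl; field. }
      eapply is_dR_ext_lin; [exact k1 | |]; simpl; field.
    - apply is_dR_ext_loc with (fun u => / 2 * (c u + - b u))%R.
      { apply filter_forall; intros; unfold Dz, b, c; simpl; field. }
      eapply is_dR_ext_lin; [exact k2 | |]; simpl; field. }
  assert (w2 : is_W (Dzb f) z (((ax - dx + cy + by') / 4)%R, ((cx + bx - ay + dy)/4)%R)
                            (((ax - dx - cy - by') / 4)%R, ((cx + bx + ay - dy)/4)%R)).
  { split.
    - apply is_dR_ext_loc with (fun u => / 2 * (a u + - d u))%R.
      { apply filter_forall; intros; unfold Dzb, a, d; simpl; field. }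
      eapply is_dR_ext_lin; [exact k3 | |]; simpl; field.
    - apply is_dR_ext_loc with (fun u => / 2 * (c u + b u))%R.
      { apply filter_forall; intros; unfold Dzb, b, c; simpl; field. }
      eapply is_dR_ext_lin; [exact k4 | |]; simpl; field. }
  rewrite (is_W_Dzb _ _ _ _ w1), (is_W_Dz _ _ _ _ w2).
  apply injective_projections; simpl; lra.
Qed.

(** * Integrals over circles *)

Local Open Scope R_scope.

Definition disc (p : C) (r : R) : C -> Prop := fun z => Cmod (z - p) < r.

Lemma continuous_Cmod (z : C) : continuous Cmod z.
Proof.
  apply (continuous_ext (fun u : C => sqrt (fst u * fst u + snd u * snd u))).
  { intros u; unfold Cmod; f_equal; ring. }
  apply (continuous_comp (fun u : C => fst u * fst u + snd u * snd u) sqrt); [| apply continuous_sqrt].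
  apply (Ck_continuous 0 (fun _ => True)); [| easy].
  apply Ck_plus; apply Ck_mult; first [apply Ck_fst | apply Ck_snd].
Qed.

Lemma continuous_Cminus_const (p z : C) : continuous (fun u : C => (u - p)%C) z.
Proof. eapply is_W_continuous, is_W_minus; [apply is_W_id | apply is_W_const]. Qed.

Lemma disc_open p r : open (disc p r).
Proof.
  unfold disc. apply (open_comp (fun z : C => Cmod (z - p)) (fun x => x < r)); [| apply open_lt].
  intros z _. apply (continuous_comp (fun z : C => (z - p)%C) Cmod);
    [apply continuous_Cminus_const | apply continuous_Cmod].
Qed.

Lemma disc_center p r : 0 < r -> disc p r p.
Proof. intros h; unfold disc. replace (p - p)%C with (RtoC 0) by ring. now rewrite Cmod_0. Qed.

Lemma locally_disc (z : C) (P : C -> Prop) : locally z P -> exists r, 0 < r /\ forall u, disc z r u -> P u.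
Proof.
  intros [eps h]; exists eps; split; [apply cond_pos |].
  intros u hu; apply h. now apply C_NormedModule_mixin_compat1.
Qed.

Lemma disc_locally (z : C) r (P : C -> Prop) : 0 < r -> (forall u, disc z r u -> P u) -> locally z P.
Proof.
  intros hr h. generalize (disc_open z r z (disc_center z r hr)). now apply filter_imp.
Qed.

Lemma open_disc_sub (U : C -> Prop) z : open U -> U z -> exists r, 0 < r /\ forall u, disc z r u -> U u.
Proof. intros hU hz; apply locally_disc, hU, hz. Qed.

Lemma Cmod_sym (a b : C) : Cmod (a - b) = Cmod (b - a).
Proof. replace (a - b)%C with (- (b - a))%C by ring. apply Cmod_opp. Qed.

Lemma disc_sub p q r s : Cmod (p - q) + r <= s -> forall u, disc p r u -> disc q s u.
Proof.
  unfold disc; intros h u hu. replace (u - q)%C with ((u - p) + (p - q))%C by ring.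
  eapply Rle_lt_trans; [apply Cmod_triangle | lra].
Qed.

Definition circ (p : C) (r t : R) : C := (fst p + r * cos t, snd p + r * sin t).

Lemma circ_disc p r t s : Rabs r < s -> disc p s (circ p r t).
Proof.
  intros h; unfold disc, circ. apply Rle_lt_trans with (2 := h). unfold Cmod; simpl.
  rewrite <- sqrt_Rsqr_abs. apply sqrt_le_1_alt. unfold Rsqr.
  apply Req_le. specialize (sin2_cos2 t); unfold Rsqr; intros.
  transitivity (r * r * (sin t * sin t + cos t * cos t)); [ring | rewrite H; ring].
Qed.

Lemma circ_mod p r t : 0 <= r -> Cmod (circ p r t - p) = r.
Proof.
  intros h; unfold circ, Cmod; simpl.
  transitivity (sqrt (Rsqr r)); [f_equal | now apply sqrt_Rsqr]. unfold Rsqr.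
  specialize (sin2_cos2 t); unfold Rsqr; intros.
  transitivity (r * r * (sin t * sin t + cos t * cos t)); [ring | rewrite H; ring].
Qed.

(** The integral in the angle, without the factor [r]; so the derivative in [r] is the integral of the radial derivative. *)
Definition circle_int (g : C -> R) (p : C) (r : R) : R :=
  RInt (fun t => g (circ p r t)) 0 (2 * PI).

Lemma PI2_pos : 0 < 2 * PI. Proof. specialize PI_RGT_0; lra. Qed.

Lemma continuous_circ p (r t : R) : continuous (fun u : R * R => circ p (fst u) (snd u)) (r, t).
Proof.
  apply (continuous_comp_2 (fun u : R * R => fst p + fst u * cos (snd u))
                           (fun u : R * R => snd p + fst u * sin (snd u)) (fun x y => (x, y) : C)).
  - apply (continuous_plus (fun _ => fst p) (fun u : R * R => fst u * cos (snd u))); [apply continuous_const |].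
    apply (continuous_mult (fun u : R * R => fst u) (fun u : R * R => cos (snd u))); [apply continuous_fst |].
    apply (continuous_comp (fun u : R * R => snd u) cos); [apply continuous_snd | apply continuous_cos].
  - apply (continuous_plus (fun _ => snd p) (fun u : R * R => fst u * sin (snd u))); [apply continuous_const |].
    apply (continuous_mult (fun u : R * R => fst u) (fun u : R * R => sin (snd u))); [apply continuous_fst |].
    apply (continuous_comp (fun u : R * R => snd u) sin); [apply continuous_snd | apply continuous_sin].
  - apply continuous_ext with (fun u : R * R => u); [now intros [? ?] | apply continuous_id].
Qed.

Lemma continuous_circ_t p (r t : R) : continuous (fun s => circ p r s) t.
Proof.
  apply (continuous_comp_2 (fun _ => r) (fun s : R => s) (fun a b => circ p a b)).
  - apply continuous_const.
  - apply continuous_id.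
  - apply continuous_circ.
Qed.

Lemma circle_ex (g : C -> R) p r s : Rabs r < s -> (forall z, disc p s z -> continuous g z) ->
  ex_RInt (fun t => g (circ p r t)) 0 (2 * PI).
Proof.
  intros hr hg; apply (ex_RInt_continuous (V := R_CompleteNormedModule)); intros t _.
  apply (continuous_comp (fun t => circ p r t) g); [apply continuous_circ_t |].
  now apply hg, circ_disc.
Qed.

Lemma circle_int_ext (f g : C -> R) p r : (forall t, f (circ p r t) = g (circ p r t)) ->
  circle_int f p r = circle_int g p r.
Proof. intros h; apply RInt_ext; intros; apply h. Qed.

Lemma circle_int_const c p r : circle_int (fun _ => c) p r = 2 * PI * c.
Proof. unfold circle_int; rewrite RInt_const. unfold scal; simpl; unfold mult; simpl; ring. Qed.

Lemma circle_int_plus (f g : C -> R) p r s : Rabs r < s ->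
  (forall z, disc p s z -> continuous f z) -> (forall z, disc p s z -> continuous g z) ->
  circle_int (fun z => f z + g z) p r = circle_int f p r + circle_int g p r.
Proof.
  intros hr hf hg; apply (RInt_plus (V := R_CompleteNormedModule) (fun t => f (circ p r t)) (fun t => g (circ p r t)));
    eapply circle_ex; eauto.
Qed.

Lemma circle_int_scal (c : R) (f : C -> R) p r s : Rabs r < s ->
  (forall z, disc p s z -> continuous f z) ->
  circle_int (fun z => c * f z) p r = c * circle_int f p r.
Proof.
  intros hr hf; apply (RInt_scal (V := R_CompleteNormedModule) (fun t => f (circ p r t)));
    eapply circle_ex; eauto.
Qed.

Lemma circle_int_le (f g : C -> R) p r s : Rabs r < s ->
  (forall z, disc p s z -> continuous f z) -> (forall z, disc p s z -> continuous g z) ->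
  (forall t, f (circ p r t) <= g (circ p r t)) -> circle_int f p r <= circle_int g p r.
Proof.
  intros hr hf hg h; apply RInt_le; [specialize PI2_pos; lra | | | intros; apply h]; eapply circle_ex; eauto.
Qed.

Lemma is_derive_circ_r (g : C -> R) p r t s : Rabs r < s -> smoothR (disc p s) g ->
  is_derive (fun u => g (circ p u t)) r (dR g (circ p r t) (cos t, sin t)).
Proof.
  intros hr hg. pose proof (circ_disc p r t s hr) as hz.
  rewrite (dR_linear _ _ _ (cos t, sin t) (disc_open p s) hg hz); simpl.
  apply (is_dR_curve g (fun u => fst p + u * cos t) (fun u => snd p + u * sin t)).
  - auto_derive; [easy | ring].
  - auto_derive; [easy | ring].
  - exact (smoothR_is_dR _ _ _ (disc_open p s) hg hz).
Qed.

Lemma is_derive_circ_t (g : C -> R) p r t s : Rabs r < s -> smoothR (disc p s) g ->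
  is_derive (fun u => g (circ p r u)) t (dR g (circ p r t) (- r * sin t, r * cos t)).
Proof.
  intros hr hg. pose proof (circ_disc p r t s hr) as hz.
  rewrite (dR_linear _ _ _ (- r * sin t, r * cos t) (disc_open p s) hg hz); simpl.
  apply (is_dR_curve g (fun u => fst p + r * cos u) (fun u => snd p + r * sin u)).
  - auto_derive; [easy | ring].
  - auto_derive; [easy | ring].
  - exact (smoothR_is_dR _ _ _ (disc_open p s) hg hz).
Qed.

(** [r d/dr] about [p]. *)
Definition euler (p : C) (g : C -> R) : C -> R := fun z => dR g z (z - p)%C.
(** [d/dtheta] about [p]. *)
Definition rot (p : C) (g : C -> R) : C -> R := fun z => dR g z (Ci * (z - p))%C.

Lemma smoothR_dR_field U g (X : C -> C) : open U -> smoothR U g -> smoothC U X ->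
  smoothR U (fun z => dR g z (X z)).
Proof.
  intros hU hg [h1 h2].
  apply smoothR_ext with (fun z => dR g z (RtoC 1) * fst (X z) + dR g z Ci * snd (X z)); auto.
  - intros z hz; symmetry; now apply (dR_linear U).
  - apply smoothR_plus; auto; apply smoothR_mult; auto; now apply smoothR_dR.
Qed.

Lemma smoothC_euler_field U p : open U -> smoothC U (fun z => z - p)%C.
Proof. intros hU; apply smoothC_minus; auto; [now apply smoothC_id | now apply smoothC_const]. Qed.

Lemma smoothR_rot U p g : open U -> smoothR U g -> smoothR U (rot p g).
Proof.
  intros hU hg; apply smoothR_dR_field; auto. apply smoothC_mult; auto;
   [now apply smoothC_const | now apply smoothC_euler_field].
Qed.

(** The statement multiplies the derivative by [r], which makes it true at [r = 0] as well. *)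
Lemma circle_int_derive (g : C -> R) p r s : Rabs r < s -> smoothR (disc p s) g ->
  exists l, is_derive (circle_int g p) r l /\ r * l = circle_int (euler p g) p r.
Proof.
  intros hr hg. pose proof (disc_open p s) as ho.
  exists (RInt (fun t => dR g (circ p r t) (cos t, sin t)) 0 (2 * PI)).
  assert (hloc : locally r (fun x => Rabs x < s)).
  { apply (open_comp Rabs (fun x => x < s)); [| apply open_lt | exact hr].
    intros x _; apply continuous_Rabs. }
  assert (hloc2 : forall t : R, locally (r, t) (fun u : R * R => Rabs (fst u) < s)).
  { intros t. apply (continuous_fst (U := R_UniformSpace) (V := R_UniformSpace) r t _ hloc). }
  assert (hcont : forall t : R, continuous (fun u : R * R => dR g (circ p (fst u) (snd u)) (cos (snd u), sin (snd u))) (r, t)).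
  { intros t. apply (continuous_ext_loc _ (fun u : R * R => dR g (circ p (fst u) (snd u)) (RtoC 1) * cos (snd u) + dR g (circ p (fst u) (snd u)) Ci * sin (snd u))).
    - apply filter_imp with (2 := hloc2 t). intros [a b] hab; simpl.
      symmetry. apply (dR_linear (disc p s) g (circ p a b) (cos b, sin b)); auto. now apply circ_disc.
    - apply (continuous_plus (fun u : R * R => dR g (circ p (fst u) (snd u)) (RtoC 1) * cos (snd u)) (fun u : R * R => dR g (circ p (fst u) (snd u)) Ci * sin (snd u))).
      + apply (continuous_mult (fun u : R * R => dR g (circ p (fst u) (snd u)) (RtoC 1)) (fun u : R * R => cos (snd u))).
        * apply (continuous_comp (fun u : R * R => circ p (fst u) (snd u)) (fun z => dR g z (RtoC 1))); [apply continuous_circ |].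
          apply (smoothR_continuous (disc p s)); [auto | now apply smoothR_dR | now apply circ_disc].
        * apply (continuous_comp (fun u : R * R => snd u) cos); [apply continuous_snd | apply continuous_cos].
      + apply (continuous_mult (fun u : R * R => dR g (circ p (fst u) (snd u)) Ci) (fun u : R * R => sin (snd u))).
        * apply (continuous_comp (fun u : R * R => circ p (fst u) (snd u)) (fun z => dR g z Ci)); [apply continuous_circ |].
          apply (smoothR_continuous (disc p s)); [auto | now apply smoothR_dR | now apply circ_disc].
        * apply (continuous_comp (fun u : R * R => snd u) sin); [apply continuous_snd | apply continuous_sin]. }
  split.
  - rewrite (RInt_ext _ (fun t => Derive (fun u => g (circ p u t)) r)).
    + apply (is_derive_RInt_param (fun x t => g (circ p x t))).
      * apply filter_imp with (2 := hloc). intros x hx t _. eexists; eapply is_derive_circ_r; eauto.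
      * intros t _. apply continuity_2d_pt_filterlim.
        change (continuous (fun u : R * R => Derive (fun z => g (circ p z (snd u))) (fst u)) (r, t)).
        apply (continuous_ext_loc _ (fun u : R * R => dR g (circ p (fst u) (snd u)) (cos (snd u), sin (snd u)))); [| apply hcont].
        apply filter_imp with (2 := hloc2 t). intros [a b] hab; simpl in *.
        symmetry. apply is_derive_unique. eapply is_derive_circ_r; eauto.
      * apply filter_imp with (2 := hloc). intros x hx. eapply circle_ex; [exact hx |].
        intros z hz; now apply (smoothR_continuous (disc p s)).
    + intros t _. symmetry; apply is_derive_unique. eapply is_derive_circ_r; eauto.
  - unfold circle_int. rewrite <- (RInt_scal (V := R_CompleteNormedModule)).
    + apply RInt_ext. intros t _. unfold euler, scal; simpl; unfold mult; simpl.
      assert (hL := fun v => dR_linear (disc p s) g (circ p r t) v ho hg (circ_disc p r t s hr)).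
      rewrite (hL (cos t, sin t)), (hL (circ p r t - p)%C). unfold circ; simpl; ring.
    + apply (ex_RInt_continuous (V := R_CompleteNormedModule)); intros t _.
      apply (continuous_comp_2 (fun _ : R => r) (fun s : R => s) (fun a b => dR g (circ p a b) (cos b, sin b)));
        [apply continuous_const | apply continuous_id | apply hcont].
Qed.

(** The integral of a total derivative over a period; this is how integration by parts in the angle enters. *)
Lemma circle_int_rot (g : C -> R) p r s : Rabs r < s -> smoothR (disc p s) g ->
  circle_int (rot p g) p r = 0.
Proof.
  intros hr hg. pose proof (disc_open p s) as ho.
  assert (H : is_RInt (fun t => rot p g (circ p r t)) 0 (2 * PI)
     (minus (g (circ p r (2 * PI))) (g (circ p r 0)))).
  { apply (is_RInt_derive (V := R_CompleteNormedModule) (fun t => g (circ p r t))).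
    - intros t _. unfold rot.
      replace (Ci * (circ p r t - p))%C with ((- r * sin t, r * cos t) : C).
      + eapply is_derive_circ_t; eauto.
      + unfold circ; apply injective_projections; simpl; ring.
    - intros t _. apply (continuous_comp (fun t => circ p r t) (rot p g)); [apply continuous_circ_t |].
      apply (smoothR_continuous (disc p s)); [auto | now apply smoothR_rot | now apply circ_disc]. }
  unfold circle_int. rewrite (is_RInt_unique (V := R_CompleteNormedModule) _ _ _ _ H).
  unfold circ. rewrite cos_2PI, sin_2PI, cos_0, sin_0. unfold minus, plus, opp; simpl; ring.
Qed.

Lemma circle_int_continuous (g : C -> R) p r s : Rabs r < s -> smoothR (disc p s) g ->
  continuous (circle_int g p) r.
Proof.
  intros hr hg. destruct (circle_int_derive g p r s hr hg) as [l [hl _]].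
  apply (ex_derive_continuous (K := R_AbsRing) (V := R_NormedModule)). now exists l.
Qed.

(** * Liouville on the sphere *)

(** The derivative of the circular mean vanishes for [r > 0], and the mean is continuous at [r = 0]. *)
Lemma circle_int_mean (g : C -> R) p s : 0 < s -> smoothR (disc p s) g ->
  (forall r, 0 < r < s -> circle_int (euler p g) p r = 0) ->
  forall r, 0 <= r < s -> circle_int g p r = 2 * PI * g p.
Proof.
  intros hs hg h r hr.
  transitivity (circle_int g p 0).
  - destruct (Req_dec r 0) as [-> | hr0]; [reflexivity |].
    destruct (MVT_gen (circle_int g p) 0 r (fun _ => 0)) as [c [_ hc]].
    + intros x. rewrite Rmin_left, Rmax_right by lra. intros hx.
      destruct (circle_int_derive g p x s) as [l [hl e]]; [rewrite Rabs_pos_eq; lra | auto |].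
      rewrite h in e by lra. replace 0 with l; [exact hl |].
      apply Rmult_integral in e; destruct e; lra.
    + intros x. rewrite Rmin_left, Rmax_right by lra. intros hx.
      apply continuity_pt_filterlim. apply circle_int_continuous with s; [rewrite Rabs_pos_eq; lra | auto].
    + lra.
  - rewrite <- (circle_int_const (g p) p 0). apply circle_int_ext; intros t. f_equal.
    unfold circ; apply injective_projections; simpl; ring.
Qed.

(** The value at [p] is the mean over arbitrarily large circles about [p], where the function is close to [c]. *)
Lemma constant_of_mean (g : C -> R) c : smoothR (fun _ => True) g ->
  (forall p r, 0 < r -> circle_int (euler p g) p r = 0) ->
  (forall eps : posreal, exists M, forall z, M < Cmod z -> Rabs (g z - c) <= eps) ->
  forall p, g p = c.
Proof.
  intros hg he hinf p.
  assert (hsm : forall s, smoothR (disc p s) g).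
  { intros s; apply (smoothR_sub (fun _ => True)); auto; [apply open_true | apply disc_open]. }
  apply cond_eq. intros eps heps.
  destruct (hinf (mkposreal (eps / 2) ltac:(lra))) as [M hM]; simpl in hM.
  set (r := Rabs M + Cmod p + 1).
  assert (hr0 : 0 < r) by (unfold r; specialize (Rabs_pos M); specialize (Cmod_ge_0 p); lra).
  assert (hr : Rabs r < r + 1) by (rewrite Rabs_pos_eq; lra).
  assert (e : circle_int g p r = 2 * PI * g p).
  { apply circle_int_mean with (r + 1); [lra | auto | | lra]. intros; apply he; lra. }
  assert (hc : forall (f : C -> R), smoothR (fun _ => True) f -> forall z, disc p (r + 1) z -> continuous f z).
  { intros f hf z _; apply (smoothR_continuous (fun _ => True)); auto; apply open_true. }
  assert (hb : forall t, Rabs (g (circ p r t) - c) <= eps / 2).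
  { intros t; apply hM.
    assert (Cmod (circ p r t - p) = r) by (apply circ_mod; lra).
    assert (Cmod (circ p r t - p) <= Cmod (circ p r t) + Cmod (- p)) by apply Cmod_triangle.
    rewrite Cmod_opp in H0. specialize (Rle_abs M). unfold r in *; lra. }
  assert (h1 : circle_int g p r <= circle_int (fun _ => c + eps / 2) p r).
  { apply circle_int_le with (r + 1); auto; [intros; apply continuous_const |].
    intros t; specialize (hb t); apply Rabs_le_between in hb; lra. }
  assert (h2 : circle_int (fun _ => c - eps / 2) p r <= circle_int g p r).
  { apply circle_int_le with (r + 1); auto; [intros; apply continuous_const |].
    intros t; specialize (hb t); apply Rabs_le_between in hb; lra. }
  rewrite circle_int_const, e in h1, h2.
  apply Rmult_le_reg_l in h1; [| apply PI2_pos]. apply Rmult_le_reg_l in h2; [| apply PI2_pos].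
  apply Rabs_lt_between; lra.
Qed.

(** The Cauchy-Riemann equations in polar coordinates; they make the integral of the radial derivative vanish. *)
Lemma holomorphic_euler_rot (h : C -> C) p z : is_W h z (Dz h z) 0 ->
  euler p (fun u => fst (h u)) z = rot p (fun u => snd (h u)) z /\
  euler p (fun u => snd (h u)) z = - rot p (fun u => fst (h u)) z.
Proof.
  intros [h1 h2]; unfold euler, rot.
  rewrite !(is_dR_dR _ _ _ _ _ h1), !(is_dR_dR _ _ _ _ _ h2); simpl; split; ring.
Qed.

Lemma Cinv_neq0 (z : C) : z <> 0%C -> (/ z)%C <> 0%C.
Proof. intros h e. apply C1_nz. rewrite <- (Cinv_r z h), e. ring. Qed.

Lemma Cinv_inv (z : C) : (/ / z)%C = z.
Proof.
  destruct (classic (z = 0%C)) as [-> | h].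
  - unfold Cinv; apply injective_projections; simpl; unfold Rdiv; ring.
  - field; repeat split; auto using Cinv_neq0, C1_nz.
Qed.

(** A function holomorphic on [C] that extends continuously to infinity by the value of [k] at 0 is constant: its real and imaginary parts have the mean value property. *)
Lemma sphere_liouville (h k : C -> C) :
  smoothC (fun _ => True) h -> (forall z, Dzb h z = 0%C) ->
  continuous k (RtoC 0) -> (forall w : C, w <> 0%C -> k w = h (/ w)%C) ->
  forall z, h z = k (RtoC 0).
Proof.
  intros hh hd hk e.
  assert (hW : forall z, is_W h z (Dz h z) 0).
  { intros z; rewrite <- (hd z); apply (smoothC_W (fun _ => True)); auto; apply open_true. }
  assert (hs1 : smoothR (fun _ => True) (fun u => fst (h u))) by apply hh.
  assert (hs2 : smoothR (fun _ => True) (fun u => snd (h u))) by apply hh.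
  assert (hsub : forall g, smoothR (fun _ => True) g -> forall p s, smoothR (disc p s) g).
  { intros g hg p s; apply (smoothR_sub (fun _ => True)); auto; [apply open_true | apply disc_open]. }
  assert (hinf : forall eps : posreal, exists M, forall z, M < Cmod z ->
      Rabs (fst (h z) - fst (k 0%C)) <= eps /\ Rabs (snd (h z) - snd (k 0%C)) <= eps).
  { intros eps. destruct (locally_disc _ _ (hk _ (locally_ball (k 0%C) eps))) as [d [hd0 hball]].
    exists (/ d). intros z hz.
    assert (hz0 : z <> 0%C). { intros ->; rewrite Cmod_0 in hz. assert (0 < / d) by now apply Rinv_0_lt_compat. lra. }
    assert (hin : disc 0 d (/ z)%C).
    { unfold disc. replace (/ z - 0)%C with (/ z)%C by ring. rewrite Cmod_inv by exact hz0.
      rewrite <- (Rinv_inv d). apply Rinv_lt_contravar; [| exact hz].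
      apply Rmult_lt_0_compat; [now apply Rinv_0_lt_compat | now apply Cmod_gt_0]. }
    specialize (hball _ hin). rewrite (e _ (Cinv_neq0 z hz0)) in hball.
    rewrite Cinv_inv in hball. destruct hball as [b1 b2].
    change (Rabs (fst (h z) - fst (k 0%C)) < eps) in b1.
    change (Rabs (snd (h z) - snd (k 0%C)) < eps) in b2. split; lra. }
  intros z; apply injective_projections.
  - apply (constant_of_mean (fun u => fst (h u))); auto.
    + intros p r hr. rewrite (circle_int_ext _ (rot p (fun u => snd (h u)))).
      * apply circle_int_rot with (r + 1); [rewrite Rabs_pos_eq; lra | auto].
      * intros t; apply holomorphic_euler_rot; auto.
    + intros eps; destruct (hinf eps) as [M hM]; exists M; intros; now apply hM.
  - apply (constant_of_mean (fun u => snd (h u))); auto.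
    + intros p r hr. rewrite (circle_int_ext _ (fun u => -1 * rot p (fun u => fst (h u)) u)).
      * rewrite (circle_int_scal _ _ _ _ (r + 1)).
        -- rewrite (circle_int_rot _ _ _ (r + 1)); [ring | rewrite Rabs_pos_eq; lra | auto].
        -- rewrite Rabs_pos_eq; lra.
        -- intros u hu; apply (smoothR_continuous (disc p (r + 1))); auto; [apply disc_open |].
           apply smoothR_rot; auto; apply disc_open.
      * intros t; rewrite (proj2 (holomorphic_euler_rot h p _ (hW _))); ring.
    + intros eps; destruct (hinf eps) as [M hM]; exists M; intros; now apply hM.
Qed.

(** * Radial and angular derivatives *)

Definition rdot (a b : C) : R := fst a * fst b + snd a * snd b.

(** The operator [-i d/dtheta] about [p].  It is symmetric on each circle, and for holomorphic functions it coincides with [r d/dr]; its eigenvalues are the orders of vanishing. *)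
Definition angular (p : C) (f : C -> C) (z : C) : C := (Dz f z * (z - p) - Dzb f z * Cconj (z - p))%C.
(** The difference between [r d/dr] and [angular], which measures the failure to be holomorphic. *)
Definition defect (p : C) (f : C -> C) (z : C) : C := (2 * Cconj (z - p) * Dzb f z)%C.

Lemma is_dR_euler (g : C -> R) p z a b : is_dR g z a b ->
  euler p g z = a * (fst z - fst p) + b * (snd z - snd p).
Proof. intros h; unfold euler; rewrite (is_dR_dR _ _ _ _ _ h); reflexivity. Qed.

Lemma is_dR_rot (g : C -> R) p z a b : is_dR g z a b ->
  rot p g z = a * (- (snd z - snd p)) + b * (fst z - fst p).
Proof. intros h; unfold rot; rewrite (is_dR_dR _ _ _ _ _ h); simpl; ring. Qed.

Lemma smoothR_rdot U f g : open U -> smoothC U f -> smoothC U g -> smoothR U (fun z => rdot (f z) (g z)).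
Proof.
  intros hU [f1 f2] [g1 g2].
  exact (smoothR_plus U _ _ hU (smoothR_mult U _ _ hU f1 g1) (smoothR_mult U _ _ hU f2 g2)).
Qed.

Lemma smoothC_angular U p f : open U -> smoothC U f -> smoothC U (angular p f).
Proof.
  intros hU hf. pose proof (smoothC_euler_field U p hU) as hz.
  apply smoothC_minus; auto; apply smoothC_mult; auto;
    [now apply smoothC_Dz | now apply smoothC_Dzb | now apply smoothC_conj].
Qed.

Lemma smoothC_defect U p f : open U -> smoothC U f -> smoothC U (defect p f).
Proof.
  intros hU hf. pose proof (smoothC_euler_field U p hU) as hz.
  apply smoothC_mult; auto; [apply smoothC_mult; auto; [now apply smoothC_const | now apply smoothC_conj] | now apply smoothC_Dzb].
Qed.

(** [r d/dr = angular + defect]. *)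
Lemma euler_norm2 U p f z : open U -> smoothC U f -> U z ->
  euler p (fun u => rdot (f u) (f u)) z = 2 * rdot (angular p f z) (f z) + 2 * rdot (defect p f z) (f z).
Proof.
  intros hU hf hz. destruct (smoothC_W U f z hU hf hz) as [h1 h2].
  etransitivity; [exact (is_dR_euler _ p z _ _ (is_dR_plus _ _ _ _ _ _ _ (is_dR_mult _ _ _ _ _ _ _ h1 h1) (is_dR_mult _ _ _ _ _ _ _ h2 h2))) |].
  unfold rdot, angular, defect.
  destruct (Dz f z), (Dzb f z), (f z), z, p; simpl; ring.
Qed.

(** Symmetry of [angular] with the integration by parts performed pointwise: differentiating [<Af, f>] radially gives [2 <Af, r df/dr>] up to a total angular derivative, whose integral over a circle is 0. *)
Lemma euler_angular U p f z : open U -> smoothC U f -> U z ->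
  euler p (fun u => rdot (angular p f u) (f u)) z =
  rot p (fun u => rdot (- Ci * (angular p f u + defect p f u))%C (f u)) z +
  2 * (rdot (angular p f z) (angular p f z) + rdot (angular p f z) (defect p f z)).
Proof.
  intros hU hf hz.
  assert (hc := Dz_Dzb_comm U f z hU hf hz).
  assert (h0 := smoothC_W U f z hU hf hz).
  assert (h1 := smoothC_W U _ z hU (smoothC_Dz U f hU hf) hz).
  assert (h2 := smoothC_W U _ z hU (smoothC_Dzb U f hU hf) hz).
  rewrite hc in h2.
  assert (hzp := is_W_minus _ _ _ _ _ _ _ (is_W_id z) (is_W_const p z)).
  assert (hzc := is_W_conj _ _ _ _ hzp).
  assert (ha := is_W_minus _ _ _ _ _ _ _ (is_W_mult _ _ _ _ _ _ _ h1 hzp) (is_W_mult _ _ _ _ _ _ _ h2 hzc)).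
  assert (hd := is_W_mult _ _ _ _ _ _ _ (is_W_mult _ _ _ _ _ _ _ (is_W_const 2 z) hzc) h2).
  fold (angular p f) in ha. fold (defect p f) in hd.
  assert (hs := is_W_mult _ _ _ _ _ _ _ (is_W_const (- Ci)%C z) (is_W_plus _ _ _ _ _ _ _ ha hd)).
  destruct h0 as [f1 f2].
  cbv beta in ha, hs. destruct ha as [a1 a2], hs as [s1 s2].
  etransitivity; [exact (is_dR_euler _ p z _ _ (is_dR_plus _ _ _ _ _ _ _ (is_dR_mult _ _ _ _ _ _ _ a1 f1) (is_dR_mult _ _ _ _ _ _ _ a2 f2))) |].
  etransitivity; [| apply Rplus_eq_compat_r; symmetry;
    exact (is_dR_rot _ p z _ _ (is_dR_plus _ _ _ _ _ _ _ (is_dR_mult _ _ _ _ _ _ _ s1 f1) (is_dR_mult _ _ _ _ _ _ _ s2 f2)))].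
  unfold rdot, angular, defect. clear.
  generalize (Dz (Dz f) z), (Dzb (Dz f) z), (Dzb (Dzb f) z), (Dz f z), (Dzb f z), (f z).
  intros [x1 y1] [x2 y2] [x3 y3] [x4 y4] [x5 y5] [x6 y6]. destruct z as [x y], p as [px py].
  simpl. ring.
Qed.

(** * The frequency function *)

Lemma derive_nonneg_le (f df : R -> R) a b : a <= b ->
  (forall x, a <= x <= b -> is_derive f x (df x)) -> (forall x, a <= x <= b -> 0 <= df x) -> f a <= f b.
Proof.
  intros hab hd hp.
  destruct (MVT_gen f a b df) as [c [hc e]].
  - intros x; rewrite Rmin_left, Rmax_right by lra; intros; apply hd; lra.
  - intros x; rewrite Rmin_left, Rmax_right by lra; intros.
    apply continuity_pt_filterlim. apply (ex_derive_continuous (K := R_AbsRing) (V := R_NormedModule)).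
    eexists; apply hd; lra.
  - rewrite Rmin_left, Rmax_right in hc by lra.
    assert (0 <= df c * (b - a)) by (apply Rmult_le_pos; [now apply hp | lra]). lra.
Qed.

Lemma is_derive_inv_pow m r : 0 < r -> is_derive (fun x => (/ x) ^ m) r (- INR m * (/ r) ^ S m).
Proof.
  intros hr. destruct m as [|m].
  - apply (is_derive_ext (fun _ => 1)); [reflexivity |].
    replace (- INR 0 * (/ r) ^ 1) with 0 by (simpl; ring). apply (is_derive_const (K:=R_AbsRing) (V:=R_NormedModule)).
  - auto_derive; [lra |]. change (Init.Nat.pred (S m)) with m. rewrite <- !tech_pow_Rmult.
    change (match m with O => 1 | S _ => INR m + 1 end) with (INR (S m)). field; lra.
Qed.

(** Here [h] is the integral of [|f|^2] over a circle and [n] that of [<Af, f>], with [A = -i d/dtheta].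
    The last hypothesis at [q = n / h] says that [n / h + K^2 r^2] is nondecreasing, so the
    frequency [n / h] is bounded on [(0, r0]].  Then [r h' <= m h] for some [m], and [h / r^m] is
    nonincreasing.  The quotient makes sense only where [h > 0]; on the way down from [r0]
    the lower bound itself prevents [h] from reaching 0. *)
Lemma frequency_ode (h n : R -> R) (s K : R) : 0 <= K ->
  (forall r, 0 < r < s -> 0 <= h r) ->
  (forall r, 0 < r < s -> exists h' n', is_derive h r h' /\ is_derive n r n' /\
     r * h' <= 2 * n r + 4 * r * K * h r /\
     (forall q, 2 * q * n r - q ^ 2 * h r + q * (r * h' / 2 - n r) - r ^ 2 * K ^ 2 * h r <= r * n' / 2)) ->
  forall r0, 0 < r0 < s -> 0 < h r0 ->
  exists (m : nat) (c : R), 0 < c /\ forall r, 0 < r <= r0 -> c * r ^ m <= h r.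
Proof.
  intros hK hpos hd r0 hr0 h0.
  set (dh := Derive h). set (dn := Derive n).
  assert (Hd : forall r, 0 < r < s -> is_derive h r (dh r) /\ is_derive n r (dn r) /\
     r * dh r <= 2 * n r + 4 * r * K * h r /\
     (forall q, 2 * q * n r - q ^ 2 * h r + q * (r * dh r / 2 - n r) - r ^ 2 * K ^ 2 * h r <= r * dn r / 2)).
  { intros r hr; destruct (hd r hr) as [h' [n' [d1 [d2 [d3 d4]]]]].
    unfold dh, dn; rewrite (is_derive_unique _ _ _ d1), (is_derive_unique _ _ _ d2). auto. }
  clear hd.
  assert (A : forall r, 0 < r <= r0 -> (forall x, r <= x <= r0 -> 0 < h x) ->
     n r / h r + K ^ 2 * r ^ 2 <= n r0 / h r0 + K ^ 2 * r0 ^ 2).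
  { intros r hr hp.
    apply (derive_nonneg_le (fun x => n x / h x + K ^ 2 * x ^ 2)
      (fun x => (dn x * h x - n x * dh x) / h x ^ 2 + K ^ 2 * (2 * x))); [lra | |].
    - intros x hx. specialize (hp x hx). destruct (Hd x) as [d1 [d2 _]]; [lra |].
      apply (is_derive_plus (K := R_AbsRing) (V := R_NormedModule) (fun x => n x / h x) (fun x => K ^ 2 * x ^ 2)).
      + apply is_derive_div; auto; lra.
      + auto_derive; [easy | ring].
    - intros x hx. specialize (hp x hx). destruct (Hd x) as [_ [_ [_ d4]]]; [lra |].
      specialize (d4 (n x / h x)).
      assert (hx0 : 0 < x) by lra.
      replace ((dn x * h x - n x * dh x) / h x ^ 2 + K ^ 2 * (2 * x)) with
        ((x * dn x / 2 - (2 * (n x / h x) * n x - (n x / h x) ^ 2 * h x + n x / h x * (x * dh x / 2 - n x) - x ^ 2 * K ^ 2 * h x)) * (2 / (x * h x))) by (field; lra).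
      apply Rmult_le_pos; [lra |]. apply Rlt_le, Rdiv_lt_0_compat; [lra | now apply Rmult_lt_0_compat]. }
  destruct (nfloor_ex (Rmax 0 (2 * (n r0 / h r0 + K ^ 2 * r0 ^ 2) + 4 * r0 * K)) (Rmax_l _ _)) as [m0 [_ hm0]].
  set (m := S m0). assert (hm : 2 * (n r0 / h r0 + K ^ 2 * r0 ^ 2) + 4 * r0 * K <= INR m).
  { unfold m; rewrite S_INR. specialize (Rmax_r 0 (2 * (n r0 / h r0 + K ^ 2 * r0 ^ 2) + 4 * r0 * K)); lra. }
  clearbody m; clear hm0 m0.
  assert (B : forall r, 0 < r <= r0 -> (forall x, r <= x <= r0 -> 0 < h x) ->
     h r0 * (/ r0) ^ m <= h r * (/ r) ^ m).
  { intros r hr hp.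
    apply Ropp_le_cancel.
    apply (derive_nonneg_le (fun x => - (h x * (/ x) ^ m)) (fun x => (/ x) ^ S m * (INR m * h x - x * dh x))); [lra | |].
    - intros x hx. destruct (Hd x) as [d1 _]; [lra |].
      assert (d := is_derive_inv_pow m x ltac:(lra)).
      apply (is_derive_ext (fun x => opp (mult (h x) ((/ x) ^ m)))); [reflexivity |].
      replace ((/ x) ^ S m * (INR m * h x - x * dh x)) with
        (opp (plus (mult (dh x) ((/ x) ^ m)) (mult (h x) (- INR m * (/ x) ^ S m)))).
      + apply (is_derive_opp (K := R_AbsRing) (V := R_NormedModule)).
        apply (is_derive_mult (K := R_AbsRing)); auto. intros; apply Rmult_comm.
      + unfold opp, plus, mult; simpl. field. lra.
    - intros x hx. destruct (Hd x) as [_ [_ [d3 _]]]; [lra |].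
      assert (a := A x ltac:(lra) ltac:(intros; apply hp; lra)). specialize (hp x hx).
      apply Rmult_le_pos; [apply pow_le, Rlt_le, Rinv_0_lt_compat; lra |].
      assert (e : n x = n x / h x * h x) by (field; lra).
      assert (0 <= K ^ 2 * x ^ 2) by (apply Rmult_le_pos; apply pow2_ge_0).
      assert (x * K <= r0 * K) by (apply Rmult_le_compat_r; lra).
      assert ((2 * (n x / h x) + 4 * (x * K)) * h x <= INR m * h x) by (apply Rmult_le_compat_r; lra).
      lra. }
  assert (Cont : forall r, 0 < r < s -> continuous h r).
  { intros r hr. apply (ex_derive_continuous (K := R_AbsRing) (V := R_NormedModule)). exists (dh r); exact (proj1 (Hd r hr)). }
  set (c := h r0 * (/ r0) ^ m).
  assert (hc : 0 < c) by (apply Rmult_lt_0_compat; [auto | apply pow_lt, Rinv_0_lt_compat; lra]).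
  assert (B' : forall r, 0 < r <= r0 -> (forall x, r <= x <= r0 -> 0 < h x) -> c * r ^ m <= h r).
  { intros r hr hp. specialize (B r hr hp). fold c in B.
    replace (h r) with (h r * (/ r) ^ m * r ^ m).
    - apply Rmult_le_compat_r; [apply pow_le; lra | exact B].
    - rewrite Rmult_assoc, <- Rpow_mult_distr, Rinv_l, pow1 by lra. ring. }
  assert (P : forall r, 0 < r <= r0 -> 0 < h r).
  { intros r2 hr2. destruct (Rle_lt_or_eq_dec 0 (h r2)) as [|e]; [apply hpos; lra | auto |].
    exfalso.
    (* the largest zero of h below r0; the bound holds to the right of it and contradicts continuity there *)
    destruct (completeness (fun r => r2 <= r <= r0 /\ h r = 0)) as [S [hS1 hS2]].
    - exists r0. intros r [hr _]; lra.
    - exists r2. split; [lra | auto].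
    - assert (S1 : r2 <= S) by (apply hS1; split; [lra | auto]).
      assert (S2 : S <= r0) by (apply hS2; intros r [hr _]; lra).
      assert (cS := Cont S ltac:(lra)).
      assert (nz : forall x, S < x <= r0 -> 0 < h x).
      { intros x hx. destruct (Rle_lt_or_eq_dec 0 (h x)) as [|e']; [apply hpos; lra | auto |].
        assert (x <= S) by (apply hS1; split; [lra | auto]). lra. }
      assert (hS0 : h S = 0).
      { destruct (Rle_lt_or_eq_dec 0 (h S)) as [l|e']; [apply hpos; lra | | auto].
        destruct (cS (fun y => 0 < y)) as [d hdl]; [now apply open_gt |].
        assert (S <= S - d / 2); [| specialize (cond_pos d); lra].
        apply hS2. intros r [hr1 hr3]. assert (r <= S) by (apply hS1; auto).
        apply Rnot_lt_le; intro hlt.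
        assert (0 < h r); [| lra]. apply hdl.
        unfold ball; simpl; unfold AbsRing_ball, abs, minus, plus, opp; simpl. apply Rabs_lt_between.
        specialize (cond_pos d); lra. }
      assert (S < r0) by (destruct S2; [auto | subst; lra]).
      assert (hcS : 0 < c * S ^ m) by (apply Rmult_lt_0_compat; [auto | apply pow_lt; lra]).
      destruct (cS (fun y => y < c * S ^ m)) as [d hdl]; [rewrite hS0; now apply open_lt |].
      set (x := S + Rmin (d / 2) (r0 - S)).
      assert (0 < Rmin (d / 2) (r0 - S)) by (apply Rmin_glb_lt; [specialize (cond_pos d); lra | lra]).
      assert (Rmin (d / 2) (r0 - S) <= d / 2) by apply Rmin_l.
      assert (Rmin (d / 2) (r0 - S) <= r0 - S) by apply Rmin_r.
      assert (hx1 : h x < c * S ^ m).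
      { apply hdl. unfold ball; simpl; unfold AbsRing_ball, abs, minus, plus, opp; simpl. apply Rabs_lt_between.
        unfold x; specialize (cond_pos d); lra. }
      assert (hx2 : c * x ^ m <= h x) by (apply B'; [unfold x; lra | intros; apply nz; unfold x in *; lra]).
      assert (c * S ^ m <= c * x ^ m); [| lra].
      apply Rmult_le_compat_l; [lra |]. apply pow_incr; unfold x; lra. }
  exists m, c; split; [exact hc |].
  intros r hr; apply B'; [exact hr | intros; apply P; lra].
Qed.

Definition norm2 (f1 f2 : C -> C) : C -> R := fun z => rdot (f1 z) (f1 z) + rdot (f2 z) (f2 z).

(** The inequality [|dbar f| <= K |f|] for the pair [f = (f1, f2)]; it is all that unique continuation uses of a linear system. *)
Definition dbar_bounded (U : C -> Prop) (K : R) (f1 f2 : C -> C) : Prop :=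
  forall z, U z -> norm2 (Dzb f1) (Dzb f2) z <= K ^ 2 * norm2 f1 f2 z.

Lemma rdot_pos a : 0 <= rdot a a.
Proof. unfold rdot; nra. Qed.

Lemma norm2_pos f1 f2 z : 0 <= norm2 f1 f2 z.
Proof. unfold norm2; specialize (rdot_pos (f1 z)); specialize (rdot_pos (f2 z)); lra. Qed.

Lemma rdot_zero a : rdot a a <= 0 -> a = RtoC 0.
Proof. unfold rdot; intros h; apply injective_projections; simpl; nra. Qed.

Lemma smoothR_norm2 U f1 f2 : open U -> smoothC U f1 -> smoothC U f2 -> smoothR U (norm2 f1 f2).
Proof. intros hU h1 h2; apply smoothR_plus; auto; now apply smoothR_rdot. Qed.

Lemma euler_plus U p f g z : open U -> smoothR U f -> smoothR U g -> U z ->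
  euler p (fun u => f u + g u) z = euler p f z + euler p g z.
Proof.
  intros hU hf hg hz. pose proof (smoothR_is_dR U f z hU hf hz) as h1. pose proof (smoothR_is_dR U g z hU hg hz) as h2.
  rewrite (is_dR_euler _ p z _ _ (is_dR_plus _ _ _ _ _ _ _ h1 h2)),
    (is_dR_euler _ p z _ _ h1), (is_dR_euler _ p z _ _ h2). ring.
Qed.

Lemma rdot_defect p f r t :
  rdot (defect p f (circ p r t)) (defect p f (circ p r t)) =
  4 * r ^ 2 * rdot (Dzb f (circ p r t)) (Dzb f (circ p r t)).
Proof.
  unfold defect, circ, rdot. destruct (Dzb f _) as [x y]; simpl.
  specialize (sin2_cos2 t); unfold Rsqr; intros e.
  transitivity (4 * (r * r) * (sin t * sin t + cos t * cos t) * (x * x + y * y)); [ring | rewrite e; ring].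
Qed.

(** With [A] the angular operator and [D] the defect, [r h' / 2] is the integral of [<Af, f> + <D, f>]
    and [r n' / 2] that of [|Af|^2 + <Af, D>].  The inequality required by [frequency_ode] follows from
    [|Af - q f + D / 2|^2 >= 0] and [|D| <= 2 r K |f|]. *)
Lemma pair_frequency p s K f1 f2 : 0 <= K -> smoothC (disc p s) f1 -> smoothC (disc p s) f2 ->
  dbar_bounded (disc p s) K f1 f2 ->
  forall r0, 0 < r0 < s -> 0 < circle_int (norm2 f1 f2) p r0 ->
  exists (m : nat) (c : R), 0 < c /\ forall r, 0 < r <= r0 -> c * r ^ m <= circle_int (norm2 f1 f2) p r.
Proof.
  intros hK h1 h2 hb.
  pose proof (disc_open p s) as ho.
  set (h0 := norm2 f1 f2).
  set (n0 := fun z => rdot (angular p f1 z) (f1 z) + rdot (angular p f2 z) (f2 z)).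
  set (g0 := fun z => rdot (defect p f1 z) (f1 z) + rdot (defect p f2 z) (f2 z)).
  set (m0 := fun z => rdot (- Ci * (angular p f1 z + defect p f1 z))%C (f1 z) + rdot (- Ci * (angular p f2 z + defect p f2 z))%C (f2 z)).
  set (b0 := fun z => (rdot (angular p f1 z) (angular p f1 z) + rdot (angular p f1 z) (defect p f1 z)) +
                      (rdot (angular p f2 z) (angular p f2 z) + rdot (angular p f2 z) (defect p f2 z))).
  assert (a1 := smoothC_angular _ p _ ho h1). assert (a2 := smoothC_angular _ p _ ho h2).
  assert (e1 := smoothC_defect _ p _ ho h1). assert (e2 := smoothC_defect _ p _ ho h2).
  assert (i1 : smoothC (disc p s) (fun z => - Ci * (angular p f1 z + defect p f1 z))%C)
    by (apply smoothC_mult; [auto | now apply smoothC_const | now apply smoothC_plus]).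
  assert (i2 : smoothC (disc p s) (fun z => - Ci * (angular p f2 z + defect p f2 z))%C)
    by (apply smoothC_mult; [auto | now apply smoothC_const | now apply smoothC_plus]).
  assert (Sh : smoothR (disc p s) h0) by now apply smoothR_norm2.
  assert (Sn : smoothR (disc p s) n0) by (apply smoothR_plus; auto; now apply smoothR_rdot).
  assert (Sg : smoothR (disc p s) g0) by (apply smoothR_plus; auto; now apply smoothR_rdot).
  assert (Sm : smoothR (disc p s) m0) by (apply smoothR_plus; auto; now apply smoothR_rdot).
  assert (Sb : smoothR (disc p s) b0) by (apply smoothR_plus; auto; apply smoothR_plus; auto; now apply smoothR_rdot).
  assert (Cs : forall g, smoothR (disc p s) g -> forall z, disc p s z -> continuous g z)
    by (intros g hg z hz; now apply (smoothR_continuous (disc p s))).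
  assert (Cc : forall (c : R) (g : C -> R), (forall z, disc p s z -> continuous g z) -> forall z, disc p s z -> continuous (fun u => c * g u) z).
  { intros c g hg z hz; apply (continuous_scal_r (K := R_AbsRing) (V := R_NormedModule) c g); auto. }
  assert (Cp : forall (f g : C -> R), (forall z, disc p s z -> continuous f z) -> (forall z, disc p s z -> continuous g z) -> forall z, disc p s z -> continuous (fun u => f u + g u) z).
  { intros f g hf hg z hz; apply (continuous_plus (K := R_AbsRing) (V := R_NormedModule) f g); auto. }
  apply (frequency_ode (circle_int h0 p) (circle_int n0 p) s K hK).
  - intros r hr. rewrite <- (Rmult_0_r (2 * PI)), <- (circle_int_const 0 p r).
    apply circle_int_le with s; [rewrite Rabs_pos_eq; lra | intros; apply continuous_const | auto | intros; apply norm2_pos].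
  - intros r hr. assert (hr' : Rabs r < s) by (rewrite Rabs_pos_eq; lra).
    destruct (circle_int_derive h0 p r s hr' Sh) as [h' [d1 q1]].
    destruct (circle_int_derive n0 p r s hr' Sn) as [n' [d2 q2]].
    assert (q1' : r * h' = 2 * circle_int n0 p r + 2 * circle_int g0 p r).
    { rewrite q1, (circle_int_ext _ (fun z => 2 * n0 z + 2 * g0 z)).
      - rewrite (circle_int_plus _ _ _ _ s), !(circle_int_scal _ _ _ _ s); auto.
      - intros t. pose proof (circ_disc p r t s hr') as ht.
        unfold h0, norm2. rewrite (euler_plus (disc p s)); auto; try (now apply smoothR_rdot).
        rewrite !(euler_norm2 (disc p s)); auto. unfold n0, g0; ring. }
    assert (q2' : r * n' = 2 * circle_int b0 p r).
    { rewrite q2, (circle_int_ext _ (fun z => rot p m0 z + 2 * b0 z)).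
      - rewrite (circle_int_plus _ _ _ _ s), (circle_int_scal _ _ _ _ s), (circle_int_rot _ _ _ s); auto; [ring |].
        apply Cs, smoothR_rot; auto.
      - intros t. pose proof (circ_disc p r t s hr') as ht.
        unfold n0. rewrite (euler_plus (disc p s)); auto; try (now apply smoothR_rdot).
        rewrite !(euler_angular (disc p s)); auto. unfold m0, b0.
        pose proof (smoothR_is_dR (disc p s) _ _ ho (smoothR_rdot _ _ _ ho i1 h1) ht) as k1.
        pose proof (smoothR_is_dR (disc p s) _ _ ho (smoothR_rdot _ _ _ ho i2 h2) ht) as k2.
        cbv beta in k1, k2.
        rewrite (is_dR_rot _ p _ _ _ (is_dR_plus _ _ _ _ _ _ _ k1 k2)), (is_dR_rot _ p _ _ _ k1), (is_dR_rot _ p _ _ _ k2). ring. }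
    assert (hd : forall t, rdot (defect p f1 (circ p r t)) (defect p f1 (circ p r t)) + rdot (defect p f2 (circ p r t)) (defect p f2 (circ p r t))
       <= 4 * r ^ 2 * K ^ 2 * h0 (circ p r t)).
    { intros t. rewrite !rdot_defect. specialize (hb _ (circ_disc p r t s hr')). unfold norm2 in hb at 1.
      fold h0 in hb. assert (0 <= 4 * r ^ 2) by nra.
      apply Rmult_le_compat_l with (r := 4 * r ^ 2) in hb; lra. }
    exists h', n'. split; [exact d1 |]. split; [exact d2 |]. split.
    + rewrite q1'.
      assert (circle_int g0 p r <= circle_int (fun z => 2 * r * K * h0 z) p r).
      { apply circle_int_le with s; auto.
        intros t. specialize (hd t). unfold g0.
        set (z := circ p r t) in *. unfold h0, norm2 in *.
        set (D := rdot (defect p f1 z) (defect p f1 z) + rdot (defect p f2 z) (defect p f2 z)) in *.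
        set (N := rdot (f1 z) (f1 z) + rdot (f2 z) (f2 z)) in *.
        assert (cs : (rdot (defect p f1 z) (f1 z) + rdot (defect p f2 z) (f2 z)) ^ 2 <= D * N).
        { unfold D, N, rdot. destruct (defect p f1 z) as [x1 x2], (defect p f2 z) as [x3 x4], (f1 z) as [y1 y2], (f2 z) as [y3 y4]. simpl.
          assert (0 <= (x1*y2-x2*y1)^2 + (x1*y3-x3*y1)^2 + (x1*y4-x4*y1)^2 + (x2*y3-x3*y2)^2 + (x2*y4-x4*y2)^2 + (x3*y4-x4*y3)^2).
          { repeat apply Rplus_le_le_0_compat; apply pow2_ge_0. }
          lra. }
        assert (hN : 0 <= N) by (unfold N; specialize (rdot_pos (f1 z)); specialize (rdot_pos (f2 z)); lra).
        set (G := rdot (defect p f1 z) (f1 z) + rdot (defect p f2 z) (f2 z)) in *.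
        assert (0 <= 2 * r * K) by nra.
        assert (G ^ 2 <= (2 * r * K * N) ^ 2).
        { apply Rle_trans with (1 := cs). apply Rle_trans with (4 * r ^ 2 * K ^ 2 * N * N); [now apply Rmult_le_compat_r | apply Req_le; ring]. }
        assert (0 <= 2 * r * K * N) by now apply Rmult_le_pos.
        apply Rnot_lt_le; intro. nra. }
      rewrite (circle_int_scal _ _ _ _ s) in H; auto. lra.
    + intros q. rewrite q1', q2'.
      replace (2 * circle_int b0 p r / 2) with (circle_int b0 p r) by field.
      replace (2 * q * circle_int n0 p r - q ^ 2 * circle_int h0 p r + q * ((2 * circle_int n0 p r + 2 * circle_int g0 p r) / 2 - circle_int n0 p r) - r ^ 2 * K ^ 2 * circle_int h0 p r)
        with (2 * q * circle_int n0 p r + ((- q ^ 2 - r ^ 2 * K ^ 2) * circle_int h0 p r + q * circle_int g0 p r)) by field.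
      rewrite <- !(circle_int_scal _ _ _ _ s); auto.
      rewrite <- !(circle_int_plus _ _ _ _ s); auto.
      apply circle_int_le with s; auto 6.
      intros t. specialize (hd t). set (z := circ p r t) in *.
      unfold n0, g0, b0. unfold h0, norm2 in hd |- *.
      assert (sq : forall a b f : C, 0 <= rdot a a + rdot a b - 2 * q * rdot a f + q ^ 2 * rdot f f - q * rdot b f + rdot b b / 4).
      { intros a b f. unfold rdot.
        replace (_ + _) with ((fst a - q * fst f + fst b / 2) ^ 2 + (snd a - q * snd f + snd b / 2) ^ 2) by field.
        apply Rplus_le_le_0_compat; apply pow2_ge_0. }
      pose proof (sq (angular p f1 z) (defect p f1 z) (f1 z)).
      pose proof (sq (angular p f2 z) (defect p f2 z) (f2 z)). lra.
Qed.

(** The angle is found from the arc cosine, with the two signs of the imaginary part treated separately. *)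
Lemma polar (p z : C) : exists t, 0 <= t <= 2 * PI /\ z = circ p (Cmod (z - p)) t.
Proof.
  set (r := Cmod (z - p)). destruct (Req_dec r 0) as [e | hr].
  - exists 0. split; [specialize PI2_pos; lra |]. apply Cmod_eq_0 in e.
    unfold r; rewrite e, Cmod_0. unfold circ.
    replace z with p by (transitivity (p + (z - p))%C; [rewrite e; ring | ring]).
    apply injective_projections; simpl; ring.
  - assert (r0 : 0 < r) by (specialize (Cmod_ge_0 (z - p)); fold r; lra).
    set (x := fst z - fst p). set (y := snd z - snd p).
    assert (hr2 : r ^ 2 = x ^ 2 + y ^ 2).
    { unfold r, Cmod. rewrite pow2_sqrt; [reflexivity |]. apply Rplus_le_le_0_compat; apply pow2_ge_0. }
    assert (hx : -1 <= x / r <= 1).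
    { assert (x ^ 2 <= r ^ 2) by (rewrite hr2; specialize (pow2_ge_0 y); lra).
      assert (- r <= x <= r) by (split; nra).
      split; [apply Rle_div_r | apply Rle_div_l]; lra. }
    assert (hs : sqrt (1 - (x / r)²) = Rabs y / r).
    { replace (1 - (x / r)²) with ((Rabs y / r)²).
      - apply sqrt_Rsqr. apply Rdiv_le_0_compat; [apply Rabs_pos | lra].
      - unfold Rsqr, Rdiv. replace (Rabs y * / r * (Rabs y * / r)) with ((Rabs y)^2 * / r * / r) by ring.
        rewrite pow2_abs. replace (y ^ 2) with (r ^ 2 - x ^ 2) by lra. field; lra. }
    destruct (Rle_dec 0 y) as [hy | hy].
    + exists (acos (x / r)). split; [specialize (acos_bound (x / r)); specialize PI_RGT_0; lra |].
      unfold circ. rewrite cos_acos, sin_acos, hs, Rabs_pos_eq by lra.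
      apply injective_projections; simpl; unfold x, y; field; lra.
    + exists (2 * PI - acos (x / r)). split; [specialize (acos_bound (x / r)); specialize PI_RGT_0; lra |].
      unfold circ. rewrite cos_minus, sin_minus, cos_2PI, sin_2PI, cos_acos, sin_acos, hs, Rabs_left by lra.
      apply injective_projections; simpl; unfold x, y; field; lra.
Qed.

Lemma RInt_zero_nonneg (g : R -> R) a b : a < b -> (forall t, continuous g t) -> (forall t, 0 <= g t) ->
  RInt g a b <= 0 -> forall t, a <= t <= b -> g t = 0.
Proof.
  intros hab hc hp h0 t ht. apply Rle_antisym; [| apply hp]. apply Rnot_lt_le; intro hg.
  assert (ex : forall x y, ex_RInt g x y) by (intros; apply (ex_RInt_continuous (V := R_CompleteNormedModule)); auto).
  destruct (hc t (fun y => 0 < y)) as [d hd]; [now apply open_gt |].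
  specialize (cond_pos d); intros hd0.
  assert (ge : forall x y, x <= y -> 0 <= RInt g x y) by (intros; apply RInt_ge_0; auto).
  set (x := Rmax a (t - d / 2)). set (y := Rmin b (t + d / 2)).
  assert (hx : a <= x /\ t - d / 2 <= x /\ x <= t).
  { unfold x; repeat split; [apply Rmax_l | apply Rmax_r | apply Rmax_lub; lra]. }
  assert (hy : y <= b /\ y <= t + d / 2 /\ t <= y).
  { unfold y; repeat split; [apply Rmin_l | apply Rmin_r | apply Rmin_glb; lra]. }
  assert (hxy : x < y).
  { unfold x, y. apply Rmax_lub_lt; apply Rmin_glb_lt; lra. }
  assert (0 < RInt g x y).
  { apply RInt_gt_0; auto. intros u hu. apply hd.
    unfold ball; simpl; unfold AbsRing_ball, abs, minus, plus, opp; simpl. apply Rabs_lt_between; lra. }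
  assert (e1 := RInt_Chasles (V := R_CompleteNormedModule) g a x b (ex _ _) (ex _ _)).
  assert (e2 := RInt_Chasles (V := R_CompleteNormedModule) g x y b (ex _ _) (ex _ _)).
  unfold plus in e1, e2; simpl in e1, e2.
  specialize (ge a x ltac:(lra)) as g1. specialize (ge y b ltac:(lra)) as g2. lra.
Qed.

Lemma circle_int_zero (g : C -> R) p r s : 0 <= r < s -> (forall z, disc p s z -> continuous g z) ->
  (forall z, 0 <= g z) -> circle_int g p r <= 0 -> forall z, Cmod (z - p) = r -> g z = 0.
Proof.
  intros hr hg hp h0 z hz. destruct (polar p z) as [t [ht ->]]. rewrite hz.
  apply (RInt_zero_nonneg (fun t => g (circ p r t)) 0 (2 * PI)); auto; [apply PI2_pos |].
  intros u. apply (continuous_comp (fun t => circ p r t) g); [apply continuous_circ_t |].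
  apply hg, circ_disc. rewrite Rabs_pos_eq; lra.
Qed.

(** A function that vanishes near [p] violates the lower bound [c r^m] of [pair_frequency] on small circles, so no circle carries a positive integral. *)
Lemma unique_continuation p s K f1 f2 : 0 <= K -> smoothC (disc p s) f1 -> smoothC (disc p s) f2 ->
  dbar_bounded (disc p s) K f1 f2 ->
  (exists e, 0 < e /\ forall z, disc p e z -> norm2 f1 f2 z = 0) ->
  forall z, disc p s z -> norm2 f1 f2 z = 0.
Proof.
  intros hK h1 h2 hb [e [he h0]] z hz. set (r := Cmod (z - p)).
  assert (hr : 0 <= r < s) by (split; [apply Cmod_ge_0 | exact hz]).
  destruct (Rle_lt_or_eq_dec 0 r (proj1 hr)) as [hr0 | hr0].
  2: { apply h0. unfold disc; fold r; lra. }
  apply (circle_int_zero (norm2 f1 f2) p r s); auto; [| apply norm2_pos |].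
  - intros u hu; apply (smoothR_continuous (disc p s)); auto; [apply disc_open |].
    apply smoothR_norm2; auto; apply disc_open.
  - apply Rnot_lt_le; intro hlt.
    destruct (pair_frequency p s K f1 f2 hK h1 h2 hb r ltac:(lra) hlt) as [m [c [hc hm]]].
    set (x := Rmin r (e / 2)).
    assert (hx : 0 < x) by (apply Rmin_glb_lt; lra).
    specialize (hm x ltac:(split; [auto | apply Rmin_l])).
    assert (0 < c * x ^ m) by (apply Rmult_lt_0_compat; [auto | now apply pow_lt]).
    rewrite (circle_int_ext _ (fun _ => 0)) in hm.
    + rewrite circle_int_const in hm. lra.
    + intros t. apply h0. unfold disc; rewrite circ_mod by lra. specialize (Rmin_r r (e / 2)); fold x; lra.
Qed.

(** * Integrals along rays *)

(** Compactness of the interval makes the continuity of the integrand in the parameter uniform. *)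
Lemma continuous_RInt_param {T : UniformSpace} (G : R -> T -> R) (a b : R) (z : T) : a <= b ->
  (forall t, a <= t <= b -> continuous (fun u : R * T => G (fst u) (snd u)) (t, z)) ->
  locally z (fun w => ex_RInt (fun t => G t w) a b) ->
  continuous (fun w => RInt (fun t => G t w) a b) z.
Proof.
  intros hab hc hex. apply filterlim_locally. intros eps.
  set (e := eps / (2 * (b - a + 1))).
  assert (he : 0 < e) by (apply Rdiv_lt_0_compat; [apply cond_pos | lra]).
  assert (hd : forall t, exists d : posreal, a <= t <= b -> forall s w, Rabs (s - t) < d -> ball z d w ->
     Rabs (G s w - G t z) < e / 2).
  { intros t. destruct (classic (a <= t <= b)) as [ht | ht]; [| exists (mkposreal 1 Rlt_0_1); tauto].
    destruct (proj1 (filterlim_locally _ _) (hc t ht) (mkposreal (e / 2) ltac:(lra))) as [d h].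
    exists d; intros _ s w hs hw. apply (h (s, w)). split; [exact hs | exact hw]. }
  set (delta := fun t => proj1_sig (constructive_indefinite_description _ (hd t))).
  assert (hdelta : forall t, a <= t <= b -> forall s w, Rabs (s - t) < delta t -> ball z (delta t) w ->
     Rabs (G s w - G t z) < e / 2).
  { intros t. exact (proj2_sig (constructive_indefinite_description _ (hd t))). }
  destruct (compactness_value_1d a b delta) as [d hd1].
  assert (hex0 := locally_singleton _ _ hex).
  apply filter_imp with (fun w => ex_RInt (fun t => G t w) a b /\ ball z d w).
  2: { apply filter_and; [exact hex | apply locally_ball]. }
  intros w [hw1 hw2].
  change (Rabs (RInt (fun t => G t w) a b - RInt (fun t => G t z) a b) < eps).
  rewrite <- (RInt_minus (V := R_CompleteNormedModule)) by assumption.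
  apply Rle_lt_trans with ((b - a) * e).
  - apply (abs_RInt_le_const (fun t => G t w - G t z)); [auto | |].
    + apply (ex_RInt_minus (V := R_NormedModule)); assumption.
    + intros t ht. apply Rnot_lt_le; intro hlt. apply (hd1 t ht). intros [t0 [h1 [h2 h3]]].
      assert (b1 : Rabs (G t w - G t0 z) < e / 2) by (apply hdelta; auto; apply ball_le with d; auto).
      assert (b2 : Rabs (G t z - G t0 z) < e / 2) by (apply hdelta; auto; apply ball_center).
      apply (Rlt_irrefl e). apply Rlt_trans with (1 := hlt).
      replace (G t w - G t z) with ((G t w - G t0 z) - (G t z - G t0 z)) by ring.
      eapply Rle_lt_trans; [apply Rabs_triang |]. rewrite Rabs_Ropp. lra.
  - unfold e. assert (0 < eps) by apply cond_pos.
    replace ((b - a) * (eps / (2 * (b - a + 1)))) with (eps * ((b - a) / (2 * (b - a + 1)))) by (field; lra).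
    rewrite <- (Rmult_1_r eps) at 2. apply Rmult_lt_compat_l; [auto |].
    apply Rlt_div_l; lra.
Qed.

Definition ray (p z : C) (t : R) : C := (fst p + t * (fst z - fst p), snd p + t * (snd z - snd p)).

(** The weight [t^N] appears because each derivative of [F (p + t (z - p))] in [z] produces a factor [t]. *)
Definition ray_int (N : nat) (F : C -> R) (p z : C) : R := RInt (fun t => t ^ N * F (ray p z t)) 0 1.

Lemma ray_disc p z t s : 0 <= t <= 1 -> disc p s z -> disc p s (ray p z t).
Proof.
  unfold disc; intros ht hz. apply Rle_lt_trans with (2 := hz).
  replace (ray p z t - p)%C with (RtoC t * (z - p))%C
    by (unfold ray; apply injective_projections; simpl; ring).
  rewrite Cmod_mult, Cmod_R, Rabs_pos_eq by lra.
  specialize (Cmod_ge_0 (z - p)); nra.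
Qed.

Lemma continuous_ray p (z : C) (t : R) : continuous (fun u : R * C => ray p (snd u) (fst u)) (t, z).
Proof.
  assert (c1 : continuous (fun u : R * C => fst u) (t, z)) by apply continuous_fst.
  assert (c2 : continuous (fun u : R * C => snd u) (t, z)) by apply continuous_snd.
  assert (K : forall (g : C -> R) c, continuous g z -> continuous (fun u : R * C => c + fst u * (g (snd u) - c)) (t, z)).
  { intros g c hg.
    apply (continuous_plus (K := R_AbsRing) (V := R_NormedModule) (fun _ : R * C => c) (fun u : R * C => fst u * (g (snd u) - c))); [apply continuous_const |].
    apply (continuous_mult (K := R_AbsRing) (fun u : R * C => fst u) (fun u : R * C => g (snd u) - c)); [exact c1 |].
    apply (continuous_minus (K := R_AbsRing) (V := R_NormedModule) (fun u : R * C => g (snd u)) (fun u : R * C => c)); [| apply continuous_const].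
    apply (continuous_comp (fun u : R * C => snd u) g); [exact c2 | exact hg]. }
  apply (continuous_comp_2 (fun u : R * C => fst p + fst u * (fst (snd u) - fst p))
          (fun u : R * C => snd p + fst u * (snd (snd u) - snd p)) (fun x y => (x, y) : C)).
  - apply K, (is_dR_continuous _ _ 1 0), is_dR_fst.
  - apply K, (is_dR_continuous _ _ 0 1), is_dR_snd.
  - apply continuous_ext with (fun u : R * R => u); [now intros [? ?] | apply continuous_id].
Qed.

Lemma continuous_pow_fst {T : UniformSpace} N (t : R) (z : T) : continuous (fun u : R * T => fst u ^ N) (t, z).
Proof.
  apply (continuous_comp (fun u : R * T => fst u) (fun x => x ^ N)); [apply continuous_fst |].
  apply (ex_derive_continuous (fun x : R => x ^ N)). auto_derive; easy.
Qed.

Lemma continuous_ray_integrand N F p s z t : (forall u, disc p s u -> continuous F u) -> disc p s z -> 0 <= t <= 1 ->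
  continuous (fun u : R * C => fst u ^ N * F (ray p (snd u) (fst u))) (t, z).
Proof.
  intros hF hz ht.
  apply (continuous_mult (K := R_AbsRing) (fun u : R * C => fst u ^ N) (fun u : R * C => F (ray p (snd u) (fst u))));
   [apply continuous_pow_fst |].
  apply (continuous_comp (fun u : R * C => ray p (snd u) (fst u)) F); [apply continuous_ray |].
  now apply hF, ray_disc.
Qed.

Lemma ex_ray_int N F p s z : (forall u, disc p s u -> continuous F u) -> disc p s z ->
  ex_RInt (fun t => t ^ N * F (ray p z t)) 0 1.
Proof.
  intros hF hz. apply (ex_RInt_continuous (V := R_CompleteNormedModule)); intros t.
  rewrite Rmin_left, Rmax_right by lra. intros ht.
  apply (continuous_comp_2 (fun t : R => t) (fun _ : R => z) (fun t z => t ^ N * F (ray p z t))).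
  - apply continuous_id.
  - apply continuous_const.
  - now apply (continuous_ray_integrand N F p s).
Qed.

Lemma continuous_ray_int N F p s z : (forall u, disc p s u -> continuous F u) -> disc p s z ->
  continuous (ray_int N F p) z.
Proof.
  intros hF hz. apply (continuous_RInt_param (fun t z => t ^ N * F (ray p z t))); [lra | |].
  - intros t ht; now apply (continuous_ray_integrand N F p s).
  - apply filter_imp with (2 := disc_open p s z hz). intros w hw; now apply (ex_ray_int N F p s).
Qed.

Definition shift (z v : C) (x : R) : C := (fst z + x * fst v, snd z + x * snd v).

Lemma continuous_shift (z v : C) (x : R) : continuous (fun y : R => shift z v y) x.
Proof.
  apply (continuous_comp_2 (fun t : R => fst z + t * fst v) (fun t : R => snd z + t * snd v) (fun x y => (x, y) : C)).
  - apply (ex_derive_continuous (fun t : R => fst z + t * fst v)); auto_derive; easy.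
  - apply (ex_derive_continuous (fun t : R => snd z + t * snd v)); auto_derive; easy.
  - apply continuous_ext with (fun u : R * R => u); [now intros [? ?] | apply continuous_id].
Qed.

Lemma shift_0 z v : shift z v 0 = z.
Proof. unfold shift; rewrite !Rmult_0_l, !Rplus_0_r; now destruct z. Qed.

Lemma ray_int_dir N F fx fy p s z v :
  (forall u, disc p s u -> is_dR F u (fx u) (fy u)) ->
  (forall u, disc p s u -> continuous fx u) -> (forall u, disc p s u -> continuous fy u) -> disc p s z ->
  is_derive (fun x : R => ray_int N F p (shift z v x)) 0
    (ray_int (S N) (fun u => fx u * fst v + fy u * snd v) p z).
Proof.
  intros hF hx hy hz.
  assert (hFc : forall u, disc p s u -> continuous F u) by (intros; eapply is_dR_continuous; eauto).
  assert (hD : forall x t, disc p s (ray p (shift z v x) t) ->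
     is_derive (fun x => t ^ N * F (ray p (shift z v x) t)) x
       (t ^ S N * (fx (ray p (shift z v x) t) * fst v + fy (ray p (shift z v x) t) * snd v))).
  { intros x t h.
    replace (t ^ S N * _) with (t ^ N * (fx (ray p (shift z v x) t) * (t * fst v) + fy (ray p (shift z v x) t) * (t * snd v))) by (simpl; ring).
    apply (is_derive_scal (fun x => F (ray p (shift z v x) t))).
    apply (is_dR_curve F (fun x => fst p + t * (fst z + x * fst v - fst p)) (fun x => snd p + t * (snd z + x * snd v - snd p))).
    - auto_derive; [easy | ring].
    - auto_derive; [easy | ring].
    - now apply hF. }
  assert (hloc : locally 0 (fun x : R => disc p s (shift z v x))).
  { apply (continuous_shift z v 0). rewrite shift_0. now apply disc_open. }
  assert (hcr : forall t, continuous (fun u : R * R => ray p (shift z v (fst u)) (snd u)) (0, t)).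
  { intros t. apply (continuous_comp_2 (fun u : R * R => snd u) (fun u : R * R => shift z v (fst u)) (fun t z => ray p z t)).
    - apply continuous_snd.
    - apply (continuous_comp (fun u : R * R => fst u) (shift z v)); [apply continuous_fst | apply continuous_shift].
    - apply continuous_ray. }
  assert (hloc2 : forall t, 0 <= t <= 1 -> locally (0, t) (fun u : R * R => disc p s (ray p (shift z v (fst u)) (snd u)))).
  { intros t ht. apply (hcr t). apply disc_open. simpl. apply ray_disc; auto. now rewrite shift_0. }
  unfold ray_int at 2. rewrite (RInt_ext _ (fun t => Derive (fun x => t ^ N * F (ray p (shift z v x) t)) 0)).
  - apply (is_derive_RInt_param (fun x t => t ^ N * F (ray p (shift z v x) t))).
    + apply filter_imp with (2 := hloc). intros x hxd t. rewrite Rmin_left, Rmax_right by lra. intros ht.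
      eexists; apply hD. now apply ray_disc.
    + intros t. rewrite Rmin_left, Rmax_right by lra. intros ht.
      apply continuity_2d_pt_filterlim.
      change (continuous (fun u : R * R => Derive (fun x => snd u ^ N * F (ray p (shift z v x) (snd u))) (fst u)) (0, t)).
      apply (continuous_ext_loc _ (fun u : R * R => snd u ^ S N * (fx (ray p (shift z v (fst u)) (snd u)) * fst v + fy (ray p (shift z v (fst u)) (snd u)) * snd v))).
      * apply filter_imp with (2 := hloc2 t ht). intros [x t'] h; simpl in h. symmetry. now apply is_derive_unique, hD.
      * apply (continuous_mult (K := R_AbsRing) (fun u : R * R => snd u ^ S N) (fun u : R * R => fx (ray p (shift z v (fst u)) (snd u)) * fst v + fy (ray p (shift z v (fst u)) (snd u)) * snd v)).
        -- apply (continuous_comp (fun u : R * R => snd u) (fun x => x ^ S N)); [apply continuous_snd |].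
           apply (ex_derive_continuous (fun x : R => x ^ S N)). auto_derive; easy.
        -- apply (continuous_plus (K := R_AbsRing) (V := R_NormedModule)
             (fun u : R * R => fx (ray p (shift z v (fst u)) (snd u)) * fst v) (fun u : R * R => fy (ray p (shift z v (fst u)) (snd u)) * snd v)).
           ++ apply (continuous_mult (K := R_AbsRing) (fun u : R * R => fx (ray p (shift z v (fst u)) (snd u))) (fun _ => fst v)); [| apply continuous_const].
              apply (continuous_comp (fun u : R * R => ray p (shift z v (fst u)) (snd u)) fx); [apply hcr |].
              apply hx. simpl. rewrite shift_0. now apply ray_disc.
           ++ apply (continuous_mult (K := R_AbsRing) (fun u : R * R => fy (ray p (shift z v (fst u)) (snd u))) (fun _ => snd v)); [| apply continuous_const].
              apply (continuous_comp (fun u : R * R => ray p (shift z v (fst u)) (snd u)) fy); [apply hcr |].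
              apply hy. simpl. rewrite shift_0. now apply ray_disc.
    + apply filter_imp with (2 := hloc). intros x hxd. now apply (ex_ray_int N F p s).
  - intros t. rewrite Rmin_left, Rmax_right by lra. intros ht. symmetry. apply is_derive_unique.
    specialize (hD 0 t). rewrite !shift_0 in hD. apply hD. apply ray_disc; auto; lra.
Qed.

Lemma ray_int_dR N F fx fy p s z :
  (forall u, disc p s u -> is_dR F u (fx u) (fy u)) ->
  (forall u, disc p s u -> continuous fx u) -> (forall u, disc p s u -> continuous fy u) -> disc p s z ->
  is_dR (ray_int N F p) z (ray_int (S N) fx p z) (ray_int (S N) fy p z).
Proof.
  intros hF hx hy hz.
  assert (D : forall v u, disc p s u -> is_derive (fun x : R => ray_int N F p (shift u v x)) 0
    (ray_int (S N) (fun u => fx u * fst v + fy u * snd v) p u)) by (intros; now apply ray_int_dir with s).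
  assert (E1 : forall u, ray_int (S N) (fun u => fx u * fst (RtoC 1) + fy u * snd (RtoC 1)) p u = ray_int (S N) fx p u).
  { intros u; apply RInt_ext; intros; simpl; ring. }
  assert (E2 : forall u, ray_int (S N) (fun u => fx u * fst Ci + fy u * snd Ci) p u = ray_int (S N) fy p u).
  { intros u; apply RInt_ext; intros; simpl; ring. }
  assert (F1 : forall u, disc p s u -> dR (ray_int N F p) u (RtoC 1) = ray_int (S N) fx p u).
  { intros u hu. rewrite <- E1. apply is_derive_unique, D, hu. }
  rewrite <- (F1 z hz), <- E2, <- (is_derive_unique _ _ _ (D Ci z hz)).
  apply is_dR_of_partials.
  - apply filter_imp with (2 := disc_open p s z hz). intros u hu. eexists; now apply D.
  - eexists; now apply D.
  - apply (continuous_ext_loc _ (ray_int (S N) fx p)).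
    + apply filter_imp with (2 := disc_open p s z hz). intros u hu; symmetry; now apply F1.
    + now apply continuous_ray_int with s.
Qed.

Lemma Ck_ray_int n N F p s : Ck n (disc p s) F -> Ck n (disc p s) (ray_int N F p).
Proof.
  revert N F; induction n as [|n IH]; intros N F hF.
  - intros z hz; now apply continuous_ray_int with s.
  - destruct hF as [fx [fy [h1 [h2 h3]]]].
    exists (ray_int (S N) fx p), (ray_int (S N) fy p). split; [| auto].
    intros z hz; apply ray_int_dR with s; auto; intros u hu; eapply Ck_continuous; eauto.
Qed.

Lemma smoothR_ray_int N F p s : smoothR (disc p s) F -> smoothR (disc p s) (ray_int N F p).
Proof. rewrite !smoothR_Ck by apply disc_open. intros h n; now apply Ck_ray_int. Qed.

Definition ray_intC (N : nat) (F : C -> C) (p z : C) : C :=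
  (ray_int N (fun u => fst (F u)) p z, ray_int N (fun u => snd (F u)) p z).

Lemma smoothC_ray_intC N F p s : smoothC (disc p s) F -> smoothC (disc p s) (ray_intC N F p).
Proof. intros [h1 h2]; split; now apply smoothR_ray_int. Qed.

Lemma ray_int_lin N F G p s z a b : (forall u, disc p s u -> continuous F u) -> (forall u, disc p s u -> continuous G u) ->
  disc p s z -> RInt (fun t => t ^ N * (a * F (ray p z t) + b * G (ray p z t))) 0 1 = a * ray_int N F p z + b * ray_int N G p z.
Proof.
  intros hF hG hz. pose proof (ex_ray_int N F p s z hF hz) as e1. pose proof (ex_ray_int N G p s z hG hz) as e2.
  unfold ray_int.
  rewrite (RInt_ext _ (fun t => plus (scal a (t ^ N * F (ray p z t))) (scal b (t ^ N * G (ray p z t))))).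
  - rewrite (RInt_plus (V := R_CompleteNormedModule)), !(RInt_scal (V := R_CompleteNormedModule)); auto;
      now apply (ex_RInt_scal (V := R_NormedModule)).
  - intros t _. unfold plus, scal; simpl; unfold mult; simpl; ring.
Qed.

(** A factor [A] that is homogeneous of degree [k] along rays turns into the weight [t^k]. *)
Lemma ray_intC_mult k (A F : C -> C) p s z c : smoothC (disc p s) F -> disc p s z ->
  (forall t, A (ray p z t) = (RtoC (t ^ k) * c)%C) ->
  ray_intC 0 (fun u => A u * F u)%C p z = (c * ray_intC k F p z)%C.
Proof.
  intros [h1 h2] hz hA.
  assert (c1 : forall u, disc p s u -> continuous (fun u => fst (F u)) u) by (intros; now apply (smoothR_continuous (disc p s)); [apply disc_open | |]).
  assert (c2 : forall u, disc p s u -> continuous (fun u => snd (F u)) u) by (intros; now apply (smoothR_continuous (disc p s)); [apply disc_open | |]).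
  apply injective_projections; simpl; unfold ray_int at 1.
  - rewrite (RInt_ext _ (fun t => t ^ k * (fst c * fst (F (ray p z t)) + (- snd c) * snd (F (ray p z t))))).
    + etransitivity; [exact (ray_int_lin k (fun u : C => fst (F u)) (fun u : C => snd (F u)) p s z (fst c) (- snd c) c1 c2 hz) | ring].
    + intros t _. rewrite hA; simpl; ring.
  - rewrite (RInt_ext _ (fun t => t ^ k * (fst c * snd (F (ray p z t)) + (snd c) * fst (F (ray p z t))))).
    + etransitivity; [exact (ray_int_lin k (fun u : C => snd (F u)) (fun u : C => fst (F u)) p s z (fst c) (snd c) c2 c1 hz) | ring].
    + intros t _. rewrite hA; simpl; ring.
Qed.

Lemma ray_intC_plus k (F G : C -> C) p s z : smoothC (disc p s) F -> smoothC (disc p s) G -> disc p s z ->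
  ray_intC k (fun u => F u + G u)%C p z = (ray_intC k F p z + ray_intC k G p z)%C.
Proof.
  intros [h1 h2] [h3 h4] hz.
  assert (cc : forall g, smoothR (disc p s) g -> forall u, disc p s u -> continuous g u)
    by (intros; now apply (smoothR_continuous (disc p s)); [apply disc_open | |]).
  apply injective_projections; simpl; unfold ray_int at 1.
  - rewrite (RInt_ext _ (fun t => t ^ k * (1 * fst (F (ray p z t)) + 1 * fst (G (ray p z t))))).
    + etransitivity; [exact (ray_int_lin k (fun u : C => fst (F u)) (fun u : C => fst (G u)) p s z 1 1 (cc _ h1) (cc _ h3) hz) | ring].
    + intros t _; simpl; ring.
  - rewrite (RInt_ext _ (fun t => t ^ k * (1 * snd (F (ray p z t)) + 1 * snd (G (ray p z t))))).
    + etransitivity; [exact (ray_int_lin k (fun u : C => snd (F u)) (fun u : C => snd (G u)) p s z 1 1 (cc _ h2) (cc _ h4) hz) | ring].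
    + intros t _; simpl; ring.
Qed.

(** The fundamental theorem of calculus along the ray from [p] to [z]. *)
Lemma hadamard (f : C -> C) p s z : smoothC (disc p s) f -> disc p s z -> f p = RtoC 0 ->
  f z = ((z - p) * ray_intC 0 (Dz f) p z + Cconj (z - p) * ray_intC 0 (Dzb f) p z)%C.
Proof.
  intros hf hz h0. pose proof (disc_open p s) as ho.
  assert (H : forall g : C -> R, smoothR (disc p s) g -> g p = 0 ->
     g z = (fst z - fst p) * ray_int 0 (fun u => dR g u (RtoC 1)) p z + (snd z - snd p) * ray_int 0 (fun u => dR g u Ci) p z).
  { intros g hg g0.
    assert (cc : forall v u, disc p s u -> continuous (fun u => dR g u v) u)
      by (intros; now apply (smoothR_continuous (disc p s)); [apply disc_open | apply smoothR_dR |]).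
    rewrite <- (ray_int_lin 0 _ _ p s z _ _ (cc _) (cc _) hz).
    assert (I : is_RInt (fun t => t ^ 0 * ((fst z - fst p) * dR g (ray p z t) (RtoC 1) + (snd z - snd p) * dR g (ray p z t) Ci)) 0 1
       (minus (g (ray p z 1)) (g (ray p z 0)))).
    { apply (is_RInt_derive (V := R_CompleteNormedModule) (fun t => g (ray p z t))).
      - intros t; rewrite Rmin_left, Rmax_right by lra; intros ht.
        replace (t ^ 0 * _) with (dR g (ray p z t) (RtoC 1) * (fst z - fst p) + dR g (ray p z t) Ci * (snd z - snd p)) by (simpl; ring).
        apply (is_dR_curve g (fun t => fst p + t * (fst z - fst p)) (fun t => snd p + t * (snd z - snd p))).
        + auto_derive; [easy | ring].
        + auto_derive; [easy | ring].
        + apply (smoothR_is_dR (disc p s)); auto. now apply ray_disc.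
      - intros t; rewrite Rmin_left, Rmax_right by lra; intros ht.
        apply (continuous_ext (fun t => (fst z - fst p) * (t ^ 0 * dR g (ray p z t) (RtoC 1)) + (snd z - snd p) * (t ^ 0 * dR g (ray p z t) Ci)));
          [intros; simpl; ring |].
        assert (ci : forall v, continuous (fun t => t ^ 0 * dR g (ray p z t) v) t).
        { intros v. apply (continuous_comp_2 (fun t : R => t) (fun _ : R => z) (fun t z => t ^ 0 * dR g (ray p z t) v)).
          - apply continuous_id.
          - apply continuous_const.
          - apply (continuous_ray_integrand 0 (fun u => dR g u v) p s z t (cc v) hz ht). }
        apply (continuous_plus (K := R_AbsRing) (V := R_NormedModule) (fun t => (fst z - fst p) * (t ^ 0 * dR g (ray p z t) (RtoC 1))) (fun t => (snd z - snd p) * (t ^ 0 * dR g (ray p z t) Ci)));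
          [apply (continuous_scal_r (K := R_AbsRing) (V := R_NormedModule) (fst z - fst p) _ _ (ci _)) |
           apply (continuous_scal_r (K := R_AbsRing) (V := R_NormedModule) (snd z - snd p) _ _ (ci _))]. }
    apply (is_RInt_unique (V := R_CompleteNormedModule)) in I. rewrite I.
    replace (ray p z 1) with z by (unfold ray; apply injective_projections; simpl; ring).
    replace (ray p z 0) with p by (unfold ray; apply injective_projections; simpl; ring).
    rewrite g0. unfold minus, plus, opp; simpl; ring. }
  destruct hf as [f1 f2].
  assert (cc : forall g v u, smoothR (disc p s) g -> disc p s u -> continuous (fun u => dR g u v) u)
      by (intros; now apply (smoothR_continuous (disc p s)); [apply disc_open | apply smoothR_dR |]).
  assert (L : forall a b g1 g2 v1 v2, smoothR (disc p s) g1 -> smoothR (disc p s) g2 ->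
     ray_int 0 (fun u => (a * dR g1 u v1 + b * dR g2 u v2) ) p z = a * ray_int 0 (fun u => dR g1 u v1) p z + b * ray_int 0 (fun u => dR g2 u v2) p z).
  { intros. apply (ray_int_lin 0 (fun u => dR g1 u v1) (fun u => dR g2 u v2) p s z a b); auto. }
  assert (X : forall (a b : C -> R), (forall u, a u = b u) -> ray_int 0 a p z = ray_int 0 b p z)
    by (intros a b e; apply RInt_ext; intros; now rewrite e).
  unfold Re, Im in f1, f2.
  set (g1 := fun u => fst (f u)) in *. set (g2 := fun u => snd (f u)) in *.
  assert (P1 : ray_int 0 (fun u => fst (Dz f u)) p z = / 2 * ray_int 0 (fun u => dR g1 u (RtoC 1)) p z + / 2 * ray_int 0 (fun u => dR g2 u Ci) p z)
    by (rewrite <- L by assumption; apply X; intros; unfold Dz, g1, g2; simpl; field).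
  assert (P2 : ray_int 0 (fun u => snd (Dz f u)) p z = / 2 * ray_int 0 (fun u => dR g2 u (RtoC 1)) p z + (- / 2) * ray_int 0 (fun u => dR g1 u Ci) p z)
    by (rewrite <- L by assumption; apply X; intros; unfold Dz, g1, g2; simpl; field).
  assert (P3 : ray_int 0 (fun u => fst (Dzb f u)) p z = / 2 * ray_int 0 (fun u => dR g1 u (RtoC 1)) p z + (- / 2) * ray_int 0 (fun u => dR g2 u Ci) p z)
    by (rewrite <- L by assumption; apply X; intros; unfold Dzb, g1, g2; simpl; field).
  assert (P4 : ray_int 0 (fun u => snd (Dzb f u)) p z = / 2 * ray_int 0 (fun u => dR g2 u (RtoC 1)) p z + / 2 * ray_int 0 (fun u => dR g1 u Ci) p z)
    by (rewrite <- L by assumption; apply X; intros; unfold Dzb, g1, g2; simpl; field).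
  assert (Q1 := H g1 f1 (f_equal fst h0)). assert (Q2 := H g2 f2 (f_equal snd h0)).
  unfold ray_intC. rewrite P1, P2, P3, P4. apply injective_projections; simpl.
  - change (fst (f z)) with (g1 z); rewrite Q1; field.
  - change (snd (f z)) with (g2 z); rewrite Q2; field.
Qed.

(** * Dividing solutions of d-bar systems *)

(** A function of quadratic size is differentiable with differential zero. *)
Lemma is_dR_zero (f : C -> R) p M s : 0 < s -> 0 <= M ->
  (forall z, disc p s z -> Rabs (f z) <= M * Cmod (z - p) ^ 2) -> is_dR f p 0 0.
Proof.
  intros hs hM h.
  assert (f0 : f p = 0).
  { specialize (h p (disc_center p s hs)). replace (p - p)%C with (RtoC 0) in h by ring.
    rewrite Cmod_0 in h. specialize (Rabs_pos (f p)); intros.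
    assert (Rabs (f p) = 0) by nra. destruct (Req_dec (f p) 0); auto. now apply Rabs_no_R0 in H1. }
  split.
  - assert (hl := proj1 (is_dR_const 0 p)). exact hl.
  - intros x hx eps. apply (is_filter_lim_locally_unique (K := R_AbsRing) (V := R2)) in hx. subst x.
    assert (he := cond_pos eps).
    apply (disc_locally p (Rmin s (eps / (M + 1)))).
    { apply Rmin_glb_lt; [auto | apply Rdiv_lt_0_compat; lra]. }
    intros u hu. unfold disc in hu.
    assert (u1 : Cmod (u - p) < s) by (eapply Rlt_le_trans; [exact hu | apply Rmin_l]).
    assert (u2 : Cmod (u - p) < eps / (M + 1)) by (eapply Rlt_le_trans; [exact hu | apply Rmin_r]).
    specialize (h u u1).
    change (Rabs (f u - f p - ((fst u - fst p) * 0 + (snd u - snd p) * 0)) <= eps * sqrt (Rabs (fst u - fst p) ^ 2 + Rabs (snd u - snd p) ^ 2)).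
    rewrite f0. replace (f u - 0 - ((fst u - fst p) * 0 + (snd u - snd p) * 0)) with (f u) by ring.
    rewrite !pow2_abs. change (sqrt ((fst u - fst p) ^ 2 + (snd u - snd p) ^ 2)) with (Cmod (u - p)).
    apply Rle_trans with (1 := h). specialize (Cmod_ge_0 (u - p)); intros hc.
    apply Rlt_div_r in u2; [| lra]. simpl. nra.
Qed.

Lemma is_W_pow (f : C -> C) z p q n : is_W f z p q ->
  is_W (fun u => f u ^ n)%C z (INR n * f z ^ (pred n) * p)%C (INR n * f z ^ (pred n) * q)%C.
Proof.
  intros h; induction n as [|n IH].
  - simpl. eapply is_W_eq; [apply is_W_const | |]; ring.
  - eapply is_W_eq; [exact (is_W_mult _ _ _ _ _ _ _ h IH) | |]; rewrite S_INR, RtoC_plus;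
      (destruct n as [|n]; [simpl; ring | simpl Init.Nat.pred; rewrite (Cpow_S (f z) n); ring]).
Qed.

Definition CkC (n : nat) (U : C -> Prop) (f : C -> C) : Prop :=
  Ck n U (fun u => fst (f u)) /\ Ck n U (fun u => snd (f u)).

Lemma CkC_S n U f P Q : (forall z, U z -> is_W f z (P z) (Q z)) -> CkC n U P -> CkC n U Q -> CkC (S n) U f.
Proof.
  intros hW [p1 p2] [q1 q2]; split.
  - exists (fun z => fst (P z) + fst (Q z)), (fun z => snd (Q z) + - snd (P z)).
    split; [intros z hz; apply (hW z hz) | split; apply Ck_plus; auto; now apply Ck_opp].
  - exists (fun z => snd (P z) + snd (Q z)), (fun z => fst (P z) + - fst (Q z)).
    split; [intros z hz; apply (hW z hz) | split; apply Ck_plus; auto; now apply Ck_opp].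
Qed.

Lemma CkC_plus n U f g : CkC n U f -> CkC n U g -> CkC n U (fun z => f z + g z)%C.
Proof. intros [] []; split; simpl; now apply Ck_plus. Qed.

Lemma CkC_mult n U f g : CkC n U f -> CkC n U g -> CkC n U (fun z => f z * g z)%C.
Proof.
  intros [] []; split; simpl.
  - apply Ck_plus; [| apply Ck_opp]; now apply Ck_mult.
  - apply Ck_plus; now apply Ck_mult.
Qed.

Lemma CkC_const n U c : CkC n U (fun _ => c).
Proof. split; apply Ck_const. Qed.

Lemma CkC_ext n (U : C -> Prop) f g : open U -> (forall z, U z -> f z = g z) -> CkC n U f -> CkC n U g.
Proof.
  intros hU e [h1 h2]; split.
  - eapply Ck_ext; [exact hU | | exact h1]; intros z hz; simpl; now rewrite e.
  - eapply Ck_ext; [exact hU | | exact h2]; intros z hz; simpl; now rewrite e.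
Qed.

Lemma smoothC_CkC U f : open U -> smoothC U f <-> (forall n, CkC n U f).
Proof.
  intros hU; unfold smoothC, CkC, Re, Im. rewrite !smoothR_Ck by auto. split.
  - intros [h1 h2] n; auto.
  - intros h; split; intros n; apply h.
Qed.

(** With the convention [/ 0 = 0] this is [conj (z - p)^a / (z - p)^b] extended by 0 at [p].  It is of class [C^n] as soon as [a >= b + 2 + n]: a derivative lowers [a - b] by one. *)
Definition conj_quot (a b : nat) (p z : C) : C := (Cconj (z - p) ^ a * (/ (z - p)) ^ b)%C.

Lemma conj_quot_le a b p z : Cmod (z - p) <= 1 -> Cmod (conj_quot (b + 2 + a) b p z) <= Cmod (z - p) ^ 2.
Proof.
  intros h. unfold conj_quot. rewrite Cmod_mult, !Cmod_pow, Cmod_conj.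
  set (x := Cmod (z - p)) in *. assert (hx : 0 <= x) by apply Cmod_ge_0.
  assert (hi : 0 <= Cmod (/ (z - p)) /\ x * Cmod (/ (z - p)) <= 1).
  { split; [apply Cmod_ge_0 |].
    destruct (classic ((z - p)%C = 0%C)) as [e | e].
    - unfold x; rewrite e, Cmod_0; lra.
    - unfold x; rewrite <- Cmod_mult, Cinv_r, Cmod_1 by auto; lra. }
  set (y := Cmod (/ (z - p))) in *.
  rewrite !pow_add. replace (x ^ b * x ^ 2 * x ^ a * y ^ b) with (x ^ 2 * ((x * y) ^ b * x ^ a)) by (rewrite Rpow_mult_distr; ring).
  rewrite <- (Rmult_1_r (x ^ 2)) at 2. apply Rmult_le_compat_l; [apply pow2_ge_0 |].
  rewrite <- (Rmult_1_r 1). apply Rmult_le_compat.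
  - apply pow_le, Rmult_le_pos; lra.
  - now apply pow_le.
  - rewrite <- (pow1 b). apply pow_incr. split; [apply Rmult_le_pos; lra | lra].
  - rewrite <- (pow1 a). apply pow_incr; lra.
Qed.

Lemma conj_quot_W a b p z : is_W (conj_quot (b + 2 + a) b p) z
  (- INR b * conj_quot (b + 2 + a) (S b) p z)%C (INR (b + 2 + a) * conj_quot (pred (b + 2 + a)) b p z)%C.
Proof.
  destruct (classic (z = p)) as [-> | hz].
  - assert (e1 : forall c b, conj_quot (S c) b p p = 0%C).
    { intros c b'; unfold conj_quot. rewrite Cpow_S. replace (Cconj (p - p)) with (RtoC 0); [ring |].
      apply injective_projections; simpl; ring. }
    replace (b + 2 + a)%nat with (S (S (b + a))) at 2 3 4 by lia. simpl Init.Nat.pred. rewrite !e1.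
    assert (hd : forall u, disc p 1 u -> Cmod (conj_quot (b + 2 + a) b p u) <= 1 * Cmod (u - p) ^ 2)
      by (intros u hu; rewrite Rmult_1_l; apply conj_quot_le; unfold disc in hu; lra).
    split.
    + eapply is_dR_ext_lin.
      * apply (is_dR_zero _ p 1 1); try lra. intros u hu. eapply Rle_trans; [apply (re_le_Cmod (conj_quot _ _ p u)) | now apply hd].
      * simpl; ring.
      * simpl; ring.
    + eapply is_dR_ext_lin.
      * apply (is_dR_zero _ p 1 1); try lra. intros u hu. eapply Rle_trans; [| now apply hd].
        eapply Rle_trans; [| apply Rmax_Cmod]. apply Rmax_r.
      * simpl; ring.
      * simpl; ring.
  - assert (h0 : (z - p)%C <> 0%C). { intros e; apply hz. replace z with (p + (z - p))%C by ring. rewrite e; ring. }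
    assert (h1 := is_W_minus _ _ _ _ _ _ _ (is_W_id z) (is_W_const p z)).
    assert (h2 := is_W_pow _ _ _ _ (b + 2 + a) (is_W_conj _ _ _ _ h1)).
    assert (h3 := is_W_pow _ _ _ _ b (is_W_inv (fun u => u - p)%C z _ _ h0 h1)).
    eapply is_W_eq; [exact (is_W_mult _ _ _ _ _ _ _ h2 h3) | |]; unfold conj_quot.
    + rewrite !Cminus_conj. replace (Cconj 0) with (RtoC 0) by (apply injective_projections; simpl; ring).
      destruct b as [|b]; [simpl INR; ring | simpl Init.Nat.pred]. rewrite !(Cpow_S (/ (z - p))). field. exact h0.
    + replace (Cconj (1 - 0))%C with (RtoC 1) by (apply injective_projections; simpl; ring).
      field. exact h0.
Qed.

Lemma conj_quot_CkC n : forall a b p U, CkC n U (conj_quot (b + 2 + n + a) b p).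
Proof.
  induction n as [|n IH]; intros a b p U.
  - replace (b + 2 + 0 + a)%nat with (b + 2 + a)%nat by lia.
    split; intros z _; eapply is_dR_continuous; [exact (proj1 (conj_quot_W a b p z)) | exact (proj2 (conj_quot_W a b p z))].
  - replace (b + 2 + S n + a)%nat with (b + 2 + (S n + a))%nat by lia.
    eapply CkC_S; [intros z _; apply conj_quot_W | |]; apply CkC_mult; try apply CkC_const.
    + replace (b + 2 + (S n + a))%nat with (S b + 2 + n + a)%nat by lia. apply IH.
    + replace (pred (b + 2 + (S n + a)))%nat with (b + 2 + n + a)%nat by lia. apply IH.
Qed.

(** A linear system [dbar f = A f] for a pair; the coefficients of I_1 in a frame satisfy one, and those of I_2 one with a vanishing second component. *)
Definition dbar_system (U : C -> Prop) (A11 A12 A21 A22 f1 f2 : C -> C) : Prop :=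
  forall z, U z -> Dzb f1 z = (A11 z * f1 z + A12 z * f2 z)%C /\ Dzb f2 z = (A21 z * f1 z + A22 z * f2 z)%C.

Lemma ray_conj_pow p z N t : (Cconj (ray p z t - p) ^ N)%C = (RtoC (t ^ N) * Cconj (z - p) ^ N)%C.
Proof.
  rewrite RtoC_pow, <- Cpow_mult_l. f_equal. unfold ray; apply injective_projections; simpl; ring.
Qed.

(** Hadamard expresses [f] by ray integrals of its derivatives, and the terms of [dbar f] are homogeneous along rays up to smooth factors, so they come out of the integral; the remaining factor [conj (z - p)] raises the exponent. *)
Lemma dbar_primitive p s N (f G H : C -> C) : smoothC (disc p s) f -> smoothC (disc p s) G -> smoothC (disc p s) H ->
  f p = RtoC 0 ->
  (forall z, disc p s z -> Dzb f z = ((z - p) * G z + Cconj (z - p) ^ N * H z)%C) ->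
  exists G' H', smoothC (disc p s) G' /\ smoothC (disc p s) H' /\
    forall z, disc p s z -> f z = ((z - p) * G' z + Cconj (z - p) ^ (S N) * H' z)%C.
Proof.
  intros hf hG hH h0 hd. pose proof (disc_open p s) as ho. pose proof (smoothC_euler_field _ p ho) as hzp.
  assert (hzc : smoothC (disc p s) (fun z => Cconj (z - p))) by now apply smoothC_conj.
  assert (hpow : forall N, smoothC (disc p s) (fun z => Cconj (z - p) ^ N)%C).
  { induction N0 as [|m IH]; simpl; [now apply smoothC_const | now apply smoothC_mult]. }
  exists (fun z => ray_intC 0 (Dz f) p z + Cconj (z - p) * ray_intC 1 G p z)%C, (ray_intC N H p).
  split; [| split].
  - apply smoothC_plus; auto; [apply smoothC_ray_intC, smoothC_Dz; auto | apply smoothC_mult; auto; now apply smoothC_ray_intC].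
  - now apply smoothC_ray_intC.
  - intros z hz. rewrite (hadamard f p s z hf hz h0) at 1.
    assert (e : ray_intC 0 (Dzb f) p z = ray_intC 0 (fun u => (u - p) * G u + Cconj (u - p) ^ N * H u)%C p z).
    { unfold ray_intC, ray_int. f_equal; apply RInt_ext; intros t; rewrite Rmin_left, Rmax_right by lra; intros ht;
        rewrite hd by (apply ray_disc; auto; lra); reflexivity. }
    rewrite e, (ray_intC_plus 0 (fun u => (u - p) * G u)%C (fun u => Cconj (u - p) ^ N * H u)%C p s z); auto;
      try (apply smoothC_mult; auto).
    rewrite (ray_intC_mult 1 (fun u => u - p)%C G p s z (z - p)%C); auto.
    2: { intros t; unfold ray; apply injective_projections; simpl; ring. }
    rewrite (ray_intC_mult N (fun u => Cconj (u - p) ^ N)%C H p s z (Cconj (z - p) ^ N)%C); auto.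
    2: { intros t; apply ray_conj_pow. }
    rewrite Cpow_S. ring.
Qed.

(** By induction on [N]: substituting the expansion of order [N] into the system gives [dbar f] in the form required by [dbar_primitive]. *)
Lemma dbar_expansion p s A11 A12 A21 A22 f1 f2 :
  smoothC (disc p s) A11 -> smoothC (disc p s) A12 -> smoothC (disc p s) A21 -> smoothC (disc p s) A22 ->
  smoothC (disc p s) f1 -> smoothC (disc p s) f2 -> dbar_system (disc p s) A11 A12 A21 A22 f1 f2 ->
  f1 p = RtoC 0 -> f2 p = RtoC 0 ->
  forall N, exists G1 H1 G2 H2, smoothC (disc p s) G1 /\ smoothC (disc p s) H1 /\ smoothC (disc p s) G2 /\ smoothC (disc p s) H2 /\
    forall z, disc p s z -> f1 z = ((z - p) * G1 z + Cconj (z - p) ^ N * H1 z)%C /\ f2 z = ((z - p) * G2 z + Cconj (z - p) ^ N * H2 z)%C.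
Proof.
  intros a11 a12 a21 a22 hf1 hf2 hsys f10 f20 N. pose proof (disc_open p s) as ho.
  induction N as [|N IH].
  - exists (fun _ => RtoC 0), f1, (fun _ => RtoC 0), f2. refine (conj _ (conj _ (conj _ (conj _ _)))); auto using smoothC_const.
    intros z hz; split; simpl; ring.
  - destruct IH as [G1 [H1 [G2 [H2 [g1 [h1 [g2 [h2 e]]]]]]]].
    destruct (dbar_primitive p s N f1 (fun z => A11 z * G1 z + A12 z * G2 z)%C (fun z => A11 z * H1 z + A12 z * H2 z)%C) as [G1' [H1' [k1 [k2 k3]]]]; auto.
    + apply smoothC_plus; auto; now apply smoothC_mult.
    + apply smoothC_plus; auto; now apply smoothC_mult.
    + intros z hz. rewrite (proj1 (hsys z hz)). destruct (e z hz) as [e1 e2]. rewrite e1, e2. ring.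
    + destruct (dbar_primitive p s N f2 (fun z => A21 z * G1 z + A22 z * G2 z)%C (fun z => A21 z * H1 z + A22 z * H2 z)%C) as [G2' [H2' [k4 [k5 k6]]]]; auto.
      * apply smoothC_plus; auto; now apply smoothC_mult.
      * apply smoothC_plus; auto; now apply smoothC_mult.
      * intros z hz. rewrite (proj2 (hsys z hz)). destruct (e z hz) as [e1 e2]. rewrite e1, e2. ring.
      * exists G1', H1', G2', H2'. refine (conj _ (conj _ (conj _ (conj _ _)))); auto.
Qed.

Definition quotient (f : C -> C) (p z : C) : C :=
  if excluded_middle_informative (z = p) then Dz f p else (f z * / (z - p))%C.

Lemma Csub_neq0 (z p : C) : z <> p -> (z - p)%C <> 0%C.
Proof. intros hz e; apply hz. replace z with (p + (z - p))%C by ring. rewrite e; ring. Qed.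

Lemma quotient_mul f p z : f p = RtoC 0 -> f z = ((z - p) * quotient f p z)%C.
Proof.
  intros h0; unfold quotient; destruct (excluded_middle_informative (z = p)) as [-> | hz].
  - rewrite h0; ring.
  - field. now apply Csub_neq0.
Qed.

(** The expansion of order [N] shows that [f / (z - p)] is [G + conj (z - p)^N H / (z - p)], which is of class [C^(N - 3)]. *)
Lemma smooth_quotient p s f : 0 < s -> f p = RtoC 0 ->
  (forall N, exists G H, smoothC (disc p s) G /\ smoothC (disc p s) H /\
    forall z, disc p s z -> f z = ((z - p) * G z + Cconj (z - p) ^ N * H z)%C) ->
  smoothC (disc p s) (quotient f p).
Proof.
  intros hs h0 hex. pose proof (disc_open p s) as ho. apply smoothC_CkC; auto. intros n.
  (* conj_quot (n + 3) 1 is of class C^n, by n + 3 = 1 + 2 + n *)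
  destruct (hex (n + 3)%nat) as [G [H [hG [hH e]]]].
  apply CkC_ext with (fun z => G z + conj_quot (n + 3) 1 p z * H z)%C; auto.
  - intros z hz. unfold quotient. destruct (excluded_middle_informative (z = p)) as [-> | hne].
    + assert (w := is_W_plus _ _ _ _ _ _ _
         (is_W_mult _ _ _ _ _ _ _ (is_W_minus _ _ _ _ _ _ _ (is_W_id p) (is_W_const p p)) (smoothC_W _ _ _ ho hG hz))
         (is_W_mult _ _ _ _ _ _ _ (is_W_pow _ _ _ _ (n + 3) (is_W_conj _ _ _ _ (is_W_minus _ _ _ _ _ _ _ (is_W_id p) (is_W_const p p)))) (smoothC_W _ _ _ ho hH hz))).
      apply (is_W_ext_loc _ f) in w.
      2: { apply filter_imp with (2 := ho p hz). intros u hu; symmetry; now apply e. }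
      rewrite (is_W_Dz _ _ _ _ w). clear w. unfold conj_quot.
      replace (Cconj (p - p)) with (RtoC 0) by (apply injective_projections; simpl; ring).
      replace (Cconj (0 - 0)) with (RtoC 0) by (apply injective_projections; simpl; ring).
      replace (n + 3)%nat with (S (n + 2)) by lia. rewrite !Cpow_S. ring.
    + rewrite (e z hz). unfold conj_quot. rewrite Cpow_1_r. field. now apply Csub_neq0.
  - apply CkC_plus; [now apply smoothC_CkC | apply CkC_mult; [| now apply smoothC_CkC]].
    replace (n + 3)%nat with (1 + 2 + n + 0)%nat by lia. apply conj_quot_CkC.
Qed.

Lemma disc_punctured p (e : R) : 0 < e -> exists z, disc p e z /\ z <> p.
Proof.
  intros he. exists (p + RtoC (e / 2))%C. split.
  - unfold disc. replace (p + (e / 2)%R - p)%C with (RtoC (e / 2)) by ring. rewrite Cmod_R, Rabs_pos_eq; lra.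
  - intros h. apply (f_equal fst) in h. simpl in h. lra.
Qed.

Lemma continuous_eq_punctured (f g : C -> C) p : continuous f p -> continuous g p ->
  locally p (fun z => z <> p -> f z = g z) -> f p = g p.
Proof.
  intros hf hg h. apply NNPP; intro hne.
  assert (hc : continuous (fun z => Cmod (f z - g z)) p).
  { apply (continuous_comp (fun z => (f z - g z)%C) Cmod); [| apply continuous_Cmod].
    apply (continuous_minus (K := C_AbsRing) (V := C_NormedModule) f g); assumption. }
  assert (hp : 0 < Cmod (f p - g p)) by now apply Cmod_gt_0, Csub_neq0.
  assert (hl := hc _ (open_gt 0 _ hp)).
  destruct (locally_disc p _ (filter_and _ _ h hl)) as [e [he hh]].
  destruct (disc_punctured p e he) as [z [hz1 hz2]].
  destruct (hh z hz1) as [k1 k2]. rewrite (k1 hz2) in k2.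
  replace (g z - g z)%C with (RtoC 0) in k2 by ring. rewrite Cmod_0 in k2. lra.
Qed.

(** Since [z - p] is holomorphic, the quotients satisfy the same system away from [p], and at [p] by continuity. *)
Lemma dbar_divide p s A11 A12 A21 A22 f1 f2 : 0 < s ->
  smoothC (disc p s) A11 -> smoothC (disc p s) A12 -> smoothC (disc p s) A21 -> smoothC (disc p s) A22 ->
  smoothC (disc p s) f1 -> smoothC (disc p s) f2 -> dbar_system (disc p s) A11 A12 A21 A22 f1 f2 ->
  f1 p = RtoC 0 -> f2 p = RtoC 0 ->
  exists g1 g2, smoothC (disc p s) g1 /\ smoothC (disc p s) g2 /\ dbar_system (disc p s) A11 A12 A21 A22 g1 g2 /\
    forall z, f1 z = ((z - p) * g1 z)%C /\ f2 z = ((z - p) * g2 z)%C.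
Proof.
  intros hs a11 a12 a21 a22 hf1 hf2 hsys f10 f20. pose proof (disc_open p s) as ho.
  assert (hexp := dbar_expansion p s A11 A12 A21 A22 f1 f2 a11 a12 a21 a22 hf1 hf2 hsys f10 f20).
  assert (s1 : smoothC (disc p s) (quotient f1 p)).
  { apply smooth_quotient; auto. intros N; destruct (hexp N) as [G1 [H1 [G2 [H2 [k1 [k2 [k3 [k4 k5]]]]]]]].
    exists G1, H1; refine (conj k1 (conj k2 _)). intros z hz; now apply k5. }
  assert (s2 : smoothC (disc p s) (quotient f2 p)).
  { apply smooth_quotient; auto. intros N; destruct (hexp N) as [G1 [H1 [G2 [H2 [k1 [k2 [k3 [k4 k5]]]]]]]].
    exists G2, H2; refine (conj k3 (conj k4 _)). intros z hz; now apply k5. }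
  set (g1 := quotient f1 p) in *. set (g2 := quotient f2 p) in *.
  assert (m1 : forall z, f1 z = ((z - p) * g1 z)%C) by (intros; now apply quotient_mul).
  assert (m2 : forall z, f2 z = ((z - p) * g2 z)%C) by (intros; now apply quotient_mul).
  assert (cdiv : forall a b c : C, a <> 0%C -> (a * b = a * c)%C -> b = c).
  { intros a b c ha e. replace b with (/ a * (a * b))%C by (field; auto). rewrite e. field; auto. }
  assert (D : forall f g, (forall z, f z = ((z - p) * g z)%C) -> smoothC (disc p s) g -> forall z, disc p s z -> Dzb f z = ((z - p) * Dzb g z)%C).
  { intros f g m hg z hz. apply (is_W_Dzb f z (g z + (z - p) * Dz g z)%C).
    apply is_W_ext_loc with (fun z => (z - p) * g z)%C; [apply filter_forall; intros; now rewrite m |].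
    eapply is_W_eq; [exact (is_W_mult _ _ _ _ _ _ _ (is_W_minus _ _ _ _ _ _ _ (is_W_id z) (is_W_const p z)) (smoothC_W _ _ _ ho hg hz)) | |]; cbv beta; ring. }
  assert (off : forall z, disc p s z -> z <> p -> Dzb g1 z = (A11 z * g1 z + A12 z * g2 z)%C /\ Dzb g2 z = (A21 z * g1 z + A22 z * g2 z)%C).
  { intros z hz hne. destruct (hsys z hz) as [q1 q2].
    rewrite (D f1 g1 m1 s1 z hz), m1, m2 in q1. rewrite (D f2 g2 m2 s2 z hz), m1, m2 in q2.
    split; apply (cdiv (z - p)%C); try (now apply Csub_neq0); [rewrite q1 | rewrite q2]; ring. }
  exists g1, g2; split; [exact s1 |]; split; [exact s2 |]; split; [| auto].
  intros z hz. destruct (classic (z = p)) as [-> | hne]; [| now apply off].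
  assert (hl : locally p (disc p s)) by now apply ho.
  split; [apply (continuous_eq_punctured (Dzb g1) (fun z => A11 z * g1 z + A12 z * g2 z)%C p)
         | apply (continuous_eq_punctured (Dzb g2) (fun z => A21 z * g1 z + A22 z * g2 z)%C p)].
  - apply (smoothC_continuous (disc p s)); auto; now apply smoothC_Dzb.
  - apply (smoothC_continuous (disc p s)); auto; apply smoothC_plus; auto; now apply smoothC_mult.
  - apply filter_imp with (2 := hl); intros u hu hu'; now apply off.
  - apply (smoothC_continuous (disc p s)); auto; now apply smoothC_Dzb.
  - apply (smoothC_continuous (disc p s)); auto; apply smoothC_plus; auto; now apply smoothC_mult.
  - apply filter_imp with (2 := hl); intros u hu hu'; now apply off.
Qed.

(** * Continuation and factorization of solutions *)

Lemma locally_bounded (g : C -> R) p : continuous g p -> exists d M, 0 < d /\ forall z, disc p d z -> g z <= M.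
Proof.
  intros hg. assert (hl := hg _ (open_lt (g p + 1) (g p) ltac:(lra))).
  destruct (locally_disc p _ hl) as [d [hd h]]. exists d, (g p + 1); split; auto. intros z hz; specialize (h z hz); lra.
Qed.

Lemma rdot_mult a b : rdot (a * b)%C (a * b)%C = rdot a a * rdot b b.
Proof. unfold rdot; destruct a, b; simpl; ring. Qed.

Lemma rdot_plus_le a b : rdot (a + b)%C (a + b)%C <= 2 * (rdot a a + rdot b b).
Proof. unfold rdot; destruct a as [x y], b as [u v]; simpl. specialize (pow2_ge_0 (x - u)); specialize (pow2_ge_0 (y - v)); simpl; lra. Qed.

(** The coefficients are bounded near [p]. *)
Lemma system_bounded p s A11 A12 A21 A22 f1 f2 : 0 < s ->
  smoothC (disc p s) A11 -> smoothC (disc p s) A12 -> smoothC (disc p s) A21 -> smoothC (disc p s) A22 ->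
  dbar_system (disc p s) A11 A12 A21 A22 f1 f2 ->
  exists d K, 0 < d <= s /\ 0 <= K /\ dbar_bounded (disc p d) K f1 f2.
Proof.
  intros hs a11 a12 a21 a22 hsys. pose proof (disc_open p s) as ho.
  destruct (locally_bounded (fun z => (rdot (A11 z) (A11 z) + rdot (A12 z) (A12 z)) + (rdot (A21 z) (A21 z) + rdot (A22 z) (A22 z))) p) as [d [M [hd hM]]].
  { apply (smoothR_continuous (disc p s)); auto using disc_center.
    apply smoothR_plus; auto; apply smoothR_plus; auto; now apply smoothR_rdot. }
  exists (Rmin d s), (1 + 4 * Rabs M). split; [| split].
  - split; [now apply Rmin_glb_lt | apply Rmin_r].
  - specialize (Rabs_pos M); lra.
  - intros z hz.
    assert (z1 : disc p d z) by (eapply Rlt_le_trans; [exact hz | apply Rmin_l]).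
    assert (z2 : disc p s z) by (eapply Rlt_le_trans; [exact hz | apply Rmin_r]).
    specialize (hM z z1). specialize (hsys z z2). destruct hsys as [e1 e2]. unfold norm2. rewrite e1, e2.
    eapply Rle_trans; [apply Rplus_le_compat; apply rdot_plus_le |]. rewrite !rdot_mult.
    specialize (rdot_pos (A11 z)); specialize (rdot_pos (A12 z)); specialize (rdot_pos (A21 z)); specialize (rdot_pos (A22 z)).
    specialize (rdot_pos (f1 z)); specialize (rdot_pos (f2 z)). specialize (Rle_abs M).
    revert hM. generalize (rdot (A11 z) (A11 z)), (rdot (A12 z) (A12 z)), (rdot (A21 z) (A21 z)), (rdot (A22 z) (A22 z)), (rdot (f1 z) (f1 z)), (rdot (f2 z) (f2 z)), (Rabs M).
    intros a b c d' x y N hM h1 h2 h3 h4 h5 h6 h7.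
    apply Rle_trans with (4 * N * (x + y)).
    + assert (a * x <= N * x) by (apply Rmult_le_compat_r; lra).
      assert (b * y <= N * y) by (apply Rmult_le_compat_r; lra).
      assert (c * x <= N * x) by (apply Rmult_le_compat_r; lra).
      assert (d' * y <= N * y) by (apply Rmult_le_compat_r; lra). lra.
    + apply Rmult_le_compat_r; [lra |]. assert (0 <= N) by lra. nra.
Qed.

Lemma system_sub (U V : C -> Prop) A11 A12 A21 A22 f1 f2 : (forall z, V z -> U z) ->
  dbar_system U A11 A12 A21 A22 f1 f2 -> dbar_system V A11 A12 A21 A22 f1 f2.
Proof. intros h hs z hz; apply hs, h, hz. Qed.

Lemma disc_le p r s : r <= s -> forall z, disc p r z -> disc p s z.
Proof. unfold disc; intros; lra. Qed.

Lemma smoothC_disc_sub p q r s f : Cmod (p - q) + r <= s -> smoothC (disc q s) f -> smoothC (disc p r) f.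
Proof. intros h hf; apply (smoothC_sub (disc q s)); auto using disc_open. now apply disc_sub. Qed.

Lemma smoothC_disc_le p r s f : r <= s -> smoothC (disc p s) f -> smoothC (disc p r) f.
Proof. intros h hf; apply (smoothC_sub (disc p s)); auto using disc_open. now apply disc_le. Qed.

(** The radius [d] does not depend on [q]: near [p] the constant [K] is uniform, and [unique_continuation] on a disc about [q] reaches [p]. *)
Lemma system_continuation p s A11 A12 A21 A22 f1 f2 : 0 < s ->
  smoothC (disc p s) A11 -> smoothC (disc p s) A12 -> smoothC (disc p s) A21 -> smoothC (disc p s) A22 ->
  smoothC (disc p s) f1 -> smoothC (disc p s) f2 -> dbar_system (disc p s) A11 A12 A21 A22 f1 f2 ->
  exists d, 0 < d /\ forall q, disc p d q ->
    locally q (fun z => f1 z = RtoC 0 /\ f2 z = RtoC 0) -> locally p (fun z => f1 z = RtoC 0 /\ f2 z = RtoC 0).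
Proof.
  intros hs a11 a12 a21 a22 hf1 hf2 hsys.
  destruct (system_bounded p s A11 A12 A21 A22 f1 f2 hs a11 a12 a21 a22 hsys) as [d [K [hd [hK hb]]]].
  exists (d / 3). split; [lra |]. intros q hq hl.
  destruct (locally_disc q _ hl) as [e [he hz]].
  assert (hq' : Cmod (q - p) < d / 3) by exact hq.
  apply (disc_locally p (d / 3)); [lra |]. intros z hz'.
  assert (H : norm2 f1 f2 z = 0).
  { apply (unique_continuation q (2 * d / 3) K f1 f2); auto.
    - apply (smoothC_disc_sub q p (2 * d / 3) s); auto. lra.
    - apply (smoothC_disc_sub q p (2 * d / 3) s); auto. lra.
    - intros u hu. apply hb. apply (disc_sub q p (2 * d / 3) d); auto. lra.
    - exists e; split; auto. intros u hu; destruct (hz u hu) as [e1 e2]. unfold norm2, rdot; rewrite e1, e2; simpl; ring.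
    - apply (disc_sub p q (d / 3) (2 * d / 3)); auto. rewrite Cmod_sym; lra. }
  unfold norm2 in H. specialize (rdot_pos (f1 z)); specialize (rdot_pos (f2 z)); intros. split; apply rdot_zero; lra.
Qed.

Lemma norm2_zero f1 f2 z : norm2 f1 f2 z = 0 -> f1 z = RtoC 0 /\ f2 z = RtoC 0.
Proof.
  unfold norm2. specialize (rdot_pos (f1 z)); specialize (rdot_pos (f2 z)); intros. split; apply rdot_zero; lra.
Qed.

(** Each division by [z - p] lowers the exponent of the lower bound for the circle integrals, so at most [k] divisions are possible before a nonzero value at [p] appears. *)
Lemma system_factor_of_lower_bound p s A11 A12 A21 A22 : 0 < s ->
  smoothC (disc p s) A11 -> smoothC (disc p s) A12 -> smoothC (disc p s) A21 -> smoothC (disc p s) A22 ->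
  forall k f1 f2, smoothC (disc p s) f1 -> smoothC (disc p s) f2 -> dbar_system (disc p s) A11 A12 A21 A22 f1 f2 ->
  (exists c r0, 0 < c /\ 0 < r0 <= 1 /\ forall r, 0 < r <= r0 -> c * r ^ k <= circle_int (norm2 f1 f2) p r) ->
  exists m g1 g2, smoothC (disc p s) g1 /\ smoothC (disc p s) g2 /\ dbar_system (disc p s) A11 A12 A21 A22 g1 g2 /\
    (forall z, f1 z = ((z - p) ^ m * g1 z)%C /\ f2 z = ((z - p) ^ m * g2 z)%C) /\ norm2 g1 g2 p <> 0.
Proof.
  intros hs a11 a12 a21 a22. pose proof (disc_open p s) as ho.
  induction k as [|k IH]; intros f1 f2 hf1 hf2 hsys [c [r0 [hc [hr0 hlow]]]].
  - exists 0%nat, f1, f2. refine (conj hf1 (conj hf2 (conj hsys (conj _ _)))).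
    + intros z; split; simpl; ring.
    + intros h0.
      assert (hcont := circle_int_continuous (norm2 f1 f2) p 0 s ltac:(rewrite Rabs_R0; auto) (smoothR_norm2 _ _ _ ho hf1 hf2)).
      assert (h00 : circle_int (norm2 f1 f2) p 0 < c).
      { rewrite (circle_int_ext _ (fun _ => 0)), circle_int_const; [lra |].
        intros t; replace (circ p 0 t) with p; auto. unfold circ; apply injective_projections; simpl; ring. }
      destruct (hcont _ (open_lt c _ h00)) as [d hd].
      set (r := Rmin r0 (d / 2)). specialize (cond_pos d); intros hdp.
      assert (hr : 0 < r) by (apply Rmin_glb_lt; lra).
      assert (r <= r0) by apply Rmin_l. assert (r <= d / 2) by apply Rmin_r.
      specialize (hlow r ltac:(lra)). specialize (hd r).
      assert (circle_int (norm2 f1 f2) p r < c); [| simpl in hlow; lra].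
      apply hd. unfold ball; simpl; unfold AbsRing_ball, abs, minus, plus, opp; simpl. apply Rabs_lt_between. lra.
  - destruct (classic (norm2 f1 f2 p = 0)) as [h0 | h0].
    2: { exists 0%nat, f1, f2. refine (conj hf1 (conj hf2 (conj hsys (conj _ h0)))). intros z; split; simpl; ring. }
    destruct (norm2_zero _ _ _ h0) as [z1 z2].
    destruct (dbar_divide p s A11 A12 A21 A22 f1 f2 hs a11 a12 a21 a22 hf1 hf2 hsys z1 z2) as [g1 [g2 [hg1 [hg2 [gsys e]]]]].
    destruct (IH g1 g2 hg1 hg2 gsys) as [m [b1 [b2 [hb1 [hb2 [bsys [be bp]]]]]]].
    + exists c, (Rmin r0 (s / 2)). split; [auto |]. split.
      { split; [apply Rmin_glb_lt; lra |]. eapply Rle_trans; [apply Rmin_l | lra]. }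
      intros r hr. assert (r <= r0) by (eapply Rle_trans; [apply hr | apply Rmin_l]).
      assert (r <= s / 2) by (eapply Rle_trans; [apply hr | apply Rmin_r]).
      specialize (hlow r ltac:(lra)).
      rewrite (circle_int_ext _ (fun z => r ^ 2 * norm2 g1 g2 z)) in hlow.
      * rewrite (circle_int_scal _ _ _ _ s) in hlow.
        -- assert (0 <= circle_int (norm2 g1 g2) p r).
           { rewrite <- (Rmult_0_r (2 * PI)), <- (circle_int_const 0 p r).
             apply circle_int_le with s; [rewrite Rabs_pos_eq; lra | intros; apply continuous_const | | intros; apply norm2_pos].
             intros z hz; apply (smoothR_continuous (disc p s)); auto. now apply smoothR_norm2. }
           assert (0 <= r ^ k) by (apply pow_le; lra).
           set (X := circle_int (norm2 g1 g2) p r) in *. simpl in hlow.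
           apply Rmult_le_reg_l with r; [lra |].
           apply Rle_trans with (r * (r * 1) * X); [lra |]. rewrite Rmult_1_r.
           apply Rmult_le_compat_r; [auto |]. nra.
        -- rewrite Rabs_pos_eq; lra.
        -- intros z hz; apply (smoothR_continuous (disc p s)); auto. now apply smoothR_norm2.
      * intros t. unfold norm2. destruct (e (circ p r t)) as [e1 e2]. rewrite e1, e2, !rdot_mult.
        assert (er : rdot (circ p r t - p)%C (circ p r t - p)%C = r ^ 2).
        { unfold rdot, circ; simpl. specialize (sin2_cos2 t); unfold Rsqr; intros E.
          transitivity (r * r * (sin t * sin t + cos t * cos t)); [ring | rewrite E; ring]. }
        rewrite er; ring.
    + exists (S m), b1, b2. refine (conj hb1 (conj hb2 (conj bsys (conj _ bp)))).
      intros z. destruct (e z) as [e1 e2], (be z) as [e3 e4]. rewrite e1, e2, e3, e4, Cpow_S. split; ring.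
Qed.

(** This is the local form of the statement that a holomorphic section that is not identically zero has isolated zeros of finite order. *)
Lemma system_factor p s A11 A12 A21 A22 f1 f2 : 0 < s ->
  smoothC (disc p s) A11 -> smoothC (disc p s) A12 -> smoothC (disc p s) A21 -> smoothC (disc p s) A22 ->
  smoothC (disc p s) f1 -> smoothC (disc p s) f2 -> dbar_system (disc p s) A11 A12 A21 A22 f1 f2 ->
  ~ locally p (fun z => f1 z = RtoC 0 /\ f2 z = RtoC 0) ->
  exists d m g1 g2, 0 < d <= s /\ smoothC (disc p d) g1 /\ smoothC (disc p d) g2 /\ dbar_system (disc p d) A11 A12 A21 A22 g1 g2 /\
    (forall z, f1 z = ((z - p) ^ m * g1 z)%C /\ f2 z = ((z - p) ^ m * g2 z)%C) /\
    (forall z, disc p d z -> ~ (g1 z = RtoC 0 /\ g2 z = RtoC 0)).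
Proof.
  intros hs a11 a12 a21 a22 hf1 hf2 hsys hnz. pose proof (disc_open p s) as ho.
  destruct (system_bounded p s A11 A12 A21 A22 f1 f2 hs a11 a12 a21 a22 hsys) as [d [K [hd [hK hb]]]].
  assert (hr0 : exists r0, 0 < r0 < d /\ 0 < circle_int (norm2 f1 f2) p r0).
  { apply NNPP; intro hno. apply hnz. apply (disc_locally p d); [lra |].
    assert (hoff : forall z, disc p d z -> z <> p -> norm2 f1 f2 z = 0).
    { intros z hz hne. apply (circle_int_zero (norm2 f1 f2) p (Cmod (z - p)) s); auto using norm2_pos.
      - split; [apply Cmod_ge_0 | unfold disc in hz; lra].
      - intros u hu; apply (smoothR_continuous (disc p s)); auto; now apply smoothR_norm2.
      - apply Rnot_lt_le; intro hlt. apply hno. exists (Cmod (z - p)); split; auto.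
        split; [now apply Cmod_gt_0, Csub_neq0 | exact hz]. }
    intros z hz. destruct (classic (z = p)) as [-> | hne]; [| now apply norm2_zero, hoff].
    assert (hl : locally p (disc p d)) by (apply disc_open; exact hz).
    split.
    - apply (continuous_eq_punctured f1 (fun _ => RtoC 0) p); [apply (smoothC_continuous (disc p s)); auto using disc_center | apply continuous_const |].
      apply filter_imp with (2 := hl). intros u hu hu'. now apply (norm2_zero f1 f2), hoff.
    - apply (continuous_eq_punctured f2 (fun _ => RtoC 0) p); [apply (smoothC_continuous (disc p s)); auto using disc_center | apply continuous_const |].
      apply filter_imp with (2 := hl). intros u hu hu'. now apply (norm2_zero f1 f2), hoff. }
  destruct hr0 as [r0 [hr0 hpos]].
  assert (hf1' := smoothC_disc_le p d s _ (proj2 hd) hf1). assert (hf2' := smoothC_disc_le p d s _ (proj2 hd) hf2).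
  destruct (pair_frequency p d K f1 f2 hK hf1' hf2' hb r0 hr0 hpos) as [k [c [hc hlow]]].
  destruct (system_factor_of_lower_bound p s A11 A12 A21 A22 hs a11 a12 a21 a22 k f1 f2 hf1 hf2 hsys) as [m [g1 [g2 [hg1 [hg2 [gsys [ge gp]]]]]]].
  { exists c, (Rmin r0 1). split; [auto |]. split; [split; [apply Rmin_glb_lt; lra | apply Rmin_r] |].
    intros r hr. apply hlow. split; [apply hr |]. eapply Rle_trans; [apply hr | apply Rmin_l]. }
  assert (hcont : continuous (norm2 g1 g2) p).
  { apply (smoothR_continuous (disc p s)); auto using disc_center. now apply smoothR_norm2. }
  assert (hgp : 0 < norm2 g1 g2 p) by (specialize (norm2_pos g1 g2 p); lra).
  destruct (locally_disc p _ (hcont _ (open_gt 0 _ hgp))) as [e [he hne]].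
  exists (Rmin e s), m, g1, g2.
  assert (h1 : Rmin e s <= s) by apply Rmin_r. assert (h2 : Rmin e s <= e) by apply Rmin_l.
  split; [split; [now apply Rmin_glb_lt | auto] |].
  split; [now apply (smoothC_disc_le p _ s) |]. split; [now apply (smoothC_disc_le p _ s) |].
  split; [apply (system_sub (disc p s)); auto; now apply disc_le |]. split; [exact ge |].
  intros z hz [k1 k2]. specialize (hne z (disc_le _ _ _ h2 z hz)).
  unfold norm2, rdot in hne; rewrite k1, k2 in hne; simpl in hne; lra.
Qed.

(** * Quaternionic linear algebra in complex coordinates *)

Local Open Scope C_scope.

(** The complex component of the quaternionic Hermitian product: the standard Hermitian form of [C^4]. *)
Definition hfst (v x : H2) : C :=
  Cconj (fst (fst v)) * fst (fst x) + Cconj (snd (fst v)) * snd (fst x) +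
  Cconj (fst (snd v)) * fst (snd x) + Cconj (snd (snd v)) * snd (snd x).
(** The [j] component of the quaternionic Hermitian product: the standard symplectic form of [C^4]. *)
Definition hsnd (v x : H2) : C :=
  fst (fst v) * snd (fst x) - snd (fst v) * fst (fst x) +
  fst (snd v) * snd (snd x) - snd (snd v) * fst (snd x).

Ltac csimpl := repeat first [rewrite Cplus_conj | rewrite Cminus_conj | rewrite Copp_conj | rewrite Cmult_conj | rewrite Cconj_conj].

Lemma herm_eq v x : herm v x = (hfst v x, hsnd v x).
Proof.
  destruct v as [[v1 v2] [v3 v4]], x as [[x1 x2] [x3 x4]].
  unfold herm, qadd, qmul, qconj, hfst, hsnd; simpl.
  apply injective_projections; cbn [fst snd]; csimpl; ring.
Qed.

(** Right multiplication by [j], the antilinear structure map of [C^4 = H^2]. *)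
Definition sg (v : H2) : H2 :=
  ((- Cconj (snd (fst v)), Cconj (fst (fst v))), (- Cconj (snd (snd v)), Cconj (fst (snd v)))).

Definition hadd (v w : H2) : H2 := (qadd (fst v) (fst w), qadd (snd v) (snd w)).
Definition hscal (c : C) (v : H2) : H2 :=
  ((c * fst (fst v), c * snd (fst v)), (c * fst (snd v), c * snd (snd v))).

Lemma H2_ext (v w : H2) : fst (fst v) = fst (fst w) -> snd (fst v) = snd (fst w) ->
  fst (snd v) = fst (snd w) -> snd (snd v) = snd (snd w) -> v = w.
Proof. intros; apply injective_projections; apply injective_projections; assumption. Qed.

Ltac hring := apply H2_ext; unfold hadd, hscal, sg, qadd, hmulr, qmul, qC, hfst, hsnd; cbn [fst snd]; csimpl; ring.

Lemma hmulr_qC_scal v c : hmulr v (qC c) = hscal c v.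
Proof.
  destruct v as [[v1 v2] [v3 v4]]; apply H2_ext; unfold hmulr, qmul, qC, hscal; cbn [fst snd]; csimpl;
  try replace (Cconj 0) with (RtoC 0) by (apply injective_projections; simpl; ring); ring.
Qed.

Lemma hmulr_eq v q : hmulr v q = hadd (hscal (fst q) v) (hscal (snd q) (sg v)).
Proof. destruct v as [[v1 v2] [v3 v4]], q as [q1 q2]; hring. Qed.

Definition qn (q : quat) : R := (fst (fst q) ^ 2 + snd (fst q) ^ 2 + fst (snd q) ^ 2 + snd (snd q) ^ 2)%R.

Lemma qn_mul p q : qn (qmul p q) = (qn p * qn q)%R.
Proof. destruct p as [[? ?] [? ?]], q as [[? ?] [? ?]]; unfold qn, qmul; simpl; ring. Qed.

Lemma qn_conj q : qn (qconj q) = qn q.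
Proof. destruct q as [[? ?] [? ?]]; unfold qn, qconj; simpl; ring. Qed.

Lemma qmul_conj_l q : qmul (qconj q) q = qC (RtoC (qn q)).
Proof. destruct q as [[? ?] [? ?]]; unfold qn, qmul, qconj, qC; repeat apply injective_projections; simpl; ring. Qed.

Lemma qmul_conj_r q : qmul q (qconj q) = qC (RtoC (qn q)).
Proof. destruct q as [[? ?] [? ?]]; unfold qn, qmul, qconj, qC; repeat apply injective_projections; simpl; ring. Qed.

Lemma qn_pos q : (0 <= qn q)%R.
Proof. unfold qn; nra. Qed.

Lemma qn_zero q : qn q = 0%R -> q = qzero.
Proof.
  destruct q as [[a b] [c d]]; unfold qn; simpl; intros h.
  assert (a = 0 /\ b = 0 /\ c = 0 /\ d = 0)%R as [-> [-> [-> ->]]] by (repeat split; nra). reflexivity.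
Qed.

(** A one-sided inverse of a quaternionic matrix is two-sided.  Here the equality of norms follows from [|a| |c| = |b| |d|], and the relation between the rows by multiplying it by [d] on the right, or, if [d = 0], from [a = 0]. *)
Lemma frame_rows a b c d : (qn a + qn b = 1)%R -> (qn c + qn d = 1)%R ->
  qadd (qmul (qconj a) c) (qmul (qconj b) d) = qzero ->
  qn a = qn d /\ qn b = qn c /\ qadd (qmul a (qconj b)) (qmul c (qconj d)) = qzero.
Proof.
  intros h1 h2 h3.
  assert (e1 : (qn a * qn c = qn b * qn d)%R).
  { rewrite <- (qn_conj a), <- (qn_conj b), <- !qn_mul.
    destruct (qmul (qconj a) c) as [[? ?] [? ?]], (qmul (qconj b) d) as [[? ?] [? ?]].
    unfold qadd, qzero in h3; simpl in h3. injection h3; intros. unfold qn; simpl. nra. }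
  assert (e2 : qn a = qn d) by nra. assert (e3 : qn b = qn c) by lra.
  split; [exact e2 |]; split; [exact e3 |].
  assert (D : forall p q r, qmul (qadd p q) r = qadd (qmul p r) (qmul q r)).
  { intros [[? ?] [? ?]] [[? ?] [? ?]] [[? ?] [? ?]]; unfold qmul, qadd; repeat apply injective_projections; simpl; ring. }
  assert (D' : forall p q r, qmul r (qadd p q) = qadd (qmul r p) (qmul r q)).
  { intros [[? ?] [? ?]] [[? ?] [? ?]] [[? ?] [? ?]]; unfold qmul, qadd; repeat apply injective_projections; simpl; ring. }
  assert (e4 : qmul (qadd (qmul a (qconj b)) (qmul c (qconj d))) d = qzero).
  { rewrite D, <- !qmul_assoc, qmul_conj_l.
    assert (e5 : qmul a (qadd (qmul (qconj a) c) (qmul (qconj b) d)) = qzero)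
      by (rewrite h3; unfold qmul, qzero; repeat apply injective_projections; simpl; ring).
    rewrite D', (qmul_assoc a (qconj a) c), qmul_conj_r, e2 in e5.
    rewrite <- e5. destruct (qmul a (qmul (qconj b) d)) as [[? ?] [? ?]], c as [[? ?] [? ?]].
    unfold qmul, qadd, qC; repeat apply injective_projections; simpl; ring. }
  destruct (Req_dec (qn d) 0) as [hd | hd].
  - assert (ha : a = qzero) by (apply qn_zero; lra). assert (hd' : d = qzero) by now apply qn_zero.
    rewrite ha, hd'. destruct b as [[? ?] [? ?]], c as [[? ?] [? ?]].
    unfold qmul, qadd, qconj, qzero; repeat apply injective_projections; simpl; ring.
  - apply qn_zero. apply (f_equal qn) in e4. rewrite qn_mul in e4.
    replace (qn qzero) with 0%R in e4 by (unfold qn; simpl; ring).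
    apply Rmult_integral in e4; tauto.
Qed.

Lemma hfst_self (v : H2) : hfst v v = RtoC (qn (fst v) + qn (snd v)).
Proof.
  destruct v as [[[? ?] [? ?]] [[? ?] [? ?]]]; unfold hfst, qn; apply injective_projections; simpl; ring.
Qed.

Inductive I5 : Set := i0 | i1 | i1b | i2 | i2b.

(** The projection of the bivector [x /\ y] to the five-dimensional space of bivectors annihilated by the symplectic
    form; its real points form [R^5].  The coordinate [i0] is real there, and [i1], [i1b] as well as [i2], [i2b] are conjugate to each other. *)
Definition L5 (i : I5) (x y : H2) : C :=
  match i with
  | i0 => (fst (fst x) * snd (fst y) - snd (fst x) * fst (fst y)) - (fst (snd x) * snd (snd y) - snd (snd x) * fst (snd y))
  | i1 => 2 * (fst (fst x) * snd (snd y) - snd (snd x) * fst (fst y))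
  | i1b => - 2 * (snd (fst x) * fst (snd y) - fst (snd x) * snd (fst y))
  | i2 => 2 * (snd (fst x) * snd (snd y) - snd (snd x) * snd (fst y))
  | i2b => 2 * (fst (fst x) * fst (snd y) - fst (snd x) * fst (fst y))
  end.

(** The Hopf map from the unit sphere of [H^2] to [S^4 = HP^1], as the bivector of the complex plane [v H]. *)
Definition hopf (i : I5) (v : H2) : C := L5 i v (sg v).

(** The complex bilinear extension of the scalar product of [R^5], in the coordinates of [L5]. *)
Definition G5 (s t : I5 -> C) : C :=
  s i0 * t i0 + / 2 * (s i1 * t i1b + s i1b * t i1 + s i2 * t i2b + s i2b * t i2).

(** A decomposable bivector has square zero under the wedge product, and [G5] differs from this form by the square of the symplectic form. *)
Lemma G5_L5 x y : G5 (fun i => L5 i x y) (fun i => L5 i x y) = hsnd x y * hsnd x y.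
Proof.
  unfold G5, L5, hsnd. destruct x as [[? ?] [? ?]], y as [[? ?] [? ?]]; cbn [fst snd]. field.
Qed.

Lemma hsnd_sg v x : hsnd x (sg v) = hfst v x.
Proof. unfold hsnd, sg, hfst; cbn [fst snd]; ring. Qed.

Lemma G5_hopf v : hfst v v = 1 -> G5 (fun i => hopf i v) (fun i => hopf i v) = 1.
Proof. intros h; unfold hopf; rewrite G5_L5, hsnd_sg, h; ring. Qed.

Record unitary (v w : H2) : Prop := {
  uvv : hfst v v = 1; uww : hfst w w = 1; uvw : hfst v w = 0; svw : hsnd v w = 0 }.

Lemma is_frame_unitary f : is_frame f <-> unitary (e1 f) (e2 f).
Proof.
  unfold is_frame. rewrite !herm_eq. split.
  - intros [h1 [h2 h3]]. unfold qone, qzero in *.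
    constructor; [exact (f_equal fst h1) | exact (f_equal fst h2) | exact (f_equal fst h3) | exact (f_equal snd h3)].
  - intros [h1 h2 h3 h4].
    assert (S : forall v, hsnd v v = 0) by (intros v; unfold hsnd; ring).
    rewrite h1, h2, h3, h4, !S. auto.
Qed.

Lemma unitary_rows v w : unitary v w -> qn (fst v) = qn (snd w) /\ qn (snd v) = qn (fst w) /\
  qadd (qmul (fst v) (qconj (snd v))) (qmul (fst w) (qconj (snd w))) = qzero.
Proof.
  intros [h1 h2 h3 h4]. rewrite hfst_self in h1, h2.
  apply frame_rows.
  - now apply RtoC_inj.
  - now apply RtoC_inj.
  - change (herm v w = qzero). rewrite herm_eq, h3, h4. reflexivity.
Qed.

(** Orthogonal quaternionic lines are antipodal points of [S^4]. *)
Lemma hopf_opp v w i : unitary v w -> hopf i w = - hopf i v.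
Proof.
  intros hu. destruct (unitary_rows v w hu) as [r1 [r2 r3]].
  destruct v as [[[a1 a2] [a3 a4]] [[b1 b2] [b3 b4]]], w as [[[c1 c2] [c3 c4]] [[d1 d2] [d3 d4]]].
  unfold qn, qmul, qadd, qconj, qzero in *; cbn [fst snd] in *; injection r3; simpl; intros q4 q3 q2 q1. clear r3 hu.
  destruct i; unfold hopf, L5, sg; cbn [fst snd]; apply injective_projections; simpl; nra.
Qed.

Lemma unitary_relations v w : unitary v w ->
  fst (fst v) * Cconj (fst (fst v)) + snd (fst v) * Cconj (snd (fst v)) + fst (fst w) * Cconj (fst (fst w)) + snd (fst w) * Cconj (snd (fst w)) = 1 /\
  fst (snd v) * Cconj (fst (snd v)) + snd (snd v) * Cconj (snd (snd v)) + fst (snd w) * Cconj (fst (snd w)) + snd (snd w) * Cconj (snd (snd w)) = 1 /\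
  fst (fst v) * Cconj (fst (snd v)) + Cconj (snd (fst v)) * snd (snd v) + fst (fst w) * Cconj (fst (snd w)) + Cconj (snd (fst w)) * snd (snd w) = 0 /\
  snd (fst v) * Cconj (fst (snd v)) - Cconj (fst (fst v)) * snd (snd v) + snd (fst w) * Cconj (fst (snd w)) - Cconj (fst (fst w)) * snd (snd w) = 0.
Proof.
  intros hu. destruct (unitary_rows v w hu) as [r1 [r2 r3]].
  destruct hu as [h1 h2 _ _]. rewrite hfst_self in h1, h2. apply RtoC_inj in h1. apply RtoC_inj in h2.
  destruct v as [[[a1 a2] [a3 a4]] [[b1 b2] [b3 b4]]], w as [[[c1 c2] [c3 c4]] [[d1 d2] [d3 d4]]].
  unfold qn, qmul, qadd, qconj, qzero in *; cbn [fst snd] in *; injection r3; simpl; intros q4 q3 q2 q1. clear r3.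
  repeat split; apply injective_projections; simpl in *; lra.
Qed.

(** The vectors [v], [sg v], [w], [sg w] form a unitary basis of [C^4]. *)
Lemma herm_parseval v w x y : unitary v w ->
  hfst x y = Cconj (hfst v x) * hfst v y + Cconj (hsnd v x) * hsnd v y + Cconj (hfst w x) * hfst w y + Cconj (hsnd w x) * hsnd w y.
Proof.
  intros hu. destruct (unitary_relations v w hu) as [r1 [r2 [r3 r4]]].
  pose proof (f_equal Cconj r3) as r5. pose proof (f_equal Cconj r4) as r6. revert r5 r6. csimpl.
  replace (Cconj 0) with (RtoC 0) by (apply injective_projections; simpl; ring). intros r5 r6.
  destruct v as [[v1 v2] [v3 v4]], w as [[w1 w2] [w3 w4]], x as [[x1 x2] [x3 x4]], y as [[y1 y2] [y3 y4]].
  unfold hfst, hsnd; cbn [fst snd] in *. csimpl.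
  match type of r1 with ?l1 = _ => match type of r2 with ?l2 = _ => match type of r3 with ?l3 = _ => match type of r4 with ?l4 = _ =>
  match type of r5 with ?l5 = _ => match type of r6 with ?l6 = _ =>
    transitivity ((Cconj x1 * y1 + Cconj x2 * y2) * l1 + (Cconj x3 * y3 + Cconj x4 * y4) * l2 + Cconj x1 * y3 * l3
      - Cconj x1 * y4 * l6 + Cconj x2 * y3 * l4 + Cconj x2 * y4 * l5 + Cconj x3 * y1 * l5 - Cconj x4 * y1 * l4 + Cconj x3 * y2 * l6 + Cconj x4 * y2 * l3)
  end end end end end end.
  - rewrite r1, r2, r3, r4, r5, r6. ring.
  - ring.
Qed.

Lemma hfst_sg v x : hfst v (sg x) = - Cconj (hsnd v x).
Proof. unfold hfst, sg, hsnd; cbn [fst snd]; csimpl; ring. Qed.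

Lemma hsnd_hfst x y : hsnd x y = hfst (sg x) y.
Proof. unfold hfst, sg, hsnd; cbn [fst snd]; csimpl; ring. Qed.

Lemma hfst_conj x y : Cconj (hfst x y) = hfst y x.
Proof. unfold hfst; csimpl; ring. Qed.

Lemma hsnd_anti x y : hsnd x y = - hsnd y x.
Proof. unfold hsnd; ring. Qed.

Lemma hsnd_parseval v w x y : unitary v w ->
  hsnd x y = hfst v x * hsnd v y - hsnd v x * hfst v y + hfst w x * hsnd w y - hsnd w x * hfst w y.
Proof.
  intros hu. rewrite hsnd_hfst, (herm_parseval v w (sg x) y hu), !hfst_sg, !hsnd_sg, !hfst_conj, !Copp_conj, !Cconj_conj. ring.
Qed.

Lemma frame_expand v w x : unitary v w ->
  x = hadd (hadd (hscal (hfst v x) v) (hscal (hsnd v x) (sg v))) (hadd (hscal (hfst w x) w) (hscal (hsnd w x) (sg w))).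
Proof.
  intros hu.
  assert (P := fun y => herm_parseval v w y x hu).
  assert (P1 := P ((RtoC 1, RtoC 0), (RtoC 0, RtoC 0))). assert (P2 := P ((RtoC 0, RtoC 1), (RtoC 0, RtoC 0))).
  assert (P3 := P ((RtoC 0, RtoC 0), (RtoC 1, RtoC 0))). assert (P4 := P ((RtoC 0, RtoC 0), (RtoC 0, RtoC 1))).
  assert (c0 : Cconj 0 = 0) by (apply injective_projections; simpl; ring).
  assert (c1 : Cconj 1 = 1) by (apply injective_projections; simpl; ring).
  set (p := hfst v x) in *. set (q := hsnd v x) in *. set (r := hfst w x) in *. set (s := hsnd w x) in *.
  unfold hfst, hsnd in P1, P2, P3, P4; cbn [fst snd] in *.
  revert P1 P2 P3 P4; csimpl; rewrite ?c0, ?c1; intros P1 P2 P3 P4.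
  apply H2_ext; unfold hadd, hscal, qadd, sg; cbn [fst snd].
  - transitivity (1 * fst (fst x) + 0 * snd (fst x) + 0 * fst (snd x) + 0 * snd (snd x)); [ring | rewrite P1; ring].
  - transitivity (0 * fst (fst x) + 1 * snd (fst x) + 0 * fst (snd x) + 0 * snd (snd x)); [ring | rewrite P2; ring].
  - transitivity (0 * fst (fst x) + 0 * snd (fst x) + 1 * fst (snd x) + 0 * snd (snd x)); [ring | rewrite P3; ring].
  - transitivity (0 * fst (fst x) + 0 * snd (fst x) + 0 * fst (snd x) + 1 * snd (snd x)); [ring | rewrite P4; ring].
Qed.

Lemma hopf_scal i v c : Cconj c * c = 1 -> hopf i (hscal c v) = hopf i v.
Proof.
  intros hc. unfold hopf. transitivity (Cconj c * c * L5 i v (sg v)); [| rewrite hc; ring].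
  destruct v as [[v1 v2] [v3 v4]]; destruct i; unfold L5, hscal, sg; cbn [fst snd]; csimpl; ring.
Qed.

(** * Moving frames *)

Definition DzH (v : C -> H2) (z : C) : H2 :=
  ((Dz (fun u => fst (fst (v u))) z, Dz (fun u => snd (fst (v u))) z),
   (Dz (fun u => fst (snd (v u))) z, Dz (fun u => snd (snd (v u))) z)).
Definition DzbH (v : C -> H2) (z : C) : H2 :=
  ((Dzb (fun u => fst (fst (v u))) z, Dzb (fun u => snd (fst (v u))) z),
   (Dzb (fun u => fst (snd (v u))) z, Dzb (fun u => snd (snd (v u))) z)).

Record is_WH (v : C -> H2) (z : C) (A B : H2) : Prop := {
  wh1 : is_W (fun u => fst (fst (v u))) z (fst (fst A)) (fst (fst B));
  wh2 : is_W (fun u => snd (fst (v u))) z (snd (fst A)) (snd (fst B));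
  wh3 : is_W (fun u => fst (snd (v u))) z (fst (snd A)) (fst (snd B));
  wh4 : is_W (fun u => snd (snd (v u))) z (snd (snd A)) (snd (snd B)) }.

Lemma is_WH_DzH v z A B : is_WH v z A B -> DzH v z = A /\ DzbH v z = B.
Proof.
  intros [h1 h2 h3 h4]; unfold DzH, DzbH.
  rewrite (is_W_Dz _ _ _ _ h1), (is_W_Dz _ _ _ _ h2), (is_W_Dz _ _ _ _ h3), (is_W_Dz _ _ _ _ h4).
  rewrite (is_W_Dzb _ _ _ _ h1), (is_W_Dzb _ _ _ _ h2), (is_W_Dzb _ _ _ _ h3), (is_W_Dzb _ _ _ _ h4).
  split; apply H2_ext; reflexivity.
Qed.

Lemma smoothH2_comps U v : smoothH2 U v <->
  smoothC U (fun u => fst (fst (v u))) /\ smoothC U (fun u => snd (fst (v u))) /\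
  smoothC U (fun u => fst (snd (v u))) /\ smoothC U (fun u => snd (snd (v u))).
Proof. unfold smoothH2, smoothQ; tauto. Qed.

Lemma smoothH2_WH U v z : open U -> smoothH2 U v -> U z -> is_WH v z (DzH v z) (DzbH v z).
Proof.
  intros hU h hz; apply smoothH2_comps in h; destruct h as [h1 [h2 [h3 h4]]].
  constructor; now apply (smoothC_W U).
Qed.

Lemma smoothH2_DzH U v : open U -> smoothH2 U v -> smoothH2 U (DzH v).
Proof.
  intros hU h; apply smoothH2_comps in h; destruct h as [h1 [h2 [h3 h4]]].
  apply smoothH2_comps; refine (conj _ (conj _ (conj _ _))); now apply smoothC_Dz.
Qed.
Lemma smoothH2_DzbH U v : open U -> smoothH2 U v -> smoothH2 U (DzbH v).
Proof.
  intros hU h; apply smoothH2_comps in h; destruct h as [h1 [h2 [h3 h4]]].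
  apply smoothH2_comps; refine (conj _ (conj _ (conj _ _))); now apply smoothC_Dzb.
Qed.
Lemma smoothH2_sg U v : open U -> smoothH2 U v -> smoothH2 U (fun z => sg (v z)).
Proof.
  intros hU h; apply smoothH2_comps in h; destruct h as [h1 [h2 [h3 h4]]].
  apply smoothH2_comps; split; [| split; [| split]];
   first [apply smoothC_opp; [exact hU |]; now apply smoothC_conj | now apply smoothC_conj].
Qed.

Lemma DzH_DzbH_comm U v z : open U -> smoothH2 U v -> U z -> DzH (DzbH v) z = DzbH (DzH v) z.
Proof.
  intros hU h hz; apply smoothH2_comps in h; destruct h as [h1 [h2 [h3 h4]]].
  apply H2_ext; now apply (Dz_Dzb_comm U).
Qed.

Lemma is_WH_sg v z A B : is_WH v z A B -> is_WH (fun u => sg (v u)) z (sg B) (sg A).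
Proof.
  intros [h1 h2 h3 h4]; constructor; cbn [sg fst snd];
    first [apply is_W_opp, is_W_conj; assumption | apply is_W_conj; assumption].
Qed.

Lemma is_W_hfst v x z A B E F : is_WH v z A B -> is_WH x z E F ->
  is_W (fun u => hfst (v u) (x u)) z (hfst B (x z) + hfst (v z) E) (hfst A (x z) + hfst (v z) F).
Proof.
  intros [h1 h2 h3 h4] [k1 k2 k3 k4]. eapply is_W_eq.
  - exact (is_W_plus _ _ _ _ _ _ _ (is_W_plus _ _ _ _ _ _ _ (is_W_plus _ _ _ _ _ _ _
      (is_W_mult _ _ _ _ _ _ _ (is_W_conj _ _ _ _ h1) k1) (is_W_mult _ _ _ _ _ _ _ (is_W_conj _ _ _ _ h2) k2))
      (is_W_mult _ _ _ _ _ _ _ (is_W_conj _ _ _ _ h3) k3)) (is_W_mult _ _ _ _ _ _ _ (is_W_conj _ _ _ _ h4) k4)).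
  - unfold hfst; ring.
  - unfold hfst; ring.
Qed.

Lemma is_W_wedge f1 f2 g1 g2 z a1 b1 a2 b2 p1 q1 p2 q2 :
  is_W f1 z a1 b1 -> is_W f2 z a2 b2 -> is_W g1 z p1 q1 -> is_W g2 z p2 q2 ->
  is_W (fun u => f1 u * g2 u - f2 u * g1 u) z
    ((a1 * g2 z + f1 z * p2) - (a2 * g1 z + f2 z * p1)) ((b1 * g2 z + f1 z * q2) - (b2 * g1 z + f2 z * q1)).
Proof. intros h1 h2 k1 k2; apply is_W_minus; now apply is_W_mult. Qed.

Lemma is_W_hsnd v x z A B E F : is_WH v z A B -> is_WH x z E F ->
  is_W (fun u => hsnd (v u) (x u)) z (hsnd A (x z) + hsnd (v z) E) (hsnd B (x z) + hsnd (v z) F).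
Proof.
  intros [h1 h2 h3 h4] [k1 k2 k3 k4].
  apply is_W_ext_loc with (fun u => (fst (fst (v u)) * snd (fst (x u)) - snd (fst (v u)) * fst (fst (x u))) +
    (fst (snd (v u)) * snd (snd (x u)) - snd (snd (v u)) * fst (snd (x u)))).
  { apply filter_forall; intros u; unfold hsnd; ring. }
  eapply is_W_eq.
  - exact (is_W_plus _ _ _ _ _ _ _ (is_W_wedge _ _ _ _ _ _ _ _ _ _ _ _ _ h1 h2 k1 k2) (is_W_wedge _ _ _ _ _ _ _ _ _ _ _ _ _ h3 h4 k3 k4)).
  - unfold hsnd; ring.
  - unfold hsnd; ring.
Qed.

Lemma is_W_L5 i v x z A B E F : is_WH v z A B -> is_WH x z E F ->
  is_W (fun u => L5 i (v u) (x u)) z (L5 i A (x z) + L5 i (v z) E) (L5 i B (x z) + L5 i (v z) F).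
Proof.
  intros [h1 h2 h3 h4] [k1 k2 k3 k4].
  destruct i; unfold L5.
  - eapply is_W_eq; [exact (is_W_minus _ _ _ _ _ _ _ (is_W_wedge _ _ _ _ _ _ _ _ _ _ _ _ _ h1 h2 k1 k2) (is_W_wedge _ _ _ _ _ _ _ _ _ _ _ _ _ h3 h4 k3 k4)) | |]; cbv beta; ring.
  - eapply is_W_eq; [exact (is_W_mult _ _ _ _ _ _ _ (is_W_const 2 z) (is_W_wedge _ _ _ _ _ _ _ _ _ _ _ _ _ h1 h4 k1 k4)) | |]; cbv beta; ring.
  - eapply is_W_eq; [exact (is_W_mult _ _ _ _ _ _ _ (is_W_const (- 2) z) (is_W_wedge _ _ _ _ _ _ _ _ _ _ _ _ _ h2 h3 k2 k3)) | |]; cbv beta; ring.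
  - eapply is_W_eq; [exact (is_W_mult _ _ _ _ _ _ _ (is_W_const 2 z) (is_W_wedge _ _ _ _ _ _ _ _ _ _ _ _ _ h2 h4 k2 k4)) | |]; cbv beta; ring.
  - eapply is_W_eq; [exact (is_W_mult _ _ _ _ _ _ _ (is_W_const 2 z) (is_W_wedge _ _ _ _ _ _ _ _ _ _ _ _ _ h1 h3 k1 k3)) | |]; cbv beta; ring.
Qed.

Lemma is_WH_add v x z A B E F : is_WH v z A B -> is_WH x z E F ->
  is_WH (fun u => hadd (v u) (x u)) z (hadd A E) (hadd B F).
Proof. intros [] []; constructor; cbn [hadd qadd fst snd]; now apply is_W_plus. Qed.

Lemma is_WH_scal f v z p q A B : is_W f z p q -> is_WH v z A B ->
  is_WH (fun u => hscal (f u) (v u)) z (hadd (hscal p (v z)) (hscal (f z) A)) (hadd (hscal q (v z)) (hscal (f z) B)).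
Proof. intros h []; constructor; cbn [hadd hscal qadd fst snd]; now apply is_W_mult. Qed.

Lemma is_WH_ext_loc f g z A B : locally z (fun u => f u = g u) -> is_WH f z A B -> is_WH g z A B.
Proof.
  intros e [h1 h2 h3 h4]; constructor.
  - apply is_W_ext_loc with (2 := h1); apply filter_imp with (2 := e); intros u hu; now rewrite hu.
  - apply is_W_ext_loc with (2 := h2); apply filter_imp with (2 := e); intros u hu; now rewrite hu.
  - apply is_W_ext_loc with (2 := h3); apply filter_imp with (2 := e); intros u hu; now rewrite hu.
  - apply is_W_ext_loc with (2 := h4); apply filter_imp with (2 := e); intros u hu; now rewrite hu.
Qed.

Lemma is_W_const_on (U : C -> Prop) f c z p q : open U -> (forall u, U u -> f u = c) -> U z -> is_W f z p q -> p = 0 /\ q = 0.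
Proof.
  intros hU hf hz hw.
  assert (h : is_W f z 0 0).
  { apply is_W_ext_loc with (fun _ => c); [| apply is_W_const]. apply filter_imp with (2 := hU z hz). intros u hu; symmetry; auto. }
  destruct (is_W_unique _ _ _ _ h) as [u1 u2]. destruct (is_W_unique _ _ _ _ hw) as [u3 u4].
  split; congruence.
Qed.

Lemma smoothC_hfst U v x : open U -> smoothH2 U v -> smoothH2 U x -> smoothC U (fun z => hfst (v z) (x z)).
Proof.
  intros hU hv hx; apply smoothH2_comps in hv, hx. destruct hv as [? [? [? ?]]], hx as [? [? [? ?]]].
  repeat apply smoothC_plus; auto; apply smoothC_mult; auto; now apply smoothC_conj.
Qed.

Lemma smoothC_hsnd U v x : open U -> smoothH2 U v -> smoothH2 U x -> smoothC U (fun z => hsnd (v z) (x z)).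
Proof.
  intros hU hv hx; apply smoothH2_comps in hv, hx. destruct hv as [? [? [? ?]]], hx as [? [? [? ?]]].
  unfold hsnd. apply smoothC_minus; auto; [| apply smoothC_mult; auto]. apply smoothC_plus; auto; [| apply smoothC_mult; auto].
  apply smoothC_minus; auto; apply smoothC_mult; auto.
Qed.

Lemma smoothC_L5 i U v x : open U -> smoothH2 U v -> smoothH2 U x -> smoothC U (fun z => L5 i (v z) (x z)).
Proof.
  intros hU hv hx; apply smoothH2_comps in hv, hx. destruct hv as [? [? [? ?]]], hx as [? [? [? ?]]].
  assert (c : forall c, smoothC U (fun _ => c)) by (intros; now apply smoothC_const).
  destruct i; unfold L5; [apply smoothC_minus; auto | | | |]; repeat (first [apply smoothC_minus | apply smoothC_mult]; auto).
Qed.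

Lemma smoothH2_add U v x : open U -> smoothH2 U v -> smoothH2 U x -> smoothH2 U (fun z => hadd (v z) (x z)).
Proof.
  intros hU hv hx; apply smoothH2_comps in hv, hx. destruct hv as [? [? [? ?]]], hx as [? [? [? ?]]].
  apply smoothH2_comps; refine (conj _ (conj _ (conj _ _))); now apply smoothC_plus.
Qed.

Lemma smoothH2_scal U f v : open U -> smoothC U f -> smoothH2 U v -> smoothH2 U (fun z => hscal (f z) (v z)).
Proof.
  intros hU hf hv; apply smoothH2_comps in hv. destruct hv as [? [? [? ?]]].
  apply smoothH2_comps; refine (conj _ (conj _ (conj _ _))); now apply smoothC_mult.
Qed.

(** The fields [mf_omega1], [mf_omega2], [mf_omega3] say that omega_1, omega_2, omega_3 are of type (1,0).  As omega_3 is the conjugate of the component [hsnd v dv], the third one concerns the derivative in [z] instead of that in [zbar]. *)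
Record moving_frame (U : C -> Prop) (v w : C -> H2) : Prop := {
  mf_open : open U;
  mf_v : smoothH2 U v;
  mf_w : smoothH2 U w;
  mf_unitary : forall z, U z -> unitary (v z) (w z);
  mf_omega1 : forall z, U z -> hfst (w z) (DzbH v z) = 0;
  mf_omega2 : forall z, U z -> hsnd (w z) (DzbH v z) = 0;
  mf_omega3 : forall z, U z -> hsnd (v z) (DzH v z) = 0 }.

(** Up to the factor [sqrt 2], the coefficients [cf1] and [cf2] of [omega_1] and [omega_2] are the components of [I_1]. *)
Definition cf1 (v w : C -> H2) (z : C) : C := hfst (w z) (DzH v z).
Definition cf2 (v w : C -> H2) (z : C) : C := hsnd (w z) (DzH v z).
(** The connection coefficient of the tautological line spanned by [v]. *)
Definition alf (v : C -> H2) (z : C) : C := hfst (v z) (DzbH v z).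
(** The conjugate of this coefficient is that of [omega_3], i.e. of [I_2]. *)
Definition bef (v : C -> H2) (z : C) : C := hsnd (v z) (DzbH v z).

(** What the orthonormality relations and the type conditions say about the first derivatives. *)
Record moving_eqs (v w : C -> H2) (z : C) : Prop := {
  me_vA : hfst (v z) (DzH v z) = - Cconj (alf v z);
  me_vA' : hfst (v z) (DzH w z) = 0;
  me_svA' : hsnd (v z) (DzH w z) = cf2 v w z;
  me_vB' : hfst (v z) (DzbH w z) = - Cconj (cf1 v w z);
  me_svB' : hsnd (v z) (DzbH w z) = 0;
  me_wB' : hfst (w z) (DzbH w z) = - Cconj (hfst (w z) (DzH w z)) }.

Lemma moving_frame_eqs U v w z : moving_frame U v w -> U z -> moving_eqs v w z.
Proof.
  intros [hU hv hw hu m1 m2 m3] hz.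
  assert (Wv := smoothH2_WH U v z hU hv hz). assert (Ww := smoothH2_WH U w z hU hw hz).
  destruct (is_W_const_on U _ 1 z _ _ hU (fun u h => uvv _ _ (hu u h)) hz (is_W_hfst _ _ _ _ _ _ _ Wv Wv)) as [a1 a2].
  destruct (is_W_const_on U _ 1 z _ _ hU (fun u h => uww _ _ (hu u h)) hz (is_W_hfst _ _ _ _ _ _ _ Ww Ww)) as [b1 b2].
  destruct (is_W_const_on U _ 0 z _ _ hU (fun u h => uvw _ _ (hu u h)) hz (is_W_hfst _ _ _ _ _ _ _ Wv Ww)) as [d1 d2].
  destruct (is_W_const_on U _ 0 z _ _ hU (fun u h => svw _ _ (hu u h)) hz (is_W_hsnd _ _ _ _ _ _ _ Wv Ww)) as [s1 s2].
  specialize (m1 z hz); specialize (m2 z hz); specialize (m3 z hz).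
  assert (c0 : Cconj 0 = 0) by (apply injective_projections; simpl; ring).
  assert (X : forall a b : C, a + b = 0 -> b = - a).
  { intros a b e. replace b with ((a + b) - a) by ring. rewrite e; ring. }
  constructor; unfold alf, cf1, cf2.
  - apply X in a1. now rewrite a1, hfst_conj.
  - apply X in d1. rewrite d1, <- hfst_conj, m1, c0. ring.
  - apply X in s1. rewrite s1, (hsnd_anti (DzH v z)). ring.
  - apply X in d2. now rewrite d2, hfst_conj.
  - apply X in s2. rewrite s2, (hsnd_anti (DzbH v z)), m2. ring.
  - apply X in b2. now rewrite b2, hfst_conj.
Qed.

(** Differentiate [<w, dbar v> = 0] with respect to [z], commute the derivatives and expand the products of first derivatives in the frame.  This is the holomorphy of [I_1]; the coefficients are those of the connection of the horizontal bundle. *)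
Lemma dbar_cf1 U v w z : moving_frame U v w -> U z ->
  Dzb (cf1 v w) z = (alf v z + Cconj (hfst (w z) (DzH w z))) * cf1 v w z + Cconj (hsnd (w z) (DzH w z)) * cf2 v w z.
Proof.
  intros hm hz. destruct (moving_frame_eqs U v w z hm hz) as [e1 e2 e3 e4 e5 e6].
  destruct hm as [hU hv hw hu m1 m2 m3].
  assert (Ww := smoothH2_WH U w z hU hw hz).
  assert (WA := smoothH2_WH U _ z hU (smoothH2_DzH U v hU hv) hz).
  assert (WB := smoothH2_WH U _ z hU (smoothH2_DzbH U v hU hv) hz).
  rewrite (DzH_DzbH_comm U v z hU hv hz) in WB.
  etransitivity; [exact (is_W_Dzb _ _ _ _ (is_W_hfst _ _ _ _ _ _ _ Ww WA)) |].
  destruct (is_W_const_on U _ 0 z _ _ hU m1 hz (is_W_hfst _ _ _ _ _ _ _ Ww WB)) as [k _].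
  replace (hfst (w z) (DzbH (DzH v) z)) with (- hfst (DzbH w z) (DzbH v z)).
  2: { replace (hfst (w z) (DzbH (DzH v) z)) with ((hfst (DzbH w z) (DzbH v z) + hfst (w z) (DzbH (DzH v) z)) - hfst (DzbH w z) (DzbH v z)) by ring.
       rewrite k; ring. }
  rewrite (herm_parseval _ _ (DzH w z) (DzH v z) (hu z hz)), (herm_parseval _ _ (DzbH w z) (DzbH v z) (hu z hz)).
  rewrite e2, e3, e4, e5, (m1 z hz), (m2 z hz), (m3 z hz), Copp_conj, Cconj_conj.
  fold (cf1 v w z) (cf2 v w z) (alf v z).
  replace (Cconj 0) with (RtoC 0) by (apply injective_projections; simpl; ring). ring.
Qed.

(** As for [cf1], with the symplectic form in place of the Hermitian one. *)
Lemma dbar_cf2 U v w z : moving_frame U v w -> U z ->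
  Dzb (cf2 v w) z = - hsnd (w z) (DzbH w z) * cf1 v w z + (alf v z + hfst (w z) (DzbH w z)) * cf2 v w z.
Proof.
  intros hm hz. destruct (moving_frame_eqs U v w z hm hz) as [e1 e2 e3 e4 e5 e6].
  destruct hm as [hU hv hw hu m1 m2 m3].
  assert (Ww := smoothH2_WH U w z hU hw hz).
  assert (WA := smoothH2_WH U _ z hU (smoothH2_DzH U v hU hv) hz).
  assert (WB := smoothH2_WH U _ z hU (smoothH2_DzbH U v hU hv) hz).
  rewrite (DzH_DzbH_comm U v z hU hv hz) in WB.
  etransitivity; [exact (is_W_Dzb _ _ _ _ (is_W_hsnd _ _ _ _ _ _ _ Ww WA)) |].
  destruct (is_W_const_on U _ 0 z _ _ hU m2 hz (is_W_hsnd _ _ _ _ _ _ _ Ww WB)) as [k _].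
  replace (hsnd (w z) (DzbH (DzH v) z)) with (- hsnd (DzH w z) (DzbH v z)).
  2: { replace (hsnd (w z) (DzbH (DzH v) z)) with ((hsnd (DzH w z) (DzbH v z) + hsnd (w z) (DzbH (DzH v) z)) - hsnd (DzH w z) (DzbH v z)) by ring.
       rewrite k; ring. }
  rewrite (hsnd_parseval _ _ (DzbH w z) (DzH v z) (hu z hz)), (hsnd_parseval _ _ (DzH w z) (DzbH v z) (hu z hz)).
  rewrite e2, e3, e4, e5, (m1 z hz), (m2 z hz), (m3 z hz).
  fold (cf1 v w z) (cf2 v w z) (alf v z). ring.
Qed.

(** As for [cf1], starting from the third condition; this is the holomorphy of [I_2]. *)
Lemma dbar_bef U v w z : moving_frame U v w -> U z ->
  Dzb (fun u => Cconj (bef v u)) z = (- 2 * alf v z) * Cconj (bef v z).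
Proof.
  intros hm hz. destruct (moving_frame_eqs U v w z hm hz) as [e1 e2 e3 e4 e5 e6].
  destruct hm as [hU hv hw hu m1 m2 m3].
  assert (Wv := smoothH2_WH U v z hU hv hz).
  assert (WA := smoothH2_WH U _ z hU (smoothH2_DzH U v hU hv) hz).
  assert (WB := smoothH2_WH U _ z hU (smoothH2_DzbH U v hU hv) hz).
  rewrite (DzH_DzbH_comm U v z hU hv hz) in WB.
  etransitivity; [exact (is_W_Dzb _ _ _ _ (is_W_conj _ _ _ _ (is_W_hsnd _ _ _ _ _ _ _ Wv WB))) |].
  destruct (is_W_const_on U _ 0 z _ _ hU m3 hz (is_W_hsnd _ _ _ _ _ _ _ Wv WA)) as [_ k].
  replace (hsnd (v z) (DzbH (DzH v) z)) with (hsnd (DzH v z) (DzbH v z)).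
  2: { replace (hsnd (v z) (DzbH (DzH v) z)) with ((hsnd (DzbH v z) (DzH v z) + hsnd (v z) (DzbH (DzH v) z)) - hsnd (DzbH v z) (DzH v z)) by ring.
       rewrite k, (hsnd_anti (DzH v z)); ring. }
  rewrite (hsnd_parseval _ _ (DzH v z) (DzbH v z) (hu z hz)).
  rewrite e1, (m1 z hz), (m2 z hz), (m3 z hz). fold (bef v z).
  csimpl. replace (Cconj 0) with (RtoC 0) by (apply injective_projections; simpl; ring).
  ring.
Qed.

(** * The quartic differential *)

(** The component of [dv/dz] orthogonal to the quaternionic line [v H]: the value of [I_1] as a vector of [C^4], which does not depend on [w]. *)
Definition horiz (v w : C -> H2) (z : C) : H2 := hadd (hscal (cf1 v w z) (w z)) (hscal (cf2 v w z) (sg (w z))).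
(** The square of the norm of [horiz]. *)
Definition speed (v w : C -> H2) (z : C) : C := cf1 v w z * Cconj (cf1 v w z) + cf2 v w z * Cconj (cf2 v w z).

Lemma Cconj_0 : Cconj 0 = 0.
Proof. apply injective_projections; simpl; ring. Qed.

Lemma hscal0_add v x : hadd (hscal 0 v) x = x.
Proof. destruct v as [[? ?] [? ?]], x as [[? ?] [? ?]]; hring. Qed.
Lemma add_hscal0 v x : hadd x (hscal 0 v) = x.
Proof. destruct v as [[? ?] [? ?]], x as [[? ?] [? ?]]; hring. Qed.

Lemma expand_A U v w z : moving_frame U v w -> U z ->
  DzH v z = hadd (hscal (- Cconj (alf v z)) (v z)) (horiz v w z).
Proof.
  intros hm hz. destruct (moving_frame_eqs U v w z hm hz) as [e1 _ _ _ _ _].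
  rewrite (frame_expand _ _ (DzH v z) (mf_unitary _ _ _ hm z hz)).
  now rewrite (mf_omega3 _ _ _ hm z hz), e1, add_hscal0.
Qed.

Lemma expand_B U v w z : moving_frame U v w -> U z ->
  DzbH v z = hadd (hscal (alf v z) (v z)) (hscal (bef v z) (sg (v z))).
Proof.
  intros hm hz.
  rewrite (frame_expand _ _ (DzbH v z) (mf_unitary _ _ _ hm z hz)).
  now rewrite (mf_omega1 _ _ _ hm z hz), (mf_omega2 _ _ _ hm z hz), !add_hscal0.
Qed.

Lemma expand_A' U v w z : moving_frame U v w -> U z ->
  DzH w z = hadd (hscal (cf2 v w z) (sg (v z))) (hadd (hscal (hfst (w z) (DzH w z)) (w z)) (hscal (hsnd (w z) (DzH w z)) (sg (w z)))).
Proof.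
  intros hm hz. destruct (moving_frame_eqs U v w z hm hz) as [_ e2 e3 _ _ _].
  rewrite (frame_expand _ _ (DzH w z) (mf_unitary _ _ _ hm z hz)) at 1.
  now rewrite e2, e3, hscal0_add.
Qed.

Lemma expand_B' U v w z : moving_frame U v w -> U z ->
  DzbH w z = hadd (hscal (- Cconj (cf1 v w z)) (v z)) (hadd (hscal (- Cconj (hfst (w z) (DzH w z))) (w z)) (hscal (hsnd (w z) (DzbH w z)) (sg (w z)))).
Proof.
  intros hm hz. destruct (moving_frame_eqs U v w z hm hz) as [_ _ _ e4 e5 e6].
  rewrite (frame_expand _ _ (DzbH w z) (mf_unitary _ _ _ hm z hz)) at 1.
  now rewrite e4, e5, e6, add_hscal0.
Qed.

Lemma smooth_cf1 U v w : moving_frame U v w -> smoothC U (cf1 v w).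
Proof. intros [hU hv hw _ _ _ _]; apply smoothC_hfst; auto; now apply smoothH2_DzH. Qed.
Lemma smooth_cf2 U v w : moving_frame U v w -> smoothC U (cf2 v w).
Proof. intros [hU hv hw _ _ _ _]; apply smoothC_hsnd; auto; now apply smoothH2_DzH. Qed.
Lemma smooth_alf U v w : moving_frame U v w -> smoothC U (alf v).
Proof. intros [hU hv hw _ _ _ _]; apply smoothC_hfst; auto; now apply smoothH2_DzbH. Qed.
Lemma smooth_bef U v w : moving_frame U v w -> smoothC U (bef v).
Proof. intros [hU hv hw _ _ _ _]; apply smoothC_hsnd; auto; now apply smoothH2_DzbH. Qed.
Lemma smooth_horiz U v w : moving_frame U v w -> smoothH2 U (horiz v w).
Proof.
  intros hm. pose proof (smooth_cf1 _ _ _ hm). pose proof (smooth_cf2 _ _ _ hm). destruct hm as [hU hv hw _ _ _ _].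
  apply smoothH2_add; auto; apply smoothH2_scal; auto. now apply smoothH2_sg.
Qed.

Lemma dbar_horiz U v w z : moving_frame U v w -> U z ->
  DzbH (horiz v w) z = hadd (hscal (alf v z) (horiz v w z)) (hscal (- speed v w z) (v z)).
Proof.
  intros hm hz. pose proof (mf_open _ _ _ hm) as hU.
  assert (Ww := smoothH2_WH U w z hU (mf_w _ _ _ hm) hz).
  assert (W1 := smoothC_W U _ z hU (smooth_cf1 U v w hm) hz). assert (W2 := smoothC_W U _ z hU (smooth_cf2 U v w hm) hz).
  rewrite (dbar_cf1 U v w z hm hz) in W1. rewrite (dbar_cf2 U v w z hm hz) in W2.
  assert (H := is_WH_add _ _ _ _ _ _ _ (is_WH_scal _ _ _ _ _ _ _ W1 Ww) (is_WH_scal _ _ _ _ _ _ _ W2 (is_WH_sg _ _ _ _ Ww))).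
  apply is_WH_DzH in H. destruct H as [_ H].
  etransitivity; [exact H |]. clear H W1 W2 Ww.
  rewrite (me_wB' _ _ _ (moving_frame_eqs U v w z hm hz)).
  assert (eA := expand_A' U v w z hm hz). assert (eB := expand_B' U v w z hm hz).
  unfold horiz, speed.
  set (a := hfst (w z) (DzH w z)) in *. set (b := hsnd (w z) (DzH w z)) in *. set (q := hsnd (w z) (DzbH w z)) in *.
  set (x1 := cf1 v w z) in *. set (x2 := cf2 v w z) in *. set (al := alf v z).
  rewrite eA, eB. clear.
  destruct (v z) as [[v1 v2] [v3 v4]], (w z) as [[w1 w2] [w3 w4]]. hring.
Qed.

(** Vertical components do not change the Hopf coordinates, and the antiholomorphic derivative of [v] is vertical. *)
Lemma dz_hopf U v w z i : moving_frame U v w -> U z ->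
  Dz (fun u => hopf i (v u)) z = L5 i (horiz v w z) (sg (v z)).
Proof.
  intros hm hz. pose proof (mf_open _ _ _ hm) as hU.
  assert (Wv := smoothH2_WH U v z hU (mf_v _ _ _ hm) hz).
  etransitivity; [exact (is_W_Dz _ _ _ _ (is_W_L5 i _ _ _ _ _ _ _ Wv (is_WH_sg _ _ _ _ Wv))) |].
  rewrite (expand_A U v w z hm hz), (expand_B U v w z hm hz).
  set (al := alf v z). set (be := bef v z). clear. destruct (v z) as [[v1 v2] [v3 v4]], (horiz v w z) as [[u1 u2] [u3 u4]].
  destruct i; unfold L5, hadd, hscal, sg, qadd; cbn [fst snd]; csimpl; ring.
Qed.

Lemma horiz_wedge U v w z : moving_frame U v w -> U z -> hfst (v z) (horiz v w z) = 0 /\ hsnd (v z) (horiz v w z) = 0.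
Proof.
  intros hm hz. destruct (mf_unitary _ _ _ hm z hz) as [_ _ h1 h2].
  assert (A : forall v x y, hfst v (hadd x y) = hfst v x + hfst v y) by (intros; unfold hfst, hadd, qadd; cbn [fst snd]; ring).
  assert (B : forall v x y, hsnd v (hadd x y) = hsnd v x + hsnd v y) by (intros; unfold hsnd, hadd, qadd; cbn [fst snd]; ring).
  assert (A' : forall v c x, hfst v (hscal c x) = c * hfst v x) by (intros; unfold hfst, hscal; cbn [fst snd]; ring).
  assert (B' : forall v c x, hsnd v (hscal c x) = c * hsnd v x) by (intros; unfold hsnd, hscal; cbn [fst snd]; ring).
  unfold horiz. rewrite A, B, !A', !B', hfst_sg, hsnd_sg, <- (hfst_conj (v z)), h1, h2, Cconj_0. split; ring.
Qed.

(** By [G5_L5] this is the square of [<v, u>] with [u] horizontal. *)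
Lemma hopf_conformal U v w z : moving_frame U v w -> U z ->
  G5 (fun i => Dz (fun u => hopf i (v u)) z) (fun i => Dz (fun u => hopf i (v u)) z) = 0.
Proof.
  intros hm hz. unfold G5. rewrite !(dz_hopf U v w z) by assumption.
  change (G5 (fun i => L5 i (horiz v w z) (sg (v z))) (fun i => L5 i (horiz v w z) (sg (v z))) = 0).
  rewrite G5_L5, hsnd_sg, (proj1 (horiz_wedge U v w z hm hz)). ring.
Qed.

Lemma Dz_ext_loc f g z : locally z (fun u => f u = g u) -> Dz f z = Dz g z.
Proof.
  intros h.
  assert (E1 : forall v, dR (fun u : C => fst (f u)) z v = dR (fun u : C => fst (g u)) z v)
    by (intros; apply dR_ext_loc; apply filter_imp with (2 := h); intros u hu; now rewrite hu).
  assert (E2 : forall v, dR (fun u : C => snd (f u)) z v = dR (fun u : C => snd (g u)) z v)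
    by (intros; apply dR_ext_loc; apply filter_imp with (2 := h); intros u hu; now rewrite hu).
  unfold Dz; now rewrite !E1, !E2.
Qed.
Lemma Dzb_ext_loc f g z : locally z (fun u => f u = g u) -> Dzb f z = Dzb g z.
Proof.
  intros h.
  assert (E1 : forall v, dR (fun u : C => fst (f u)) z v = dR (fun u : C => fst (g u)) z v)
    by (intros; apply dR_ext_loc; apply filter_imp with (2 := h); intros u hu; now rewrite hu).
  assert (E2 : forall v, dR (fun u : C => snd (f u)) z v = dR (fun u : C => snd (g u)) z v)
    by (intros; apply dR_ext_loc; apply filter_imp with (2 := h); intros u hu; now rewrite hu).
  unfold Dzb; now rewrite !E1, !E2.
Qed.

(** Differentiating [dz_hopf] gives [-|u|^2] times the Hopf coordinates of [v] plus those of [u], and the latter are [|u|^2] times those of [w], the antipode of [v]. *)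
Lemma hopf_harmonic U v w z i : moving_frame U v w -> U z ->
  Dzb (Dz (fun u => hopf i (v u))) z = (- 2 * speed v w z) * hopf i (v z).
Proof.
  intros hm hz. pose proof (mf_open _ _ _ hm) as hU.
  assert (Wv := smoothH2_WH U v z hU (mf_v _ _ _ hm) hz).
  assert (Wu := smoothH2_WH U _ z hU (smooth_horiz _ _ _ hm) hz).
  transitivity (Dzb (fun u => L5 i (horiz v w u) (sg (v u))) z).
  { apply Dzb_ext_loc. apply filter_imp with (2 := hU z hz). intros u hu; now apply (dz_hopf U). }
  etransitivity; [exact (is_W_Dzb _ _ _ _ (is_W_L5 i _ _ _ _ _ _ _ Wu (is_WH_sg _ _ _ _ Wv))) |].
  rewrite (dbar_horiz U v w z hm hz), (expand_A U v w z hm hz).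
  transitivity (- speed v w z * hopf i (v z) + L5 i (horiz v w z) (sg (horiz v w z))).
  - unfold hopf. set (al := alf v z). set (s := speed v w z). clear. destruct (v z) as [[v1 v2] [v3 v4]], (horiz v w z) as [[u1 u2] [u3 u4]].
    destruct i; unfold L5, hadd, hscal, sg, qadd; cbn [fst snd]; csimpl; ring.
  - transitivity (- speed v w z * hopf i (v z) + speed v w z * hopf i (w z)).
    + f_equal. unfold horiz, hopf, speed. generalize (cf1 v w z), (cf2 v w z). intros x1 x2. clear.
      destruct (w z) as [[w1 w2] [w3 w4]].
      destruct i; unfold L5, hadd, hscal, sg, qadd; cbn [fst snd]; csimpl; ring.
    + rewrite (hopf_opp _ _ i (mf_unitary _ _ _ hm z hz)). ring.
Qed.

(** Calabi's quartic differential, the coefficient of [dz^4]. *)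
Definition quartic (Phi : I5 -> C -> C) (z : C) : C :=
  G5 (fun i => Dz (Dz (Phi i)) z) (fun i => Dz (Dz (Phi i)) z).

Lemma is_W_G5 (f g : I5 -> C -> C) z fp fq gp gq : (forall i, is_W (f i) z (fp i) (fq i)) -> (forall i, is_W (g i) z (gp i) (gq i)) ->
  is_W (fun u => G5 (fun i => f i u) (fun i => g i u)) z
    (G5 fp (fun i => g i z) + G5 (fun i => f i z) gp) (G5 fq (fun i => g i z) + G5 (fun i => f i z) gq).
Proof.
  intros hf hg. unfold G5.
  assert (m := fun i j => is_W_mult _ _ _ _ _ _ _ (hf i) (hg j)).
  eapply is_W_eq; [exact (is_W_plus _ _ _ _ _ _ _ (m i0 i0) (is_W_mult _ _ _ _ _ _ _ (is_W_const (/ 2) z)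
    (is_W_plus _ _ _ _ _ _ _ (is_W_plus _ _ _ _ _ _ _ (is_W_plus _ _ _ _ _ _ _ (m i1 i1b) (m i1b i1)) (m i2 i2b)) (m i2b i2)))) | |]; cbv beta; ring.
Qed.

Lemma G5_sym s t : G5 s t = G5 t s.
Proof. unfold G5; ring. Qed.

Lemma smoothC_G5 U (f g : I5 -> C -> C) : open U -> (forall i, smoothC U (f i)) -> (forall i, smoothC U (g i)) ->
  smoothC U (fun z => G5 (fun i => f i z) (fun i => g i z)).
Proof.
  intros hU hf hg. assert (m := fun i j => smoothC_mult U _ _ hU (hf i) (hg j)).
  apply smoothC_plus; auto. apply smoothC_mult; auto; [now apply smoothC_const |].
  repeat apply smoothC_plus; auto.
Qed.

(** Differentiating the first two relations gives that [Phi_zz] is [G]-orthogonal to [Phi] and [Phi_z].  Harmonicity makes [dbar Phi_zz] a combination of these two vectors. *)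
Lemma quartic_holomorphic U (Phi : I5 -> C -> C) (nu : C -> C) : open U -> (forall i, smoothC U (Phi i)) -> smoothC U nu ->
  (forall z, U z -> G5 (fun i => Phi i z) (fun i => Phi i z) = 1) ->
  (forall z, U z -> G5 (fun i => Dz (Phi i) z) (fun i => Dz (Phi i) z) = 0) ->
  (forall z i, U z -> Dzb (Dz (Phi i)) z = nu z * Phi i z) ->
  forall z, U z -> Dzb (quartic Phi) z = 0.
Proof.
  intros hU hP hnu h1 h2 h3 z hz.
  assert (P1 : forall i, smoothC U (Dz (Phi i))) by (intros; now apply smoothC_Dz).
  assert (P2 : forall i, smoothC U (Dz (Dz (Phi i)))) by (intros; now apply smoothC_Dz).
  assert (W0 : forall u i, U u -> is_W (Phi i) u (Dz (Phi i) u) (Dzb (Phi i) u)) by (intros; now apply (smoothC_W U)).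
  assert (W1 : forall u i, U u -> is_W (Dz (Phi i)) u (Dz (Dz (Phi i)) u) (Dzb (Dz (Phi i)) u)) by (intros; now apply (smoothC_W U)).
  assert (W2 : forall u i, U u -> is_W (Dz (Dz (Phi i))) u (Dz (Dz (Dz (Phi i))) u) (Dzb (Dz (Dz (Phi i))) u)) by (intros; now apply (smoothC_W U)).
  assert (dbl : forall x : C, x + x = 0 -> x = 0).
  { intros x e. replace x with (/ 2 * (x + x)) by (field). rewrite e; ring. }
  assert (o1 : forall u, U u -> G5 (fun i => Phi i u) (fun i => Dz (Phi i) u) = 0).
  { intros u hu. destruct (is_W_const_on U _ _ u _ _ hU h1 hu (is_W_G5 _ _ _ _ _ _ _ (fun i => W0 u i hu) (fun i => W0 u i hu))) as [k _].
    rewrite (G5_sym (fun i => Dz (Phi i) u)) in k. now apply dbl. }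
  assert (o2 : forall u, U u -> G5 (fun i => Dz (Phi i) u) (fun i => Dz (Dz (Phi i)) u) = 0).
  { intros u hu. destruct (is_W_const_on U _ _ u _ _ hU h2 hu (is_W_G5 _ _ _ _ _ _ _ (fun i => W1 u i hu) (fun i => W1 u i hu))) as [k _].
    rewrite (G5_sym (fun i => Dz (Dz (Phi i)) u)) in k. now apply dbl. }
  assert (o3 : G5 (fun i => Phi i z) (fun i => Dz (Dz (Phi i)) z) = 0).
  { destruct (is_W_const_on U _ _ z _ _ hU o1 hz (is_W_G5 _ _ _ _ _ _ _ (fun i => W0 z i hz) (fun i => W1 z i hz))) as [k _].
    rewrite (h2 z hz) in k. rewrite <- k. ring. }
  assert (d3 : forall i, Dzb (Dz (Dz (Phi i))) z = Dz nu z * Phi i z + nu z * Dz (Phi i) z).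
  { intros i. rewrite <- (Dz_Dzb_comm U _ z hU (P1 i) hz).
    transitivity (Dz (fun u => nu u * Phi i u) z).
    - apply Dz_ext_loc. apply filter_imp with (2 := hU z hz). intros u hu; now apply h3.
    - exact (is_W_Dz _ _ _ _ (is_W_mult _ _ _ _ _ _ _ (smoothC_W U nu z hU hnu hz) (W0 z i hz))). }
  etransitivity; [exact (is_W_Dzb _ _ _ _ (is_W_G5 _ _ _ _ _ _ _ (fun i => W2 z i hz) (fun i => W2 z i hz))) |].
  specialize (o2 z hz). revert o2 o3. unfold G5. rewrite !d3. intros o2 o3.
  match type of o2 with ?l2 = _ => match type of o3 with ?l3 = _ => transitivity (2 * Dz nu z * l3 + 2 * nu z * l2) end end.
  - field.
  - rewrite o2, o3; ring.
Qed.

(** The determinant of four vectors of [C^4], by Laplace expansion along the first two. *)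
Definition det4 (x y z t : H2) : C :=
  (fst (fst x) * snd (fst y) - snd (fst x) * fst (fst y)) * (fst (snd z) * snd (snd t) - snd (snd z) * fst (snd t))
 - (fst (fst x) * fst (snd y) - fst (snd x) * fst (fst y)) * (snd (fst z) * snd (snd t) - snd (snd z) * snd (fst t))
 + (fst (fst x) * snd (snd y) - snd (snd x) * fst (fst y)) * (snd (fst z) * fst (snd t) - fst (snd z) * snd (fst t))
 + (snd (fst x) * fst (snd y) - fst (snd x) * snd (fst y)) * (fst (fst z) * snd (snd t) - snd (snd z) * fst (fst t))
 - (snd (fst x) * snd (snd y) - snd (snd x) * snd (fst y)) * (fst (fst z) * fst (snd t) - fst (snd z) * fst (fst t))
 + (fst (snd x) * snd (snd y) - snd (snd x) * fst (snd y)) * (fst (fst z) * snd (fst t) - snd (fst z) * fst (fst t)).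

Lemma G5_L5_gen x y x' y' : G5 (fun i => L5 i x y) (fun i => L5 i x' y') = hsnd x y * hsnd x' y' - 2 * det4 x y x' y'.
Proof.
  unfold G5, L5, hsnd, det4. destruct x as [[? ?] [? ?]], y as [[? ?] [? ?]], x' as [[? ?] [? ?]], y' as [[? ?] [? ?]]; cbn [fst snd]. field.
Qed.

(** The bases of this form are the elements of [Sp(2)], which have determinant 1. *)
Lemma det4_frame v w : unitary v w -> det4 v (sg v) w (sg w) = 1.
Proof.
  intros hu. assert (h := G5_L5_gen v (sg v) w (sg w)).
  change (G5 (fun i => hopf i v) (fun i => hopf i w) = hsnd v (sg v) * hsnd w (sg w) - 2 * det4 v (sg v) w (sg w)) in h.
  rewrite !hsnd_sg, (uvv _ _ hu), (uww _ _ hu) in h.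
  assert (e : G5 (fun i => hopf i v) (fun i => hopf i w) = - G5 (fun i => hopf i v) (fun i => hopf i v)).
  { unfold G5; rewrite !(hopf_opp _ _ _ hu); ring. }
  rewrite e, (G5_hopf _ (uvv _ _ hu)) in h.
  set (d := det4 v (sg v) w (sg w)) in *. replace d with (/ 2 * (1 * 1 - (1 * 1 - 2 * d))) by field. rewrite <- h. field.
Qed.

(** When [omega_1 = 0], the vector [Phi_zz] is a combination of [sg w /\ sg v], [w /\ sg v] and [sg w /\ v].  The wedge product
    pairs the first of them to 0 with all three, each of the others to 0 with itself, and the last two with each other to the determinant of the frame.
    The coefficients of [w /\ sg v] and [sg w /\ v] contain [kappa_12] and [omega_3]. *)
Lemma quartic_adapted U v w z : moving_frame U v w -> (forall u, U u -> cf1 v w u = 0) -> U z ->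
  quartic (fun i u => hopf i (v u)) z = - 4 * (cf2 v w z * cf2 v w z) * Cconj (hsnd (w z) (DzbH w z)) * Cconj (bef v z).
Proof.
  intros hm h0 hz. pose proof (mf_open _ _ _ hm) as hU. pose proof (mf_unitary _ _ _ hm z hz) as hu.
  assert (Wv := smoothH2_WH U v z hU (mf_v _ _ _ hm) hz).
  assert (Ww := smoothH2_WH U w z hU (mf_w _ _ _ hm) hz).
  assert (W2 := smoothC_W U _ z hU (smooth_cf2 U v w hm) hz).
  set (q := hsnd (w z) (DzbH w z)). set (a := hfst (w z) (DzH w z)). set (x2 := cf2 v w z) in *.
  set (x := Dz (cf2 v w) z - x2 * a + x2 * Cconj (alf v z)). set (y := - x2 * Cconj q). set (t := - x2 * Cconj (bef v z)).
  assert (D : forall i, Dz (Dz (fun u => hopf i (v u))) z = x * L5 i (sg (w z)) (sg (v z)) + y * L5 i (w z) (sg (v z)) + t * L5 i (sg (w z)) (v z)).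
  { intros i. transitivity (Dz (fun u => L5 i (hscal (cf2 v w u) (sg (w u))) (sg (v u))) z).
    { apply Dz_ext_loc. apply filter_imp with (2 := hU z hz). intros u hu'. rewrite (dz_hopf U v w u i hm hu'). unfold horiz.
      now rewrite (h0 u hu'), hscal0_add. }
    etransitivity; [exact (is_W_Dz _ _ _ _ (is_W_L5 i _ _ _ _ _ _ _ (is_WH_scal _ _ _ _ _ _ _ W2 (is_WH_sg _ _ _ _ Ww)) (is_WH_sg _ _ _ _ Wv))) |].
    rewrite (expand_B U v w z hm hz), (expand_B' U v w z hm hz), (h0 z hz).
    fold q a x2. unfold x, y, t. set (al := alf v z). set (be := bef v z). generalize (Dz (cf2 v w) z); intros dx.
    clearbody al be x2 q a. clear.
    destruct (v z) as [[v1 v2] [v3 v4]], (w z) as [[w1 w2] [w3 w4]].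
    destruct i; unfold L5, hadd, hscal, sg, qadd; cbn [fst snd]; csimpl; rewrite ?Cconj_0; ring. }
  unfold quartic, G5. rewrite !D. clear D.
  set (sw := sg (w z)). set (sv := sg (v z)).
  assert (z1 : hsnd sw sv = 0).
  { unfold sw, sv. rewrite hsnd_sg, hfst_sg, (svw _ _ hu), Cconj_0; ring. }
  assert (z2 : hsnd (w z) sv = 0) by (unfold sv; now rewrite hsnd_sg, (uvw _ _ hu)).
  assert (z3 : hsnd sw (v z) = 0).
  { unfold sw. rewrite hsnd_anti, hsnd_sg, <- hfst_conj, (uvw _ _ hu), Cconj_0; ring. }
  transitivity (x * x * G5 (fun i => L5 i sw sv) (fun i => L5 i sw sv) + y * y * G5 (fun i => L5 i (w z) sv) (fun i => L5 i (w z) sv)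
    + t * t * G5 (fun i => L5 i sw (v z)) (fun i => L5 i sw (v z)) + 2 * x * y * G5 (fun i => L5 i sw sv) (fun i => L5 i (w z) sv)
    + 2 * x * t * G5 (fun i => L5 i sw sv) (fun i => L5 i sw (v z)) + 2 * y * t * G5 (fun i => L5 i (w z) sv) (fun i => L5 i sw (v z))).
  { unfold G5. ring. }
  rewrite !G5_L5_gen, z1, z2, z3.
  assert (d1 : forall x y y', det4 x y x y' = 0) by (intros; unfold det4; ring).
  assert (d2 : forall x x' y, det4 x y x' y = 0) by (intros; unfold det4; ring).
  assert (d3 : det4 (w z) sv sw (v z) = 1).
  { rewrite <- (det4_frame _ _ hu). fold sv sw. unfold det4; ring. }
  rewrite !d1, !d2, d3. unfold y, t. ring.
Qed.

(** * Local frames of a pseudoholomorphic curve *)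

Lemma dH2_W v z A B t : is_WH v z A B -> dH2 v z t = hadd (hscal t A) (hscal (Cconj t) B).
Proof.
  intros [h1 h2 h3 h4]; unfold dH2, dQ.
  rewrite (is_W_dC _ _ _ _ t h1), (is_W_dC _ _ _ _ t h2), (is_W_dC _ _ _ _ t h3), (is_W_dC _ _ _ _ t h4).
  apply H2_ext; unfold hadd, hscal, qadd; cbn [fst snd]; ring.
Qed.

Lemma hfst_comb v t A s B : hfst v (hadd (hscal t A) (hscal s B)) = hfst v A * t + hfst v B * s.
Proof. unfold hfst, hadd, hscal, qadd; cbn [fst snd]; ring. Qed.
Lemma hsnd_comb v t A s B : hsnd v (hadd (hscal t A) (hscal s B)) = hsnd v A * t + hsnd v B * s.
Proof. unfold hsnd, hadd, hscal, qadd; cbn [fst snd]; ring. Qed.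

(** The conjugate linear part of a real linear form is its obstruction to being of type (1,0). *)
Lemma type10_lin P Q : type10 (fun t => P * t + Q * Cconj t) <-> Q = 0.
Proof.
  split.
  (* evaluate the linearity condition at 1 *)
  - intros h. specialize (h 1). revert h. rewrite !Cmult_1_r.
    replace (Cconj 1) with (RtoC 1) by (apply injective_projections; simpl; ring).
    replace (Cconj Ci) with (- Ci) by (apply injective_projections; simpl; ring).
    intros h. replace Q with (/ 2 * Ci * ((P * Ci + Q * - Ci) - Ci * (P + Q * 1))).
    + rewrite h. ring.
    + replace (/ 2 * Ci * ((P * Ci + Q * - Ci) - Ci * (P + Q * 1))) with (- (Ci * Ci) * Q) by field.
      rewrite <- (Cmult_1_l Q) at 2. f_equal. apply injective_projections; simpl; ring.
  - intros -> v. ring.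
Qed.

Lemma type10_ext (f g : C -> C) : (forall t, f t = g t) -> type10 f -> type10 g.
Proof. intros e h t; rewrite <- !e; apply h. Qed.

Lemma sqrt2_neq0 : RtoC (sqrt 2) <> 0.
Proof. intros h; apply RtoC_inj in h. specialize (sqrt_lt_R0 2 ltac:(lra)); lra. Qed.

Lemma pullback_forms F z A B A' B' t :
  is_WH (fun u => e1 (F u)) z A B -> is_WH (fun u => e2 (F u)) z A' B' ->
  pullback omega1 F z t = RtoC (sqrt 2) * hfst (e2 (F z)) A * t + RtoC (sqrt 2) * hfst (e2 (F z)) B * Cconj t /\
  pullback omega2 F z t = RtoC (sqrt 2) * hsnd (e2 (F z)) A * t + RtoC (sqrt 2) * hsnd (e2 (F z)) B * Cconj t /\
  pullback omega3 F z t = Cconj (hsnd (e1 (F z)) B) * t + Cconj (hsnd (e1 (F z)) A) * Cconj t /\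
  pullback kappa12 F z t = - Cconj (hsnd (e2 (F z)) B') * t + - Cconj (hsnd (e2 (F z)) A') * Cconj t /\
  pullback kappa21 F z t = hsnd (e2 (F z)) A' * t + hsnd (e2 (F z)) B' * Cconj t /\
  pullback kappa11 F z t = Ci * RtoC (Im (hfst (e2 (F z)) A' * t + hfst (e2 (F z)) B' * Cconj t) - Im (hfst (e1 (F z)) A * t + hfst (e1 (F z)) B * Cconj t))%R /\
  pullback kappa22 F z t = - (Ci * RtoC (Im (hfst (e1 (F z)) A * t + hfst (e1 (F z)) B * Cconj t) + Im (hfst (e2 (F z)) A' * t + hfst (e2 (F z)) B' * Cconj t))%R).
Proof.
  intros h1 h2. unfold pullback. rewrite (dH2_W _ _ _ _ t h1), (dH2_W _ _ _ _ t h2).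
  unfold omega1, omega2, omega3, kappa11, kappa12, kappa21, kappa22, tau, rho1, rho2, phi11, phi21, phi22.
  cbn [e1 e2 fst snd]. change (fst (F z)) with (e1 (F z)). change (snd (F z)) with (e2 (F z)).
  rewrite !herm_eq; cbn [fst snd]. rewrite !hfst_comb, !hsnd_comb.
  refine (conj _ (conj _ (conj _ (conj _ (conj _ (conj _ _)))))); csimpl; try reflexivity; ring.
Qed.

Definition fr1 (F : C -> frame) : C -> H2 := fun u => e1 (F u).
Definition fr2 (F : C -> frame) : C -> H2 := fun u => e2 (F u).

Lemma local_frame_WH X k U F z : local_frame X k U F -> U z ->
  is_WH (fr1 F) z (DzH (fr1 F) z) (DzbH (fr1 F) z) /\ is_WH (fr2 F) z (DzH (fr2 F) z) (DzbH (fr2 F) z).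
Proof. intros [hU [h1 [h2 _]]] hz; split; now apply (smoothH2_WH U). Qed.

Lemma Cmult_eq0_r (a b : C) : a <> 0 -> a * b = 0 -> b = 0.
Proof. intros ha e. replace b with (/ a * (a * b)) by (field; auto). rewrite e; ring. Qed.

Lemma psh_moving_frame X k U F : pseudoholomorphic X -> local_frame X k U F -> moving_frame U (fr1 F) (fr2 F).
Proof.
  intros [_ [_ hX]] hF. specialize (hX k U F hF).
  assert (hW := fun z => local_frame_WH X k U F z hF).
  destruct hF as [hU [h1 [h2 h3]]]. constructor; auto.
  - intros z hz. apply is_frame_unitary, h3, hz.
  - intros z hz. destruct (hX z hz) as [k1 [k2 k3]]. destruct (hW z hz) as [w1 w2].
    apply (Cmult_eq0_r (RtoC (sqrt 2))); [exact sqrt2_neq0 |].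
    eapply type10_lin, type10_ext; [| exact k1]. intros t. apply (pullback_forms F z _ _ _ _ t w1 w2).
  - intros z hz. destruct (hX z hz) as [k1 [k2 k3]]. destruct (hW z hz) as [w1 w2].
    apply (Cmult_eq0_r (RtoC (sqrt 2))); [exact sqrt2_neq0 |].
    eapply type10_lin, type10_ext; [| exact k2]. intros t. apply (pullback_forms F z _ _ _ _ t w1 w2).
  - intros z hz. destruct (hX z hz) as [k1 [k2 k3]]. destruct (hW z hz) as [w1 w2].
    assert (e : Cconj (hsnd (e1 (F z)) (DzH (fr1 F) z)) = 0).
    { eapply type10_lin, type10_ext; [| exact k3]. intros t. apply (pullback_forms F z _ _ _ _ t w1 w2). }
    apply (f_equal Cconj) in e. rewrite Cconj_conj, Cconj_0 in e. exact e.
Qed.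

Lemma Ci_Im (x y t : C) : y = - Cconj x -> Ci * RtoC (Im (x * t + y * Cconj t)) = x * t + y * Cconj t.
Proof. intros ->. destruct x, t; apply injective_projections; simpl; ring. Qed.

Lemma psh_pullbacks X k U F z t : pseudoholomorphic X -> local_frame X k U F -> U z ->
  let v := fr1 F in let w := fr2 F in
  pullback omega1 F z t = RtoC (sqrt 2) * cf1 v w z * t /\
  pullback omega2 F z t = RtoC (sqrt 2) * cf2 v w z * t /\
  pullback omega3 F z t = Cconj (bef v z) * t /\
  pullback kappa12 F z t = - Cconj (hsnd (w z) (DzbH w z)) * t + - Cconj (hsnd (w z) (DzH w z)) * Cconj t /\
  pullback kappa21 F z t = hsnd (w z) (DzH w z) * t + hsnd (w z) (DzbH w z) * Cconj t /\
  pullback kappa11 F z t = (hfst (w z) (DzH w z) + Cconj (alf v z)) * t + - (alf v z + Cconj (hfst (w z) (DzH w z))) * Cconj t /\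
  pullback kappa22 F z t = (Cconj (alf v z) - hfst (w z) (DzH w z)) * t + - (alf v z + hfst (w z) (DzbH w z)) * Cconj t.
Proof.
  intros hX hF hz v w. pose proof (psh_moving_frame X k U F hX hF) as hm.
  destruct (local_frame_WH X k U F z hF hz) as [w1 w2].
  destruct (pullback_forms F z _ _ _ _ t w1 w2) as [p1 [p2 [p3 [p4 [p5 [p6 p7]]]]]].
  assert (m1 := mf_omega1 _ _ _ hm z hz). assert (m2 := mf_omega2 _ _ _ hm z hz). assert (m3 := mf_omega3 _ _ _ hm z hz).
  destruct (moving_frame_eqs U _ _ z hm hz) as [q1 q2 q3 q4 q5 q6].
  change (e1 (F z)) with (v z) in p1, p2, p3, p4, p5, p6, p7. change (e2 (F z)) with (w z) in p1, p2, p3, p4, p5, p6, p7.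
  change (fr1 F) with v in p1, p2, p3, p4, p5, p6, p7, m1, m2, m3, q1, q2, q3, q4, q5, q6, hm.
  change (fr2 F) with w in p1, p2, p3, p4, p5, p6, p7, m1, m2, m3, q1, q2, q3, q4, q5, q6, hm.
  rewrite m1 in p1. rewrite m2 in p2. rewrite m3, Cconj_0 in p3.
  change (hfst (w z) (DzH v z)) with (cf1 v w z) in p1. change (hsnd (w z) (DzH v z)) with (cf2 v w z) in p2.
  change (hsnd (v z) (DzbH v z)) with (bef v z) in p3. change (hfst (v z) (DzbH v z)) with (alf v z) in p6, p7.
  split; [rewrite p1; ring |]. split; [rewrite p2; ring |]. split; [rewrite p3; ring |]. split; [exact p4 |]. split; [exact p5 |].
  assert (i1 := Ci_Im (hfst (w z) (DzH w z)) (hfst (w z) (DzbH w z)) t q6).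
  assert (i2 := Ci_Im (hfst (v z) (DzH v z)) (alf v z) t).
  rewrite q1, Copp_conj, Cconj_conj in i2. specialize (i2 ltac:(ring)). rewrite q1 in p6, p7.
  split.
  - rewrite p6, RtoC_minus.
    match goal with |- Ci * (?a - ?b) = _ => replace (Ci * (a - b)) with (Ci * a - Ci * b) by ring end.
    rewrite i1, i2, q6. ring.
  - rewrite p7, RtoC_plus.
    match goal with |- - (Ci * (?a + ?b)) = _ => replace (- (Ci * (a + b))) with (- (Ci * a + Ci * b)) by ring end.
    rewrite i1, i2, q6. ring.
Qed.

(** The coefficients [k11], [k12], [k21], [k22] are minus the (0,1) parts of the connection forms, so the system reads [nabla^(0,1) s = 0]. *)
Definition k11 (v w : C -> H2) z := alf v z + Cconj (hfst (w z) (DzH w z)).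
Definition k12 (v w : C -> H2) z := Cconj (hsnd (w z) (DzH w z)).
Definition k21 (v w : C -> H2) z := - hsnd (w z) (DzbH w z).
Definition k22 (v w : C -> H2) z := alf v z + hfst (w z) (DzbH w z).

Lemma holomorphic_section_of_system X k U F s1 s2 : pseudoholomorphic X -> local_frame X k U F ->
  smoothC U s1 -> smoothC U s2 ->
  dbar_system U (k11 (fr1 F) (fr2 F)) (k12 (fr1 F) (fr2 F)) (k21 (fr1 F) (fr2 F)) (k22 (fr1 F) (fr2 F)) s1 s2 ->
  holomorphic_section U F (fun z => (s1 z, s2 z)).
Proof.
  intros hX hF h1 h2 hs. split; [split; assumption |]. intros z hz.
  pose proof (proj1 hF) as hU.
  assert (W1 := smoothC_W U s1 z hU h1 hz). assert (W2 := smoothC_W U s2 z hU h2 hz).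
  destruct (hs z hz) as [d1 d2]. rewrite d1 in W1. rewrite d2 in W2. cbn [fst snd].
  assert (P := fun t => psh_pullbacks X k U F z t hX hF hz). cbv zeta in P.
  unfold k11, k12, k21, k22 in W1, W2.
  set (v := fr1 F) in *. set (w := fr2 F) in *.
  split.
  - apply type10_ext with (fun t => (Dz s1 z + (hfst (w z) (DzH w z) + Cconj (alf v z)) * s1 z + - Cconj (hsnd (w z) (DzbH w z)) * s2 z) * t + 0 * Cconj t);
      [| now apply type10_lin].
    intros t. destruct (P t) as [_ [_ [_ [p4 [p5 [p6 p7]]]]]]. rewrite p4, p6.
    match goal with |- _ = dC ?f z t + _ + _ => change (dC f z t) with (dC s1 z t) end.
    rewrite (is_W_dC _ _ _ _ t W1). cbn [fst snd]. ring.
  - apply type10_ext with (fun t => (Dz s2 z + hsnd (w z) (DzH w z) * s1 z + (Cconj (alf v z) - hfst (w z) (DzH w z)) * s2 z) * t + 0 * Cconj t);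
      [| now apply type10_lin].
    intros t. destruct (P t) as [_ [_ [_ [p4 [p5 [p6 p7]]]]]]. rewrite p5, p7.
    match goal with |- _ = dC ?f z t + _ + _ => change (dC f z t) with (dC s2 z t) end.
    rewrite (is_W_dC _ _ _ _ t W2). cbn [fst snd]. ring.
Qed.

Lemma smooth_k U v w : moving_frame U v w ->
  smoothC U (k11 v w) /\ smoothC U (k12 v w) /\ smoothC U (k21 v w) /\ smoothC U (k22 v w).
Proof.
  intros hm. pose proof (smooth_alf _ _ _ hm) as ha. destruct hm as [hU hv hw _ _ _ _].
  assert (hA := smoothH2_DzH U w hU hw). assert (hB := smoothH2_DzbH U w hU hw).
  refine (conj _ (conj _ (conj _ _))).
  - apply smoothC_plus; auto. apply smoothC_conj; auto. now apply smoothC_hfst.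
  - apply smoothC_conj; auto. now apply smoothC_hsnd.
  - apply smoothC_opp; auto. now apply smoothC_hsnd.
  - apply smoothC_plus; auto. now apply smoothC_hfst.
Qed.

Lemma system_cf U v w : moving_frame U v w -> dbar_system U (k11 v w) (k12 v w) (k21 v w) (k22 v w) (cf1 v w) (cf2 v w).
Proof.
  intros hm z hz. split; [exact (dbar_cf1 U v w z hm hz) | exact (dbar_cf2 U v w z hm hz)].
Qed.

Lemma system_bef U v w : moving_frame U v w ->
  dbar_system U (fun z => - 2 * alf v z) (fun _ => 0) (fun _ => 0) (fun _ => 0) (fun z => Cconj (bef v z)) (fun _ => 0).
Proof.
  intros hm z hz. split.
  - rewrite (dbar_bef U v w z hm hz). ring.
  - rewrite (is_W_Dzb _ _ _ _ (is_W_const 0 z)). ring.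
Qed.

Lemma local_frame_sub X k (U V : C -> Prop) F : local_frame X k U F -> open V -> (forall z, V z -> U z) -> local_frame X k V F.
Proof.
  intros [hU [h1 [h2 h3]]] hV hs.
  assert (S : forall f, smoothH2 U f -> smoothH2 V f).
  { intros f hf; apply smoothH2_comps in hf; destruct hf as [? [? [? ?]]]; apply smoothH2_comps.
    refine (conj _ (conj _ (conj _ _))); now apply (smoothC_sub U V). }
  repeat split; auto; try (now apply S); now apply h3, hs.
Qed.

(** * Points of the projective spaces *)

Lemma Projective_ext {V : ModuleSpace C_Ring} (p q : Projective V) : proj1_sig p = proj1_sig q -> p = q.
Proof. destruct p, q; simpl; intros ->; f_equal; apply proof_irrelevance. Qed.

Lemma HP1_ext (p q : HP1) : proj1_sig p = proj1_sig q -> p = q.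
Proof. destruct p, q; simpl; intros ->; f_equal; apply proof_irrelevance. Qed.

Lemma Cspan_self {V : ModuleSpace C_Ring} (v : V) : Cspan v v.
Proof. exists (RtoC 1). symmetry; apply (scal_one v). Qed.

Lemma Cspan_scal {V : ModuleSpace C_Ring} (v : V) (c : C) : c <> 0 -> Cspan (scal c v) = Cspan v.
Proof.
  intros hc. apply functional_extensionality; intros w; apply propositional_extensionality; split.
  - intros [d ->]. exists (mult d c). now rewrite scal_assoc.
  - intros [d ->]. exists (d * / c). rewrite scal_assoc. f_equal.
    unfold mult; simpl. field. exact hc.
Qed.

Lemma scal_C2 (c a b : C) : scal c ((a, b) : C2) = ((c * a, c * b) : C2).
Proof. reflexivity. Qed.

Lemma scal_H2 (c : C) (v : H2) : (scal c (v : H2_C) : H2_C) = hscal c v.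
Proof. now rewrite <- hmulr_qC, hmulr_qC_scal. Qed.

Lemma chart_flip k (z : C) : z <> 0 -> chart k z = chart (negb k) (/ z).
Proof.
  intros hz. apply Projective_ext; simpl. destruct k; simpl.
  - rewrite <- (Cspan_scal ((RtoC 1, / z) : C2) z hz), scal_C2. do 2 f_equal; field; exact hz.
  - rewrite <- (Cspan_scal ((/ z, RtoC 1) : C2) z hz), scal_C2. do 2 f_equal; field; exact hz.
Qed.

Lemma chart_surj x : exists k z, x = chart k z.
Proof.
  destruct x as [l hl]. destruct hl as [[a b] [hv e]] eqn:Hl. clear Hl.
  change C in a. change C in b.
  destruct (classic (a = RtoC 0)) as [ha | ha].
  - assert (hb : b <> RtoC 0). { intros hb; apply hv. rewrite ha, hb. reflexivity. }
    exists true, (a / b). apply Projective_ext; simpl. rewrite e.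
    rewrite <- (Cspan_scal ((a / b, RtoC 1) : C2) b hb), scal_C2. f_equal. f_equal; field; exact hb.
  - exists false, (b / a). apply Projective_ext; simpl. rewrite e.
    rewrite <- (Cspan_scal ((RtoC 1, b / a) : C2) a ha), scal_C2. f_equal. f_equal; field; exact ha.
Qed.

Lemma chart_eq k (z : C) k' (z' : C) : chart k z = chart k' z' -> (k' = k /\ z' = z) \/ (k' = negb k /\ z <> 0 /\ z' = / z).
Proof.
  intros h. assert (hc : Cspan (chart_rep k' z') (chart_rep k z)).
  { apply (f_equal (@proj1_sig _ _)) in h. simpl in h. rewrite <- h. apply Cspan_self. }
  destruct hc as [c hc]. destruct k, k'; simpl in hc; rewrite scal_C2 in hc.
  - left. split; auto. assert (e1 := f_equal fst hc). assert (e2 := f_equal snd hc). cbn [fst snd] in *.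
    rewrite Cmult_1_r in e2. rewrite e1, <- e2. ring.
  - right. assert (e1 := f_equal fst hc). assert (e2 := f_equal snd hc). cbn [fst snd] in *. rewrite Cmult_1_r in e1. rewrite <- e1 in e2.
    assert (z0 : z <> 0). { intros e0; rewrite e0, Cmult_0_l in e2. now apply C1_nz. }
    split; [reflexivity |]. split; [exact z0 |]. replace z' with (/ z * (z * z')) by (field; auto). rewrite <- e2. ring.
  - right. assert (e1 := f_equal fst hc). assert (e2 := f_equal snd hc). cbn [fst snd] in *. rewrite Cmult_1_r in e2. rewrite <- e2 in e1.
    assert (z0 : z <> 0). { intros e0; rewrite e0, Cmult_0_l in e1. now apply C1_nz. }
    split; [reflexivity |]. split; [exact z0 |]. replace z' with (/ z * (z * z')) by (field; auto). rewrite <- e1. ring.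
  - left. split; auto. assert (e1 := f_equal fst hc). assert (e2 := f_equal snd hc). cbn [fst snd] in *.
    rewrite Cmult_1_r in e1. rewrite e2, <- e1. ring.
Qed.

(** * Existence of local frames *)

Lemma hfst_pos (v : H2) : v <> (zero : H2_C) -> (0 < Re (hfst v v))%R.
Proof.
  intros hv. rewrite hfst_self. simpl.
  assert (h1 := qn_pos (fst v)). assert (h2 := qn_pos (snd v)).
  destruct (Req_dec (qn (fst v) + qn (snd v)) 0) as [e | e]; [exfalso | lra].
  apply hv. destruct v as [a b]; cbn [fst snd] in *.
  rewrite (qn_zero a), (qn_zero b) by lra. reflexivity.
Qed.

Lemma hfst_scal_scal c v : hfst (hscal c v) (hscal c v) = Cconj c * c * hfst v v.
Proof. unfold hfst, hscal; cbn [fst snd]; csimpl; ring. Qed.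

Lemma normalize U r : open U -> smoothH2 U r -> (forall z, U z -> (0 < Re (hfst (r z) (r z)))%R) ->
  exists c : C -> C, smoothC U c /\ (forall z, U z -> c z <> 0 /\ hfst (hscal (c z) (r z)) (hscal (c z) (r z)) = 1).
Proof.
  intros hU hr hp. set (n := fun z => Re (hfst (r z) (r z))).
  assert (hn : smoothR U n) by (apply (smoothC_hfst U r r hU hr hr)).
  exists (fun z => RtoC (/ sqrt (n z))). split.
  - apply smoothC_RtoC; auto. apply smoothR_inv; auto.
    + intros z hz. specialize (sqrt_lt_R0 _ (hp z hz)). unfold n; lra.
    + now apply smoothR_sqrt.
  - intros z hz. specialize (hp z hz). fold (n z) in hp.
    assert (hs := sqrt_lt_R0 _ hp). split.
    + intros e; apply RtoC_inj in e. specialize (Rinv_0_lt_compat _ hs); lra.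
    + rewrite hfst_scal_scal.
      assert (e : hfst (r z) (r z) = RtoC (n z)).
      { unfold n. rewrite hfst_self. reflexivity. }
      rewrite e. apply injective_projections; simpl.
      * replace (n z) with (sqrt (n z) * sqrt (n z))%R at 3 by (apply sqrt_sqrt; lra).
        field. lra.
      * ring.
Qed.

(** The orthogonal projection to the complement of [e H] and the length of its result. *)
Lemma hfst_proj e h : hfst e e = 1 ->
  let r := hadd h (hadd (hscal (- hfst e h) e) (hscal (- hsnd e h) (sg e))) in
  hfst e r = 0 /\ hsnd e r = 0 /\ hfst r r = hfst h h - hfst e h * Cconj (hfst e h) - hsnd e h * Cconj (hsnd e h).
Proof.
  intros he r.
  assert (A : forall v x y, hfst v (hadd x y) = hfst v x + hfst v y) by (intros; unfold hfst, hadd, qadd; cbn [fst snd]; ring).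
  assert (B : forall v x y, hsnd v (hadd x y) = hsnd v x + hsnd v y) by (intros; unfold hsnd, hadd, qadd; cbn [fst snd]; ring).
  assert (A' : forall v c x, hfst v (hscal c x) = c * hfst v x) by (intros; unfold hfst, hscal; cbn [fst snd]; ring).
  assert (B' : forall v c x, hsnd v (hscal c x) = c * hsnd v x) by (intros; unfold hsnd, hscal; cbn [fst snd]; ring).
  assert (S0 : hsnd e e = 0) by (unfold hsnd; ring).
  assert (r1 : hfst e r = 0).
  { unfold r. rewrite !A, !A', hfst_sg, S0, he, Cconj_0. ring. }
  assert (r2 : hsnd e r = 0).
  { unfold r. rewrite !B, !B', hsnd_sg, S0, he. ring. }
  split; [exact r1 |]. split; [exact r2 |].
  assert (r3 : hfst r e = 0) by (rewrite <- hfst_conj, r1, Cconj_0; reflexivity).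
  assert (r4 : hfst r (sg e) = 0) by (rewrite hfst_sg, hsnd_anti, r2, Copp_conj, Cconj_0; ring).
  unfold r at 2. rewrite !A, !A', r3, r4. rewrite <- (hfst_conj h r).
  unfold r. rewrite !A, !A', hfst_sg, !Cplus_conj, !Cmult_conj, !Copp_conj, !Cconj_conj, !hfst_conj, (hsnd_anti h e). ring.
Qed.

Lemma unitary_intro_frame e w : hfst e e = 1 -> hfst w w = 1 -> hfst e w = 0 -> hsnd e w = 0 -> is_frame (e, w).
Proof. intros; apply is_frame_unitary; now constructor. Qed.

(** Normalize a lift to get the first vector.  For the second, project one of the two standard vectors of [H^2] orthogonally to
    the first vector and normalize; at a given point the two projections do not both vanish, since the squares of their lengths add up to 1. *)
Lemma local_frame_exists X k z0 : smooth_map X -> exists U F, local_frame X k U F /\ U z0.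
Proof.
  intros hX. destruct (hX k z0) as [U [v [hU [hz0 [hv hl]]]]].
  destruct (normalize U v hU hv) as [c [hc1 hc2]].
  { intros z hz; apply hfst_pos, hl, hz. }
  set (e := fun z => hscal (c z) (v z)).
  assert (he : smoothH2 U e) by now apply smoothH2_scal.
  assert (he1 : forall z, U z -> hfst (e z) (e z) = 1) by (intros z hz; apply (hc2 z hz)).
  set (r := fun (h : H2) z => hadd h (hadd (hscal (- hfst (e z) h) (e z)) (hscal (- hsnd (e z) h) (sg (e z))))).
  assert (hconst : forall h : H2, smoothH2 U (fun _ => h)).
  { intros h; apply smoothH2_comps; refine (conj _ (conj _ (conj _ _))); now apply smoothC_const. }
  assert (hr : forall h, smoothH2 U (r h)).
  { intros h. apply smoothH2_add; auto. apply smoothH2_add; auto; apply smoothH2_scal; auto; try (apply smoothC_opp; auto).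
    - now apply smoothC_hfst.
    - now apply smoothC_hsnd.
    - now apply smoothH2_sg. }
  assert (hex : exists h, (0 < Re (hfst (r h z0) (r h z0)))%R).
  { apply NNPP; intro hno.
    assert (n1 := fun h => not_ex_all_not _ _ hno h). clear hno.
    specialize (he1 z0 hz0) as h1. rewrite hfst_self in h1. apply RtoC_inj in h1.
    (* the two squared lengths are 1 - qn (fst e) and 1 - qn (snd e) *)
    assert (a1 := n1 ((RtoC 1, RtoC 0), (RtoC 0, RtoC 0))). assert (a2 := n1 ((RtoC 0, RtoC 0), (RtoC 1, RtoC 0))).
    unfold r in a1, a2.
    rewrite (proj2 (proj2 (hfst_proj _ _ (he1 z0 hz0)))) in a1.
    rewrite (proj2 (proj2 (hfst_proj _ _ (he1 z0 hz0)))) in a2.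
    destruct (e z0) as [[[x1 x2] [x3 x4]] [[y1 y2] [y3 y4]]]. unfold hfst, hsnd, qn in *; simpl in *. nra. }
  destruct hex as [h hh].
  set (n := fun z => Re (hfst (r h z) (r h z))).
  assert (hn : smoothR U n) by (apply (smoothC_hfst U _ _ hU (hr h) (hr h))).
  set (V := fun z => U z /\ (0 < n z)%R).
  assert (hV : open V).
  { intros z [hz1 hz2]. apply filter_and; [now apply hU |].
    exact (smoothR_continuous U n z hU hn hz1 _ (open_gt 0 _ hz2)). }
  assert (S : forall f, smoothH2 U f -> smoothH2 V f).
  { intros f hf; apply smoothH2_comps in hf; destruct hf as [? [? [? ?]]]; apply smoothH2_comps.
    refine (conj _ (conj _ (conj _ _))); apply (smoothC_sub U V); auto; now intros z []. }
  destruct (normalize V (r h) hV (S _ (hr h))) as [d [hd1 hd2]]; [now intros z [] |].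
  exists V, (fun z => (e z, hscal (d z) (r h z))).
  split; [| split; [exact hz0 | exact hh]].
  split; [exact hV |]. split; [exact (S _ he) |]. split; [exact (smoothH2_scal V d (r h) hV hd1 (S _ (hr h))) |].
  intros z hz. destruct (hfst_proj (e z) h (he1 z (proj1 hz))) as [p1 [p2 _]]. fold (r h z) in p1, p2.
  destruct (hd2 z hz) as [_ d2]. split.
  - apply unitary_intro_frame; [apply he1, hz | exact d2 | |].
    + replace (hfst (e z) (hscal (d z) (r h z))) with (d z * hfst (e z) (r h z)) by (unfold hfst, hscal; cbn [fst snd]; ring). rewrite p1; ring.
    + replace (hsnd (e z) (hscal (d z) (r h z))) with (d z * hsnd (e z) (r h z)) by (unfold hsnd, hscal; cbn [fst snd]; ring). rewrite p2; ring.
  - destruct (hl z (proj1 hz)) as [_ hl2]. rewrite hl2. cbn [e1 fst].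
    unfold e. rewrite <- scal_H2. symmetry. apply Cspan_scal, hc2, hz.
Qed.

(** * Change of frame and of chart *)

(** Two frames over the same point differ by an element of [S^1 x S^3]. *)
Lemma frame_change_pointwise p f f' : over p f -> over p f' ->
  exists (l : C) (q : quat), Cconj l * l = 1 /\ l = hfst (e1 f) (e1 f') /\ e1 f' = hscal l (e1 f) /\
    e2 f' = hadd (hscal (fst q) (e2 f)) (hscal (snd q) (sg (e2 f))) /\ Cconj (fst q) * fst q + Cconj (snd q) * snd q = 1 /\
    q = herm (e2 f) (e2 f').
Proof.
  intros [hf hl] [hf' hl']. apply is_frame_unitary in hf, hf'.
  assert (h : Cspan (e1 f : H2_C) (e1 f')) by (rewrite <- hl, hl'; apply Cspan_self).
  destruct h as [l h]. rewrite scal_H2 in h.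
  assert (hll : Cconj l * l = 1).
  { assert (k := uvv _ _ hf'). rewrite h, hfst_scal_scal, (uvv _ _ hf), Cmult_1_r in k. exact k. }
  assert (l0 : Cconj l <> 0). { intros e; rewrite e, Cmult_0_l in hll. symmetry in hll; now apply C1_nz. }
  assert (l0' : l <> 0). { intros e; rewrite e, Cmult_0_r in hll. symmetry in hll; now apply C1_nz. }
  assert (k1 := uvw _ _ hf'). assert (k2 := svw _ _ hf').
  replace (hfst (e1 f') (e2 f')) with (Cconj l * hfst (e1 f) (e2 f')) in k1
    by (rewrite h; unfold hfst, hscal; cbn [fst snd]; csimpl; ring).
  replace (hsnd (e1 f') (e2 f')) with (l * hsnd (e1 f) (e2 f')) in k2
    by (rewrite h; unfold hsnd, hscal; cbn [fst snd]; csimpl; ring).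
  apply Cmult_eq0_r in k1; auto. apply Cmult_eq0_r in k2; auto.
  exists l, (herm (e2 f) (e2 f')). rewrite herm_eq; cbn [fst snd].
  split; [exact hll |]. split.
  { rewrite h. replace (hfst (e1 f) (hscal l (e1 f))) with (l * hfst (e1 f) (e1 f)) by (unfold hfst, hscal; cbn [fst snd]; ring).
    rewrite (uvv _ _ hf). ring. }
  split; [exact h |]. split; [| split; [| reflexivity]].
  - rewrite (frame_expand _ _ (e2 f') hf) at 1. now rewrite k1, k2, !hscal0_add.
  - assert (k := uww _ _ hf'). rewrite (herm_parseval _ _ (e2 f') (e2 f') hf), k1, k2 in k. rewrite <- k. ring.
Qed.

(** The vector [horiz] depends only on the first vector of the frame and on the quaternionic line orthogonal to it; the derivative of the factor [l] only contributes multiples of the first vector. *)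
Lemma frame_change X k U F U' F' z : pseudoholomorphic X -> local_frame X k U F -> local_frame X k U' F' -> U z -> U' z ->
  exists l : C, Cconj l * l = 1 /\ e1 (F' z) = hscal l (e1 (F z)) /\
    horiz (fr1 F') (fr2 F') z = hscal l (horiz (fr1 F) (fr2 F) z) /\ bef (fr1 F') z = l * l * bef (fr1 F) z.
Proof.
  intros hX hF hF' hz hz'.
  destruct (frame_change_pointwise _ _ _ (proj2 (proj2 (proj2 hF)) z hz) (proj2 (proj2 (proj2 hF')) z hz'))
    as [l [q [hl [hl1 [hl2 [hq1 [hq2 hq3]]]]]]].
  exists l. split; [exact hl |]. split; [exact hl2 |].
  set (V := fun u => U u /\ U' u).
  assert (hV : open V) by (apply open_and; [apply hF | apply hF']).
  assert (hm := psh_moving_frame X k U F hX hF). assert (hm' := psh_moving_frame X k U' F' hX hF').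
  assert (hFV := local_frame_sub X k U V F hF hV (fun u h => proj1 h)). assert (hFV' := local_frame_sub X k U' V F' hF' hV (fun u h => proj2 h)).
  set (lam := fun u => hfst (fr1 F u) (fr1 F' u)).
  assert (hlam : smoothC V lam) by (apply smoothC_hfst; auto; [apply hFV | apply hFV']).
  assert (heq : forall u, V u -> hscal (lam u) (fr1 F u) = fr1 F' u).
  { intros u [hu hu'].
    destruct (frame_change_pointwise _ _ _ (proj2 (proj2 (proj2 hF)) u hu) (proj2 (proj2 (proj2 hF')) u hu')) as [l' [q' [_ [e1' [e2' _]]]]].
    unfold lam, fr1. rewrite <- e1'. symmetry; exact e2'. }
  assert (Wv := smoothH2_WH U _ z (proj1 hF) (proj1 (proj2 hF)) hz).
  assert (Wl := smoothC_W V lam z hV hlam (conj hz hz')).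
  assert (H := is_WH_scal _ _ _ _ _ _ _ Wl Wv).
  apply (is_WH_ext_loc _ (fr1 F')) in H.
  2: { apply filter_imp with (2 := hV z (conj hz hz')). intros u hu; now apply heq. }
  apply is_WH_DzH in H. destruct H as [HA HB].
  change (fun u => e1 (F u)) with (fr1 F) in HA, HB.
  assert (el : lam z = l) by (symmetry; exact hl1). rewrite el in HA, HB.
  change (e1 (F' z)) with (fr1 F' z) in *. change (e1 (F z)) with (fr1 F z) in *.
  change (e2 (F' z)) with (fr2 F' z) in *. change (e2 (F z)) with (fr2 F z) in *.
  destruct (mf_unitary _ _ _ hm z hz) as [u1 u2 u3 u4].
  assert (u5 : hfst (fr2 F z) (fr1 F z) = 0) by (rewrite <- hfst_conj, u3, Cconj_0; reflexivity).
  assert (u6 : hsnd (fr2 F z) (fr1 F z) = 0) by (rewrite hsnd_anti, u4; ring).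
  split.
  - unfold horiz, cf1, cf2.
    assert (a1 : hfst (fr2 F' z) (DzH (fr1 F') z) = l * (Cconj (fst q) * hfst (fr2 F z) (DzH (fr1 F) z) + Cconj (snd q) * hsnd (fr2 F z) (DzH (fr1 F) z))).
    { rewrite HA, hq1.
      transitivity (Dz lam z * (Cconj (fst q) * hfst (fr2 F z) (fr1 F z) + Cconj (snd q) * hsnd (fr2 F z) (fr1 F z)) +
        l * (Cconj (fst q) * hfst (fr2 F z) (DzH (fr1 F) z) + Cconj (snd q) * hsnd (fr2 F z) (DzH (fr1 F) z))); [| rewrite u5, u6; ring].
      unfold hfst, hsnd, hadd, hscal, sg, qadd; cbn [fst snd]; csimpl; ring. }
    assert (a2 : hsnd (fr2 F' z) (DzH (fr1 F') z) = l * (fst q * hsnd (fr2 F z) (DzH (fr1 F) z) - snd q * hfst (fr2 F z) (DzH (fr1 F) z))).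
    { rewrite HA, hq1.
      transitivity (Dz lam z * (fst q * hsnd (fr2 F z) (fr1 F z) - snd q * hfst (fr2 F z) (fr1 F z)) +
        l * (fst q * hsnd (fr2 F z) (DzH (fr1 F) z) - snd q * hfst (fr2 F z) (DzH (fr1 F) z))); [| rewrite u5, u6; ring].
      unfold hfst, hsnd, hadd, hscal, sg, qadd; cbn [fst snd]; csimpl; ring. }
    rewrite a1, a2, hq1. generalize (hfst (fr2 F z) (DzH (fr1 F) z)), (hsnd (fr2 F z) (DzH (fr1 F) z)). intros x1 x2.
    transitivity (hscal (Cconj (fst q) * fst q + Cconj (snd q) * snd q) (hscal l (hadd (hscal x1 (fr2 F z)) (hscal x2 (sg (fr2 F z)))))).
    + hring.
    + rewrite hq2. destruct (fr2 F z) as [[? ?] [? ?]]; hring.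
  - unfold bef. rewrite HB, hl2.
    transitivity (l * Dzb lam z * hsnd (fr1 F z) (fr1 F z) + l * l * hsnd (fr1 F z) (DzbH (fr1 F) z)).
    + unfold hsnd, hadd, hscal, qadd; cbn [fst snd]; ring.
    + unfold hsnd; ring.
Qed.

Definition inv_frame (F : C -> frame) : C -> frame := fun w => F (/ w).
Definition inv_dom (U : C -> Prop) : C -> Prop := fun w => w <> 0 /\ U (/ w).

Lemma open_neq0 : open (fun w : C => w <> 0).
Proof.
  intros w hw. assert (h : (0 < Cmod w)%R) by now apply Cmod_gt_0.
  assert (hl := continuous_Cmod w _ (open_gt 0 _ h)). unfold filtermap in hl.
  apply filter_imp with (2 := hl). intros u hu e. rewrite e, Cmod_0 in hu. lra.
Qed.

Lemma is_W_Cinv (w : C) : w <> 0 -> is_W (fun u => / u) w (- / (w * w)) 0.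
Proof.
  intros hw. eapply is_W_eq; [exact (is_W_inv (fun u => u) w _ _ hw (is_W_id w)) | |]; cbv beta; field; exact hw.
Qed.

Lemma inv_dom_open U : open U -> open (inv_dom U).
Proof.
  intros hU w [hw hu]. apply filter_and; [now apply open_neq0 |].
  exact (is_W_continuous _ _ _ _ (is_W_Cinv w hw) _ (hU _ hu)).
Qed.

Lemma smoothC_inv_dom U f : open U -> smoothC U f -> smoothC (inv_dom U) (fun w => f (/ w)).
Proof.
  intros hU hf. apply (smoothC_comp (inv_dom U) U f (fun w => / w)); auto.
  - now apply inv_dom_open.
  - now intros w [].
  - apply smoothC_inv; [now apply inv_dom_open | now intros w [] | now apply smoothC_id, inv_dom_open].
Qed.

Lemma is_W_inv_comp f (w p q : C) : w <> 0 -> is_W f (/ w) p q ->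
  is_W (fun u => f (/ u)) w (- / (w * w) * p) (Cconj (- / (w * w)) * q).
Proof.
  intros hw hf. eapply is_W_eq; [exact (is_W_comp f (fun u => / u) w _ _ _ _ (is_W_Cinv w hw) hf) | |]; rewrite ?Cconj_0; ring.
Qed.

Lemma is_WH_inv_comp v (w : C) A B : w <> 0 -> is_WH v (/ w) A B ->
  is_WH (fun u => v (/ u)) w (hscal (- / (w * w)) A) (hscal (Cconj (- / (w * w))) B).
Proof. intros hw [h1 h2 h3 h4]; constructor; cbn [hscal fst snd];
  [exact (is_W_inv_comp _ _ _ _ hw h1) | exact (is_W_inv_comp _ _ _ _ hw h2) |
   exact (is_W_inv_comp _ _ _ _ hw h3) | exact (is_W_inv_comp _ _ _ _ hw h4)].
Qed.

Lemma inv_local_frame X k U F : local_frame X k U F -> local_frame X (negb k) (inv_dom U) (inv_frame F).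
Proof.
  intros [hU [h1 [h2 h3]]].
  assert (S : forall f, smoothH2 U f -> smoothH2 (inv_dom U) (fun w => f (/ w))).
  { intros f hf; apply smoothH2_comps in hf; destruct hf as [? [? [? ?]]]; apply smoothH2_comps.
    refine (conj _ (conj _ (conj _ _))); [exact (smoothC_inv_dom U _ hU H) | exact (smoothC_inv_dom U _ hU H0) |
      exact (smoothC_inv_dom U _ hU H1) | exact (smoothC_inv_dom U _ hU H2)]. }
  split; [now apply inv_dom_open |]. split; [exact (S _ h1) |]. split; [exact (S _ h2) |].
  intros w [hw hu]. specialize (h3 _ hu).
  rewrite (chart_flip k (/ w)) in h3 by now apply Cinv_neq0. rewrite Cinv_inv in h3. exact h3.
Qed.

(** The chain rule for [w |-> 1 / w].  The coefficient [bef] is attached to [dzbar], hence the conjugate factor. *)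
Lemma inv_frame_data F U k X w : local_frame X k U F -> inv_dom U w ->
  horiz (fr1 (inv_frame F)) (fr2 (inv_frame F)) w = hscal (- / (w * w)) (horiz (fr1 F) (fr2 F) (/ w)) /\
  bef (fr1 (inv_frame F)) w = Cconj (- / (w * w)) * bef (fr1 F) (/ w).
Proof.
  intros hF [hw hu]. destruct (local_frame_WH X k U F _ hF hu) as [W1 _].
  assert (H := is_WH_inv_comp _ w _ _ hw W1). apply is_WH_DzH in H. destruct H as [HA HB].
  change (fun u => fr1 F (/ u)) with (fr1 (inv_frame F)) in HA, HB.
  unfold horiz, cf1, cf2, bef. rewrite HA, HB.
  change (fr2 (inv_frame F) w) with (fr2 F (/ w)). change (fr1 (inv_frame F) w) with (fr1 F (/ w)). split.
  - assert (a1 : forall c x y, hfst x (hscal c y) = c * hfst x y) by (intros; unfold hfst, hscal; cbn [fst snd]; ring).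
    assert (a2 : forall c x y, hsnd x (hscal c y) = c * hsnd x y) by (intros; unfold hsnd, hscal; cbn [fst snd]; ring).
    rewrite a1, a2. apply H2_ext; unfold hadd, hscal, qadd; cbn [fst snd]; ring.
  - unfold hsnd, hscal; cbn [fst snd]; ring.
Qed.

(** * The quartic differential of a rational curve *)

Lemma unit_rep_exists (p : CP3) : exists e : H2, hfst e e = 1 /\ proj1_sig p = Cspan (e : H2_C).
Proof.
  destruct p as [l [v [hv hl]]]. simpl.
  destruct (normalize (fun _ => True) (fun _ => v) open_true) as [c [_ hc]].
  - apply smoothH2_comps; refine (conj _ (conj _ (conj _ _))); apply smoothC_const, open_true.
  - intros z _; now apply hfst_pos.
  - destruct (hc (RtoC 0) I) as [c0 c1]. exists (hscal (c (RtoC 0)) v). split; [exact c1 |].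
    rewrite hl, <- scal_H2. symmetry; now apply Cspan_scal.
Qed.

(** An arbitrary choice, not continuous in the point; the Hopf coordinates do not depend on it. *)
Definition unit_rep (p : CP3) : H2 := proj1_sig (constructive_indefinite_description _ (unit_rep_exists p)).

Lemma unit_rep_spec p : hfst (unit_rep p) (unit_rep p) = 1 /\ proj1_sig p = Cspan (unit_rep p : H2_C).
Proof. exact (proj2_sig (constructive_indefinite_description _ (unit_rep_exists p))). Qed.

(** The Hopf coordinates of [T o X] in the chart [k]. *)
Definition hopfX (X : CP1 -> CP3) (k : bool) (i : I5) (z : C) : C := hopf i (unit_rep (X (chart k z))).

Lemma hopf_span (a b : H2) i : hfst a a = 1 -> hfst b b = 1 -> Cspan (a : H2_C) = Cspan (b : H2_C) -> hopf i a = hopf i b.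
Proof.
  intros ha hb h. assert (hc : Cspan (b : H2_C) a) by (rewrite <- h; apply Cspan_self).
  destruct hc as [c hc]. rewrite scal_H2 in hc. rewrite hc. apply hopf_scal.
  rewrite hc, hfst_scal_scal, hb, Cmult_1_r in ha. exact ha.
Qed.

Lemma hopfX_frame X k U F z i : local_frame X k U F -> U z -> hopfX X k i z = hopf i (fr1 F z).
Proof.
  intros hF hz. destruct (unit_rep_spec (X (chart k z))) as [h1 h2].
  destruct (proj2 (proj2 (proj2 hF)) z hz) as [h3 h4]. apply is_frame_unitary in h3.
  apply hopf_span; auto; [apply h3 |]. now rewrite <- h2, h4.
Qed.

Lemma hopfX_flip X k i (w : C) : w <> 0 -> hopfX X (negb k) i w = hopfX X k i (/ w).
Proof.
  intros hw. unfold hopfX. rewrite (chart_flip k (/ w)) by now apply Cinv_neq0. now rewrite Cinv_inv.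
Qed.

Lemma hopfX_smooth X k i : smooth_map X -> smoothC (fun _ => True) (hopfX X k i).
Proof.
  intros hX. apply smoothC_loc; [apply open_true |]. intros z _.
  destruct (local_frame_exists X k z hX) as [U [F [hF hz]]].
  exists U. split; [apply hF |]. split; [exact hz |].
  apply (smoothC_ext U (fun u => hopf i (fr1 F u))); [apply hF | |].
  - intros u hu; symmetry; now apply (hopfX_frame X k U).
  - apply smoothC_L5; [apply hF | apply hF | apply smoothH2_sg; apply hF].
Qed.

Lemma hopfX_facts X k : pseudoholomorphic X ->
  (forall z, G5 (fun i => hopfX X k i z) (fun i => hopfX X k i z) = 1) /\
  (forall z, G5 (fun i => Dz (hopfX X k i) z) (fun i => Dz (hopfX X k i) z) = 0) /\
  (forall z, Dzb (quartic (hopfX X k)) z = 0).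
Proof.
  intros hX.
  assert (h1 : forall z, G5 (fun i => hopfX X k i z) (fun i => hopfX X k i z) = 1).
  { intros z. apply G5_hopf. apply (unit_rep_spec (X (chart k z))). }
  assert (hl : forall z, exists U F, local_frame X k U F /\ U z) by (intros; apply local_frame_exists, hX).
  assert (he : forall U F i z, local_frame X k U F -> U z -> locally z (fun u => hopfX X k i u = hopf i (fr1 F u))).
  { intros U F i z hF hz. apply filter_imp with (2 := proj1 hF z hz). intros u hu; now apply (hopfX_frame X k U). }
  assert (h2 : forall z, G5 (fun i => Dz (hopfX X k i) z) (fun i => Dz (hopfX X k i) z) = 0).
  { intros z. destruct (hl z) as [U [F [hF hz]]]. rewrite <- (hopf_conformal U _ _ z (psh_moving_frame X k U F hX hF) hz).
    unfold G5. now rewrite !(fun i => Dz_ext_loc _ _ _ (he U F i z hF hz)). }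
  split; [exact h1 |]. split; [exact h2 |].
  intros z. destruct (hl z) as [U [F [hF hz]]]. assert (hm := psh_moving_frame X k U F hX hF).
  apply (quartic_holomorphic U (hopfX X k) (fun u => - 2 * speed (fr1 F) (fr2 F) u)); auto.
  - apply hF.
  - intros i. apply (smoothC_sub (fun _ => True)); auto; [apply open_true | apply hF |]. apply hopfX_smooth, hX.
  - apply smoothC_mult; [apply hF | apply smoothC_const, hF |].
    assert (s1 := smooth_cf1 _ _ _ hm). assert (s2 := smooth_cf2 _ _ _ hm). assert (hU := proj1 hF).
    apply smoothC_plus; auto; apply smoothC_mult; auto; now apply smoothC_conj.
  - intros u i hu. rewrite (hopfX_frame X k U F u i hF hu), <- (hopf_harmonic U (fr1 F) (fr2 F) u i hm hu).
    apply Dzb_ext_loc. apply filter_imp with (2 := proj1 hF u hu). intros u' hu'. now apply Dz_ext_loc, (he U F).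
Qed.

Lemma Dz_inv f (w : C) : smoothC (fun _ => True) f -> w <> 0 -> Dz (fun u => f (/ u)) w = - / (w * w) * Dz f (/ w).
Proof.
  intros hf hw. apply (is_W_Dz _ _ _ _ (is_W_inv_comp f w _ _ hw (smoothC_W (fun _ => True) f (/ w) open_true hf I))).
Qed.

Lemma Dz_Dz_inv f (w : C) : smoothC (fun _ => True) f -> w <> 0 ->
  Dz (Dz (fun u => f (/ u))) w = 2 / (w * w * w) * Dz f (/ w) + / (w * w * w * w) * Dz (Dz f) (/ w).
Proof.
  intros hf hw. transitivity (Dz (fun u => - / (u * u) * Dz f (/ u)) w).
  { apply Dz_ext_loc. apply filter_imp with (2 := open_neq0 w hw). intros u hu; now apply Dz_inv. }
  assert (W1 := is_W_inv_comp (Dz f) w _ _ hw (smoothC_W (fun _ => True) _ (/ w) open_true (smoothC_Dz _ _ open_true hf) I)).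
  assert (hww : w * w <> 0) by now apply Cmult_neq_0.
  assert (W2 := is_W_opp _ _ _ _ (is_W_inv (fun u => u * u) w _ _ hww (is_W_mult _ _ _ _ _ _ _ (is_W_id w) (is_W_id w)))).
  etransitivity; [exact (is_W_Dz _ _ _ _ (is_W_mult _ _ _ _ _ _ _ W2 W1)) |].
  cbv beta. field. exact hw.
Qed.

(** The second derivative transforms with an extra multiple of [Phi_z], which is isotropic and orthogonal to [Phi_zz]; so only the factor [(dz/dw)^4 = w^(-8)] survives. *)
Lemma quartic_flip X k (w : C) : pseudoholomorphic X -> w <> 0 ->
  quartic (hopfX X (negb k)) w = / (w ^ 8) * quartic (hopfX X k) (/ w).
Proof.
  intros hX hw. destruct (hopfX_facts X k hX) as [_ [h2 _]].
  assert (hs := fun i => hopfX_smooth X k i (proj1 hX)).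
  assert (D : forall i, Dz (Dz (hopfX X (negb k) i)) w =
     2 / (w * w * w) * Dz (hopfX X k i) (/ w) + / (w * w * w * w) * Dz (Dz (hopfX X k i)) (/ w)).
  { intros i. rewrite <- (Dz_Dz_inv _ w (hs i) hw). apply Dz_ext_loc.
    apply filter_imp with (2 := open_neq0 w hw). intros u hu. apply Dz_ext_loc.
    apply filter_imp with (2 := open_neq0 u hu). intros u' hu'. now apply hopfX_flip. }
  assert (o1 := h2 (/ w)).
  assert (o2 : G5 (fun i => Dz (hopfX X k i) (/ w)) (fun i => Dz (Dz (hopfX X k i)) (/ w)) = 0).
  { assert (W1 : forall i, is_W (Dz (hopfX X k i)) (/ w) (Dz (Dz (hopfX X k i)) (/ w)) (Dzb (Dz (hopfX X k i)) (/ w)))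
      by (intros; apply (smoothC_W (fun _ => True)); auto using open_true; now apply smoothC_Dz; [apply open_true |]).
    destruct (is_W_const_on (fun _ => True) _ 0 (/ w) _ _ open_true (fun u _ => h2 u) I (is_W_G5 _ _ _ _ _ _ _ W1 W1)) as [e _].
    rewrite (G5_sym (fun i => Dz (Dz (hopfX X k i)) (/ w))) in e.
    match type of e with ?x + ?x = _ => replace x with (/ 2 * (x + x)) by field end. rewrite e; ring. }
  unfold quartic. revert o1 o2. unfold G5. rewrite !D. intros o1 o2.
  match type of o1 with ?l1 = _ => match type of o2 with ?l2 = _ =>
    match goal with |- _ = _ * ?l3 => transitivity ((2 / (w * w * w)) * (2 / (w * w * w)) * l1 + 2 * (2 / (w * w * w)) * / (w * w * w * w) * l2 + / (w ^ 8) * l3) end end end.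
  - field. exact hw.
  - rewrite o1, o2. ring.
Qed.

Lemma is_W_Cpow n (z : C) : is_W (fun u => u ^ n) z (INR n * z ^ (pred n) * 1) (INR n * z ^ (pred n) * 0).
Proof. exact (is_W_pow _ _ _ _ n (is_W_id z)). Qed.

(** By [quartic_flip] the coefficient in one chart vanishes to order 8 at infinity. *)
Lemma quartic_zero X k z : pseudoholomorphic X -> quartic (hopfX X k) z = 0.
Proof.
  intros hX.
  assert (hs : forall k, smoothC (fun _ => True) (quartic (hopfX X k))).
  { intros k'. assert (hd := fun i => smoothC_Dz _ _ open_true (smoothC_Dz _ _ open_true (hopfX_smooth X k' i (proj1 hX)))).
    apply (smoothC_G5 (fun _ => True) (fun i => Dz (Dz (hopfX X k' i))) (fun i => Dz (Dz (hopfX X k' i))) open_true hd hd). }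
  (* the constant is the value at w = 0 of the second function, which is 0 *)
  rewrite (sphere_liouville (quartic (hopfX X k)) (fun w => w ^ 8 * quartic (hopfX X (negb k)) w)).
  - simpl; ring.
  - apply hs.
  - apply hopfX_facts, hX.
  - eapply is_W_continuous, is_W_mult; [apply is_W_Cpow | apply (smoothC_W (fun _ => True)); auto using open_true].
  - intros w hw. rewrite (quartic_flip X k w hX hw). field. exact hw.
Qed.

(** * The zeros of I_1 and I_2 *)

(** A property of germs that is open by definition and closed by the hypothesis passes along segments. *)
Lemma connected_C (Z : C -> Prop) :
  (forall p, exists d, (0 < d)%R /\ forall q, disc p d q -> locally q Z -> locally p Z) ->
  forall z0 z1, locally z0 Z -> locally z1 Z.
Proof.
  intros hcl z0 z1 h0.
  set (W := fun t : R => locally (shift z0 (z1 - z0) t) Z).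
  assert (hd : forall t, exists d, (0 < d)%R /\ forall s, (Rabs (s - t) < d)%R -> (W s -> W t) /\ (W t -> W s)).
  { intros t. destruct (hcl (shift z0 (z1 - z0) t)) as [d [hd h]].
    assert (e1 : locally t (fun s => disc (shift z0 (z1 - z0) t) d (shift z0 (z1 - z0) s))).
    { apply (continuous_shift z0 (z1 - z0) t). apply disc_open, disc_center, hd. }
    assert (e2 : locally t (fun s => W t -> W s)).
    { destruct (classic (W t)) as [wt | wt].
      - apply filter_imp with W; [tauto |].
        exact (continuous_shift z0 (z1 - z0) t _ (locally_locally _ _ wt)).
      - apply filter_forall; tauto. }
    destruct (filter_and _ _ e1 e2) as [e he]. exists e. split; [apply cond_pos |].
    intros s hs. destruct (he s hs) as [k1 k2]. split; [apply h, k1 | exact k2]. }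
  assert (w0 : W 0%R) by (unfold W; now rewrite shift_0).
  cut (W 1%R).
  { unfold W. replace (shift z0 (z1 - z0) 1) with z1; [auto |]. unfold shift; apply injective_projections; simpl; ring. }
  destruct (completeness (fun t => (0 <= t <= 1)%R /\ forall s, (0 <= s <= t)%R -> W s)) as [S [hS1 hS2]].
  - exists 1%R. intros t [ht _]; lra.
  - exists 0%R. split; [lra |]. intros s hs. replace s with 0%R by lra. exact w0.
  - assert (S0 : (0 <= S)%R). { apply hS1; split; [lra |]. intros s hs. replace s with 0%R by lra. exact w0. }
    assert (S1 : (S <= 1)%R) by (apply hS2; intros t [ht _]; lra).
    destruct (hd S) as [d [hd0 hdS]].
    assert (hlt : forall s, (0 <= s < S)%R -> W s).
    { intros s hs. apply NNPP; intro hn.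
      assert (S <= s)%R; [| lra]. apply hS2. intros t [ht1 ht2]. apply Rnot_lt_le; intro. apply hn, ht2; lra. }
    assert (wS : W S).
    { destruct (Req_dec S 0) as [-> | hne]; [exact w0 |].
      apply (proj1 (hdS (S - Rmin (d / 2) S)%R ltac:(apply Rabs_lt_between; assert (0 < Rmin (d/2) S)%R by (apply Rmin_glb_lt; lra); specialize (Rmin_l (d / 2) S); lra))).
      apply hlt. assert (0 < Rmin (d/2) S)%R by (apply Rmin_glb_lt; lra). specialize (Rmin_r (d / 2) S). lra. }
    destruct (Req_dec S 1) as [<- | hne]; [exact wS |].
    exfalso. set (t := Rmin 1 (S + d / 2)).
    assert (ht : (S < t)%R) by (apply Rmin_glb_lt; lra).
    assert (ht1 : (t <= 1)%R) by apply Rmin_l. assert (ht2 : (t <= S + d / 2)%R) by apply Rmin_r.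
    assert (t <= S)%R; [| lra].
    apply hS1. split; [lra |]. intros s hs.
    destruct (Rlt_dec s S) as [l | l]; [apply hlt; lra |].
    apply (hdS s); [apply Rabs_lt_between; lra | exact wS].
Qed.

(** Stated for all frames; by [frame_change] one frame suffices. *)
Definition I1_zero (X : CP1 -> CP3) (k : bool) (z : C) : Prop :=
  forall U F, local_frame X k U F -> U z -> cf1 (fr1 F) (fr2 F) z = 0 /\ cf2 (fr1 F) (fr2 F) z = 0.
Definition I2_zero (X : CP1 -> CP3) (k : bool) (z : C) : Prop :=
  forall U F, local_frame X k U F -> U z -> bef (fr1 F) z = 0.

Definition hzero : H2 := ((RtoC 0, RtoC 0), (RtoC 0, RtoC 0)).

Lemma horiz_zero U v w z : moving_frame U v w -> U z -> (horiz v w z = hzero <-> cf1 v w z = 0 /\ cf2 v w z = 0).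
Proof.
  intros hm hu. destruct (mf_unitary _ _ _ hm z hu) as [u1 u2 u3 u4]. split.
  - intros e. assert (e1 := f_equal (hfst (w z)) e). assert (e2 := f_equal (hsnd (w z)) e).
    unfold horiz in e1, e2. rewrite hfst_comb in e1. rewrite hsnd_comb in e2.
    rewrite hfst_sg, u2 in e1. rewrite hsnd_sg, u2 in e2.
    replace (hsnd (w z) (w z)) with (RtoC 0) in e1, e2 by (unfold hsnd; ring). rewrite Cconj_0 in e1.
    replace (hfst (w z) hzero) with (RtoC 0) in e1 by (unfold hfst, hzero; cbn [fst snd]; ring).
    replace (hsnd (w z) hzero) with (RtoC 0) in e2 by (unfold hsnd, hzero; cbn [fst snd]; ring).
    split; [rewrite <- e1 | rewrite <- e2]; ring.
  - intros [e1 e2]. unfold horiz. rewrite e1, e2. apply H2_ext; unfold hadd, hscal, qadd, hzero; cbn [fst snd]; ring.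
Qed.

Lemma hscal_hzero l : hscal l hzero = hzero.
Proof. apply H2_ext; unfold hscal, hzero; cbn [fst snd]; ring. Qed.

Lemma I1_zero_frame X k U F z : pseudoholomorphic X -> local_frame X k U F -> U z ->
  cf1 (fr1 F) (fr2 F) z = 0 /\ cf2 (fr1 F) (fr2 F) z = 0 -> I1_zero X k z.
Proof.
  intros hX hF hu h U' F' hF' hu'.
  destruct (frame_change X k U F U' F' z hX hF hF' hu hu') as [l [_ [_ [hl _]]]].
  apply (horiz_zero U _ _ z (psh_moving_frame X k U F hX hF) hu) in h.
  apply (horiz_zero U' _ _ z (psh_moving_frame X k U' F' hX hF') hu'). now rewrite hl, h, hscal_hzero.
Qed.

Lemma I2_zero_frame X k U F z : pseudoholomorphic X -> local_frame X k U F -> U z ->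
  bef (fr1 F) z = 0 -> I2_zero X k z.
Proof.
  intros hX hF hu h U' F' hF' hu'.
  destruct (frame_change X k U F U' F' z hX hF hF' hu hu') as [l [_ [_ [_ hl]]]].
  rewrite hl, h; ring.
Qed.

Lemma I1_zero_flip X k (w : C) : pseudoholomorphic X -> w <> 0 -> I1_zero X k (/ w) -> I1_zero X (negb k) w.
Proof.
  intros hX hw h. destruct (local_frame_exists X k (/ w) (proj1 hX)) as [U [F [hF hu]]].
  assert (hF' := inv_local_frame X k U F hF). assert (hu' : inv_dom U w) by now split.
  apply (I1_zero_frame X (negb k) _ _ w hX hF' hu').
  apply (horiz_zero _ _ _ w (psh_moving_frame _ _ _ _ hX hF') hu').
  rewrite (proj1 (inv_frame_data F U k X w hF hu')).
  specialize (h U F hF hu). apply (horiz_zero U _ _ (/ w) (psh_moving_frame X k U F hX hF) hu) in h.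
  now rewrite h, hscal_hzero.
Qed.

Lemma I2_zero_flip X k (w : C) : pseudoholomorphic X -> w <> 0 -> I2_zero X k (/ w) -> I2_zero X (negb k) w.
Proof.
  intros hX hw h. destruct (local_frame_exists X k (/ w) (proj1 hX)) as [U [F [hF hu]]].
  assert (hF' := inv_local_frame X k U F hF). assert (hu' : inv_dom U w) by now split.
  apply (I2_zero_frame X (negb k) _ _ w hX hF' hu').
  rewrite (proj2 (inv_frame_data F U k X w hF hu')), (h U F hF hu). ring.
Qed.

Lemma I1_zero_continuation X k p : pseudoholomorphic X ->
  exists d, (0 < d)%R /\ forall q, disc p d q -> locally q (I1_zero X k) -> locally p (I1_zero X k).
Proof.
  intros hX. destruct (local_frame_exists X k p (proj1 hX)) as [U [F [hF hu]]].
  destruct (open_disc_sub U p (proj1 hF) hu) as [s [hs hsU]].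
  assert (hF' := local_frame_sub X k U (disc p s) F hF (disc_open p s) hsU).
  assert (hm := psh_moving_frame X k _ F hX hF'). destruct (smooth_k _ _ _ hm) as [a1 [a2 [a3 a4]]].
  destruct (system_continuation p s _ _ _ _ _ _ hs a1 a2 a3 a4 (smooth_cf1 _ _ _ hm) (smooth_cf2 _ _ _ hm) (system_cf _ _ _ hm)) as [d [hd h]].
  exists (Rmin d s). split; [now apply Rmin_glb_lt |]. intros q hq hl.
  assert (q1 : disc p d q) by (apply (disc_le p (Rmin d s)); [apply Rmin_l | exact hq]).
  assert (q2 : disc p s q) by (apply (disc_le p (Rmin d s)); [apply Rmin_r | exact hq]).
  assert (hp := h q q1).
  apply filter_imp with (fun z => disc p s z /\ (cf1 (fr1 F) (fr2 F) z = 0 /\ cf2 (fr1 F) (fr2 F) z = 0)).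
  - intros z [z1 z2]. now apply (I1_zero_frame X k (disc p s) F).
  - apply filter_and; [apply disc_open, disc_center, hs |]. apply hp.
    apply filter_imp with (2 := filter_and _ _ hl (disc_open p s q q2)). intros z [z1 z2]. now apply (z1 (disc p s) F).
Qed.

Lemma I2_zero_continuation X k p : pseudoholomorphic X ->
  exists d, (0 < d)%R /\ forall q, disc p d q -> locally q (I2_zero X k) -> locally p (I2_zero X k).
Proof.
  intros hX. destruct (local_frame_exists X k p (proj1 hX)) as [U [F [hF hu]]].
  destruct (open_disc_sub U p (proj1 hF) hu) as [s [hs hsU]].
  assert (ho := disc_open p s).
  assert (hF' := local_frame_sub X k U (disc p s) F hF ho hsU).
  assert (hm := psh_moving_frame X k _ F hX hF').
  assert (c0 : smoothC (disc p s) (fun _ => RtoC 0)) by now apply smoothC_const.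
  assert (ca : smoothC (disc p s) (fun z => - 2 * alf (fr1 F) z)).
  { apply smoothC_mult; auto; [now apply smoothC_const | apply (smooth_alf _ _ _ hm)]. }
  destruct (system_continuation p s _ _ _ _ _ _ hs ca c0 c0 c0 (smoothC_conj _ _ ho (smooth_bef _ _ _ hm)) c0 (system_bef _ _ _ hm)) as [d [hd h]].
  exists (Rmin d s). split; [now apply Rmin_glb_lt |]. intros q hq hl.
  assert (q1 : disc p d q) by (apply (disc_le p (Rmin d s)); [apply Rmin_l | exact hq]).
  assert (q2 : disc p s q) by (apply (disc_le p (Rmin d s)); [apply Rmin_r | exact hq]).
  assert (hp := h q q1).
  apply filter_imp with (fun z => disc p s z /\ (Cconj (bef (fr1 F) z) = 0 /\ RtoC 0 = 0)).
  - intros z [z1 [z2 _]]. apply (I2_zero_frame X k (disc p s) F); auto.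
    apply (f_equal Cconj) in z2. now rewrite Cconj_conj, Cconj_0 in z2.
  - apply filter_and; [apply disc_open, disc_center, hs |]. apply hp.
    apply filter_imp with (2 := filter_and _ _ hl (disc_open p s q q2)). intros z [z1 z2].
    rewrite (z1 (disc p s) F hF' z2), Cconj_0. auto.
Qed.

(** The charts overlap near 1, which carries the property from one chart to the other. *)
Lemma sphere_propagation (Z : bool -> C -> Prop) :
  (forall k p, exists d, (0 < d)%R /\ forall q, disc p d q -> locally q (Z k) -> locally p (Z k)) ->
  (forall k (w : C), w <> 0 -> Z k (/ w) -> Z (negb k) w) ->
  forall k z, locally z (Z k) -> forall k' z', Z k' z'.
Proof.
  intros h1 h2 k z hz.
  assert (a1 : forall u, locally u (Z k)) by (intros; now apply (connected_C (Z k) (h1 k) z)).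
  assert (a2 : forall u, locally u (Z (negb k))).
  { intros u. apply (connected_C (Z (negb k)) (h1 (negb k)) (RtoC 1)).
    apply filter_imp with (2 := open_neq0 (RtoC 1) C1_nz). intros w hw. apply h2; auto. now apply locally_singleton. }
  intros k' z'. apply locally_singleton. destruct k, k'; auto.
Qed.

Lemma I1_propagation X : pseudoholomorphic X -> ~ vertical X -> forall k z, ~ locally z (I1_zero X k).
Proof.
  intros hX hv k z hl. apply hv. intros k' U F hF u hu v.
  assert (h : I1_zero X k' u).
  { apply (sphere_propagation (I1_zero X)) with k z; auto.
    - intros; now apply I1_zero_continuation.
    - intros; now apply I1_zero_flip. }
  destruct (psh_pullbacks X k' U F u v hX hF hu) as [p1 [p2 _]]. destruct (h U F hF hu) as [c1 c2].
  rewrite p1, p2, c1, c2. split; ring.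
Qed.

Lemma I2_propagation X : pseudoholomorphic X -> ~ horizontal X -> forall k z, ~ locally z (I2_zero X k).
Proof.
  intros hX hv k z hl. apply hv. intros k' U F hF u hu v.
  assert (h : I2_zero X k' u).
  { apply (sphere_propagation (I2_zero X)) with k z; auto.
    - intros; now apply I2_zero_continuation.
    - intros; now apply I2_zero_flip. }
  destruct (psh_pullbacks X k' U F u v hX hF hu) as [_ [_ [p3 _]]].
  rewrite p3, (h U F hF hu), Cconj_0. ring.
Qed.

(** * The line bundle spanned by I_1 *)

Record contH (g : C -> H2) (p : C) : Prop := {
  ch1 : continuous (fun u => fst (fst (g u))) p; ch2 : continuous (fun u => snd (fst (g u))) p;
  ch3 : continuous (fun u => fst (snd (g u))) p; ch4 : continuous (fun u => snd (snd (g u))) p }.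

Lemma smoothH2_contH U g p : open U -> smoothH2 U g -> U p -> contH g p.
Proof.
  intros hU h hp. destruct (smoothH2_WH U g p hU h hp) as [h1 h2 h3 h4].
  constructor; eapply is_W_continuous; eassumption.
Qed.

Lemma continuous_Cmult (f g : C -> C) (p : C) : continuous f p -> continuous g p -> continuous (fun u => f u * g u) p.
Proof.
  intros hf hg.
  assert (P1 : forall h : C -> C, continuous h p -> continuous (fun u => fst (h u)) p)
    by (intros h hh; apply (continuous_comp h (fun c : C => fst c)); [exact hh | eapply is_dR_continuous, is_dR_fst]).
  assert (P2 : forall h : C -> C, continuous h p -> continuous (fun u => snd (h u)) p)
    by (intros h hh; apply (continuous_comp h (fun c : C => snd c)); [exact hh | eapply is_dR_continuous, is_dR_snd]).
  assert (M : forall a b : C -> R, continuous a p -> continuous b p -> continuous (fun u => (a u * b u)%R) p)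
    by (intros a b ha hb; exact (continuous_mult (K := R_AbsRing) a b p ha hb)).
  apply continuous_pair_C.
  - apply (continuous_minus (K := R_AbsRing) (V := R_NormedModule) (fun u => (fst (f u) * fst (g u))%R) (fun u => (snd (f u) * snd (g u))%R)); auto.
  - apply (continuous_plus (K := R_AbsRing) (V := R_NormedModule) (fun u => (fst (f u) * snd (g u))%R) (fun u => (snd (f u) * fst (g u))%R)); auto.
Qed.

Lemma contH_scal c g p : contH g p -> contH (fun u => hscal c (g u)) p.
Proof.
  intros []; constructor; cbn [hscal fst snd]; apply continuous_Cmult; auto; apply continuous_const.
Qed.

Lemma contH_inv g (p : C) : p <> 0 -> contH g (/ p) -> contH (fun u => g (/ u)) p.
Proof.
  intros hp [h1 h2 h3 h4]. assert (hc := is_W_continuous _ _ _ _ (is_W_Cinv p hp)).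
  constructor.
  - exact (continuous_comp (fun u : C => / u) (fun u => fst (fst (g u))) p hc h1).
  - exact (continuous_comp (fun u : C => / u) (fun u => snd (fst (g u))) p hc h2).
  - exact (continuous_comp (fun u : C => / u) (fun u => fst (snd (g u))) p hc h3).
  - exact (continuous_comp (fun u : C => / u) (fun u => snd (snd (g u))) p hc h4).
Qed.

(** The vanishing of the 2 by 2 minors of [(g, h)] is a closed condition, and [g p] is nonzero. *)
Lemma contH_proportional (g h : C -> H2) (p : C) : contH g p -> contH h p -> g p <> hzero ->
  locally p (fun z => z <> p -> exists l, h z = hscal l (g z)) -> exists t, h p = hscal t (g p).
Proof.
  intros [g1 g2 g3 g4] [h1 h2 h3 h4] hne hl.
  assert (K : forall a b c d : C -> C, continuous a p -> continuous b p -> continuous c p -> continuous d p ->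
     (forall z l, h z = hscal l (g z) -> a z = l * c z /\ b z = l * d z) -> a p * d p = b p * c p).
  { intros a b c d ha hb hc hd e.
    apply (continuous_eq_punctured (fun z => a z * d z) (fun z => b z * c z) p); try (now apply continuous_Cmult).
    apply filter_imp with (2 := hl). intros z hz hzp. destruct (hz hzp) as [l hl']. destruct (e z l hl') as [e1 e2]. rewrite e1, e2. ring. }
  assert (D : forall l z, h z = hscal l (g z) -> fst (fst (h z)) = l * fst (fst (g z)) /\ snd (fst (h z)) = l * snd (fst (g z)) /\
     fst (snd (h z)) = l * fst (snd (g z)) /\ snd (snd (h z)) = l * snd (snd (g z))).
  { intros l z ->; cbn [hscal fst snd]; auto. }
  assert (k12 := K _ _ _ _ h1 h2 g1 g2 (fun z l e => conj (proj1 (D l z e)) (proj1 (proj2 (D l z e))))).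
  assert (k13 := K _ _ _ _ h1 h3 g1 g3 (fun z l e => conj (proj1 (D l z e)) (proj1 (proj2 (proj2 (D l z e)))))).
  assert (k14 := K _ _ _ _ h1 h4 g1 g4 (fun z l e => conj (proj1 (D l z e)) (proj2 (proj2 (proj2 (D l z e)))))).
  assert (k23 := K _ _ _ _ h2 h3 g2 g3 (fun z l e => conj (proj1 (proj2 (D l z e))) (proj1 (proj2 (proj2 (D l z e)))))).
  assert (k24 := K _ _ _ _ h2 h4 g2 g4 (fun z l e => conj (proj1 (proj2 (D l z e))) (proj2 (proj2 (proj2 (D l z e)))))).
  assert (k34 := K _ _ _ _ h3 h4 g3 g4 (fun z l e => conj (proj1 (proj2 (proj2 (D l z e)))) (proj2 (proj2 (proj2 (D l z e)))))).
  cbv beta in *. clear K D.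
  destruct (h p) as [[x1 x2] [x3 x4]], (g p) as [[y1 y2] [y3 y4]]. cbn [fst snd] in *.
  assert (F : forall a b c d : C, c <> 0 -> a * d = b * c -> b = a / c * d).
  { intros a b c d hc e. replace (a / c * d) with (a * d / c) by (field; auto). rewrite e. field; auto. }
  assert (F' : forall a b c d : C, d <> 0 -> a * d = b * c -> a = b / d * c).
  { intros a b c d hd e. replace (b / d * c) with (b * c / d) by (field; auto). rewrite <- e. field; auto. }
  assert (S : forall a c : C, c <> 0 -> a = a / c * c) by (intros; field; auto).
  destruct (classic (y1 = 0)) as [e1 | e1].
  - destruct (classic (y2 = 0)) as [e2 | e2].
    + destruct (classic (y3 = 0)) as [e3 | e3].
      * destruct (classic (y4 = 0)) as [e4 | e4].
        -- exfalso; apply hne. now rewrite e1, e2, e3, e4.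
        -- exists (x4 / y4). apply H2_ext; cbn [hscal fst snd]; auto.
      * exists (x3 / y3). apply H2_ext; cbn [hscal fst snd]; auto.
    + exists (x2 / y2). apply H2_ext; cbn [hscal fst snd]; auto.
  - exists (x1 / y1). apply H2_ext; cbn [hscal fst snd]; auto.
Qed.

(** The complex line spanned by [horiz], which is 0 at the zeros of [I_1]. *)
Definition hline (X : CP1 -> CP3) (k : bool) (z : C) (h : H2) : Prop :=
  exists U F l, local_frame X k U F /\ U z /\ h = hscal l (horiz (fr1 F) (fr2 F) z).

(** The limits at [x] of the lines spanned by [horiz], the point itself being excluded.  As the definition refers neither to a frame nor to a chart, the line
    bundle needs no gluing; a continuous selection [g] replaces a topology on the set of lines. *)
Definition tangent_line (X : CP1 -> CP3) (x : CP1) (h : H2) : Prop :=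
  exists k p g, x = chart k p /\ contH g p /\ g p = h /\ locally p (fun z => z <> p -> hline X k z (g z)).

Lemma hscal_hscal a b v : hscal a (hscal b v) = hscal (a * b) v.
Proof. apply H2_ext; unfold hscal; cbn [fst snd]; ring. Qed.
Lemma hscal_1 v : hscal 1 v = v.
Proof. apply H2_ext; unfold hscal; cbn [fst snd]; ring. Qed.

Lemma hline_frame X k U F z h : pseudoholomorphic X -> local_frame X k U F -> U z -> hline X k z h ->
  exists l, h = hscal l (horiz (fr1 F) (fr2 F) z).
Proof.
  intros hX hF hu [U' [F' [l [hF' [hu' e]]]]].
  destruct (frame_change X k U F U' F' z hX hF hF' hu hu') as [l' [_ [_ [e' _]]]].
  exists (l * l'). now rewrite e, e', hscal_hscal.
Qed.

Lemma hline_flip X k (w : C) h : w <> 0 -> hline X k (/ w) h -> hline X (negb k) w h.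
Proof.
  intros hw [U [F [l [hF [hu e]]]]].
  exists (inv_dom U), (inv_frame F), (- (l * (w * w))). split; [now apply inv_local_frame |]. split; [now split |].
  rewrite (proj1 (inv_frame_data F U k X w hF (conj hw hu))), hscal_hscal, e. f_equal. field. exact hw.
Qed.

Lemma tangent_line_chart X k (p : C) h : tangent_line X (chart k p) h ->
  exists g, contH g p /\ g p = h /\ locally p (fun z => z <> p -> hline X k z (g z)).
Proof.
  intros [k' [p' [g [e [hc [hg hl]]]]]].
  destruct (chart_eq _ _ _ _ e) as [[-> ->] | [-> [p0 ->]]].
  - exists g; auto.
  - exists (fun z => g (/ z)). split; [now apply contH_inv |]. split; [exact hg |].
    assert (hc' := is_W_continuous _ _ _ _ (is_W_Cinv p p0) _ hl). unfold filtermap in hc'.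
    apply filter_imp with (2 := filter_and _ _ hc' (open_neq0 p p0)).
    intros z [z1 z2] hzp. replace k with (negb (negb k)) by now destruct k.
    apply hline_flip; auto. apply z1. intros ez. apply hzp. now rewrite <- (Cinv_inv z), ez, Cinv_inv.
Qed.

Lemma tangent_line_scal X x c h : tangent_line X x h -> tangent_line X x (hscal c h).
Proof.
  intros [k [p [g [e [hc [hg hl]]]]]]. exists k, p, (fun z => hscal c (g z)).
  split; [exact e |]. split; [now apply contH_scal |]. split; [now rewrite hg |].
  apply filter_imp with (2 := hl). intros z hz' hzp. destruct (hz' hzp) as [U [F [l [hF [hu el]]]]].
  exists U, F, (c * l). split; auto. split; auto. now rewrite el, hscal_hscal.
Qed.

(** Away from [p] the nowhere vanishing factor spans the same line as [horiz]; two continuous selections that are proportional off a point are proportional there. *)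
Lemma tangent_line_factor X k d p F m b1 b2 : pseudoholomorphic X -> local_frame X k (disc p d) F ->
  smoothC (disc p d) b1 -> smoothC (disc p d) b2 ->
  (forall z, cf1 (fr1 F) (fr2 F) z = (z - p) ^ m * b1 z /\ cf2 (fr1 F) (fr2 F) z = (z - p) ^ m * b2 z) ->
  (forall z, disc p d z -> ~ (b1 z = 0 /\ b2 z = 0)) ->
  forall z, disc p d z -> forall h, tangent_line X (chart k z) h <-> exists t, h = hscal t (hmulr (fr2 F z) (b1 z, b2 z)).
Proof.
  intros hX hF hb1 hb2 hf hnz z hzd h. assert (ho := disc_open p d).
  assert (hm := psh_moving_frame X k _ F hX hF).
  set (g := fun u => hadd (hscal (b1 u) (fr2 F u)) (hscal (b2 u) (sg (fr2 F u)))).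
  assert (hg : forall u, hmulr (fr2 F u) (b1 u, b2 u) = g u) by (intros; apply hmulr_eq).
  rewrite hg.
  assert (hgs : smoothH2 (disc p d) g).
  { apply smoothH2_add; auto; apply smoothH2_scal; auto; [apply hF | apply smoothH2_sg; auto; apply hF]. }
  assert (hgc := smoothH2_contH _ g z ho hgs hzd).
  assert (hh : forall u, horiz (fr1 F) (fr2 F) u = hscal ((u - p) ^ m) (g u)).
  { intros u. unfold horiz, g. destruct (hf u) as [f1 f2]. rewrite f1, f2. apply H2_ext; unfold hadd, hscal, qadd; cbn [fst snd]; ring. }
  split.
  - intros he. destruct (tangent_line_chart X k z h he) as [g' [c1 [c2 c3]]]. rewrite <- c2.
    apply contH_proportional; auto.
    + intros e. apply (hnz z hzd). destruct (mf_unitary _ _ _ hm z hzd) as [u1 u2 u3 u4].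
      assert (e1 := f_equal (hfst (fr2 F z)) e). assert (e2 := f_equal (hsnd (fr2 F z)) e).
      unfold g in e1, e2. rewrite hfst_comb, hfst_sg, u2 in e1. rewrite hsnd_comb, hsnd_sg, u2 in e2.
      replace (hsnd (fr2 F z) (fr2 F z)) with (RtoC 0) in e1, e2 by (unfold hsnd; ring). rewrite Cconj_0 in e1.
      replace (hfst (fr2 F z) hzero) with (RtoC 0) in e1 by (unfold hfst, hzero; cbn [fst snd]; ring).
      replace (hsnd (fr2 F z) hzero) with (RtoC 0) in e2 by (unfold hsnd, hzero; cbn [fst snd]; ring).
      split; [rewrite <- e1 | rewrite <- e2]; ring.
    + apply filter_imp with (2 := filter_and _ _ c3 (ho z hzd)). intros u [u1 u2] huz.
      destruct (hline_frame X k _ F u _ hX hF u2 (u1 huz)) as [l hl]. exists (l * (u - p) ^ m). now rewrite hl, hh, hscal_hscal.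
  - intros [t ->]. exists k, z, (fun u => hscal t (g u)). split; [reflexivity |]. split; [now apply contH_scal |]. split; [reflexivity |].
    assert (hp : locally z (fun u => u <> z -> u <> p)).
    { destruct (classic (z = p)) as [<- | hne]; [apply filter_forall; auto |].
      assert (h0 : (0 < Cmod (z - p))%R) by now apply Cmod_gt_0, Csub_neq0.
      apply (disc_locally z (Cmod (z - p)) _ h0). intros u hu _ ->. unfold disc in hu. rewrite Cmod_sym in hu. lra. }
    apply filter_imp with (2 := filter_and _ _ hp (ho z hzd)). intros u [u1 u2] huz.
    exists (disc p d), F, (t * / ((u - p) ^ m)). split; [exact hF |]. split; [exact u2 |].
    assert (h0 : (u - p) ^ m <> 0) by now apply Cpow_nz, Csub_neq0, u1.
    rewrite hh, hscal_hscal. f_equal. field. exact h0.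
Qed.

Lemma I1_factor X k p : pseudoholomorphic X -> ~ vertical X ->
  exists d F m b1 b2, (0 < d)%R /\ local_frame X k (disc p d) F /\ smoothC (disc p d) b1 /\ smoothC (disc p d) b2 /\
    dbar_system (disc p d) (k11 (fr1 F) (fr2 F)) (k12 (fr1 F) (fr2 F)) (k21 (fr1 F) (fr2 F)) (k22 (fr1 F) (fr2 F)) b1 b2 /\
    (forall z, cf1 (fr1 F) (fr2 F) z = (z - p) ^ m * b1 z /\ cf2 (fr1 F) (fr2 F) z = (z - p) ^ m * b2 z) /\
    (forall z, disc p d z -> ~ (b1 z = 0 /\ b2 z = 0)).
Proof.
  intros hX hv. destruct (local_frame_exists X k p (proj1 hX)) as [U [F [hF hu]]].
  destruct (open_disc_sub U p (proj1 hF) hu) as [s [hs hsU]].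
  assert (hF' := local_frame_sub X k U (disc p s) F hF (disc_open p s) hsU).
  assert (hm := psh_moving_frame X k _ F hX hF'). destruct (smooth_k _ _ _ hm) as [a1 [a2 [a3 a4]]].
  destruct (system_factor p s _ _ _ _ _ _ hs a1 a2 a3 a4 (smooth_cf1 _ _ _ hm) (smooth_cf2 _ _ _ hm) (system_cf _ _ _ hm))
    as [d [m [b1 [b2 [hd [h1 [h2 [h3 [h4 h5]]]]]]]]].
  - intros hl. apply (I1_propagation X hX hv k p).
    apply filter_imp with (2 := filter_and _ _ hl (disc_open p s p (disc_center p s hs))).
    intros z [z1 z2]. now apply (I1_zero_frame X k (disc p s) F).
  - exists d, F, m, b1, b2. split; [apply hd |].
    split; [apply (local_frame_sub X k (disc p s)); auto using disc_open; now apply disc_le |].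
    split; [exact h1 |]. split; [exact h2 |]. split; [exact h3 |]. split; [exact h4 | exact h5].
Qed.

Lemma herm_hmulr w s : hfst w w = 1 -> herm w (hmulr w s) = s.
Proof.
  intros hw. rewrite hmulr_eq, herm_eq, hfst_comb, hsnd_comb, hfst_sg, hsnd_sg, hw.
  replace (hsnd w w) with (RtoC 0) by (unfold hsnd; ring). rewrite Cconj_0.
  destruct s as [s1 s2]; cbn [fst snd]; f_equal; ring.
Qed.

Lemma hmulr_scal w s t : hscal t (hmulr w s) = hmulr w (t * fst s, t * snd s).
Proof. rewrite !hmulr_eq. apply H2_ext; unfold hadd, hscal, qadd; cbn [fst snd]; ring. Qed.

(** The line [L], with the vectors of [tangent_line] expressed in the coordinates of the frame. *)
Definition lineL (X : CP1 -> CP3) : subset_H := fun x f s => tangent_line X x (hmulr (e2 f) s).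

Lemma lineL_line X : pseudoholomorphic X -> ~ vertical X ->
  forall x f, over (X x) f -> exists s : C2, s <> zero /\ lineL X x f = Cspan s.
Proof.
  intros hX hv x f hf. destruct (chart_surj x) as [k [p ->]].
  destruct (I1_factor X k p hX hv) as [d [F [m [b1 [b2 [hd [hF [h1 [h2 [_ [h4 h5]]]]]]]]]]].
  assert (hp := disc_center p d hd).
  destruct (frame_change_pointwise _ _ _ hf (proj2 (proj2 (proj2 hF)) p hp)) as [l [q [_ [_ [_ [hq1 [hq2 _]]]]]]].
  assert (hu : hfst (e2 f) (e2 f) = 1) by apply (uww _ _ (proj1 (is_frame_unitary f) (proj1 hf))).
  change (e2 (F p)) with (fr2 F p) in hq1. rewrite <- hmulr_eq in hq1.
  set (s := qmul q (b1 p, b2 p)).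
  exists s. split.
  - intros e. apply (h5 p hp).
    assert (e' : qmul (qconj q) s = qzero) by (rewrite e; unfold qmul, qzero; repeat apply injective_projections; simpl; ring).
    unfold s in e'. rewrite qmul_assoc in e'.
    replace (qmul (qconj q) q) with qone in e'.
    + replace (qmul qone (b1 p, b2 p)) with ((b1 p, b2 p) : quat) in e'.
      * split; [exact (f_equal fst e') | exact (f_equal snd e')].
      * unfold qmul, qone; repeat apply injective_projections; simpl; ring.
    + unfold qmul, qconj, qone; cbn [fst snd]; csimpl. f_equal; [rewrite <- hq2; ring | ring].
  - apply functional_extensionality; intros s'. apply propositional_extensionality. unfold lineL.
    rewrite (tangent_line_factor X k d p F m b1 b2 hX hF h1 h2 h4 h5 p hp). rewrite hq1, <- hmulr_assoc. fold s. split.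
    + intros [t e]. exists t. rewrite hmulr_scal in e. apply (f_equal (herm (e2 f))) in e.
      rewrite !herm_hmulr in e by exact hu. rewrite e. destruct s; reflexivity.
    + intros [t ->]. exists t. rewrite hmulr_scal. destruct s; reflexivity.
Qed.

Lemma lineL_act X x f : over (X x) f -> forall (z : C) (q : quat),
     qmul (qconj (qC z)) (qC z) = qone -> qmul (qconj q) q = qone ->
     forall s : C2, lineL X x f s <-> lineL X x (act f z q) (qmul (qmul (qconj q) s) (qC z)).
Proof.
  intros _ z q hz' hq s. unfold lineL, act. cbn [e2 snd].
  assert (hq' : qmul q (qconj q) = qone).
  { rewrite qmul_conj_l in hq. now rewrite qmul_conj_r. }
  replace (hmulr (hmulr (e2 f) q) (qmul (qmul (qconj q) s) (qC z))) with (hscal z (hmulr (e2 f) s)).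
  2: { rewrite <- hmulr_qC_scal, <- !hmulr_assoc. f_equal. rewrite !qmul_assoc, hq'. f_equal.
       unfold qmul, qone; repeat apply injective_projections; simpl; ring. }
  split; [apply tangent_line_scal |]. intros h. apply (tangent_line_scal X x (Cconj z)) in h. rewrite hscal_hscal in h.
  replace (Cconj z * z) with (RtoC 1) in h; [now rewrite hscal_1 in h |].
  apply (f_equal fst) in hz'. unfold qmul, qconj, qC, qone in hz'; cbn [fst snd] in hz'. rewrite <- hz'. csimpl. rewrite Cconj_0. ring.
Qed.

Lemma lineL_holomorphic X : pseudoholomorphic X -> ~ vertical X -> holomorphic_line_subbundle X (lineL X).
Proof.
  intros hX hv. split; [now apply lineL_line |]. split; [intros; now apply lineL_act |].
  intros k z0. destruct (I1_factor X k z0 hX hv) as [d [F [m [b1 [b2 [hd [hF [h1 [h2 [h3 [h4 h5]]]]]]]]]]].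
  exists (disc z0 d), F, (fun z => (b1 z, b2 z)).
  split; [exact hF |]. split; [now apply disc_center |].
  split; [now apply (holomorphic_section_of_system X k) |].
  intros z hzd. split.
  - intros e. apply (h5 z hzd). split; [exact (f_equal fst e) | exact (f_equal snd e)].
  - unfold lineL. apply (tangent_line_factor X k d z0 F m b1 b2 hX hF h1 h2 h4 h5 z hzd).
    exists (RtoC 1). now rewrite hscal_1.
Qed.

Lemma tangent_line_horiz X k U F z c : pseudoholomorphic X -> local_frame X k U F -> U z ->
  tangent_line X (chart k z) (hscal c (horiz (fr1 F) (fr2 F) z)).
Proof.
  intros hX hF hu. assert (hm := psh_moving_frame X k U F hX hF).
  exists k, z, (fun u => hscal c (horiz (fr1 F) (fr2 F) u)). split; [reflexivity |].
  split; [apply contH_scal, (smoothH2_contH U); [apply hF | now apply smooth_horiz | exact hu] |].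
  split; [reflexivity |]. apply filter_imp with (2 := proj1 hF z hu). intros u hu' _.
  exists U, F, c; auto.
Qed.

Lemma lineL_I1 X : pseudoholomorphic X -> contains_I1 X (lineL X).
Proof.
  intros hX k U F hF z hu v. unfold lineL.
  destruct (psh_pullbacks X k U F z v hX hF hu) as [p1 [p2 _]]. rewrite p1, p2.
  change (e2 (F z)) with (fr2 F z).
  replace (hmulr (fr2 F z) (RtoC (sqrt 2) * cf1 (fr1 F) (fr2 F) z * v, RtoC (sqrt 2) * cf2 (fr1 F) (fr2 F) z * v))
    with (hscal (RtoC (sqrt 2) * v) (horiz (fr1 F) (fr2 F) z)).
  - now apply (tangent_line_horiz X k U F).
  - rewrite hmulr_eq. cbn [fst snd]. unfold horiz. apply H2_ext; unfold hadd, hscal, qadd; cbn [fst snd]; ring.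
Qed.

(** In an adapted frame the line is spanned by [sg e2], the horizontal vector with coordinates (0, 1), and [horiz] lies in this line. *)
Lemma adapted_cf1 X k U F z : pseudoholomorphic X -> adapted_frame X (lineL X) k U F -> U z -> cf1 (fr1 F) (fr2 F) z = 0.
Proof.
  intros hX [hF hL] hu. assert (hm := psh_moving_frame X k U F hX hF).
  destruct (classic (horiz (fr1 F) (fr2 F) z = hzero)) as [e | hne]; [now apply (horiz_zero U (fr1 F) (fr2 F) z hm hu) |].
  specialize (hL z hu). unfold lineL in hL. change (e2 (F z)) with (fr2 F z) in hL.
  destruct (tangent_line_chart X k z _ hL) as [g [c1 [c2 c3]]].
  destruct (contH_proportional (horiz (fr1 F) (fr2 F)) g z) as [t ht]; auto.
  - apply (smoothH2_contH U); [apply hF | now apply smooth_horiz | exact hu].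
  - apply filter_imp with (2 := filter_and _ _ c3 (proj1 hF z hu)). intros u [u1 u2] huz.
    now apply (hline_frame X k U F u _ hX hF u2), u1.
  - rewrite c2, hmulr_eq in ht. cbn [fst snd] in ht. destruct (mf_unitary _ _ _ hm z hu) as [u1 u2 u3 u4].
    assert (S0 : hsnd (fr2 F z) (fr2 F z) = 0) by (unfold hsnd; ring).
    assert (e1 := f_equal (hfst (fr2 F z)) ht). assert (e2 := f_equal (hsnd (fr2 F z)) ht).
    rewrite hfst_comb, hfst_sg, S0, Cconj_0 in e1. rewrite hsnd_comb, hsnd_sg, S0, u2 in e2.
    assert (k1 : hfst (fr2 F z) (hscal t (horiz (fr1 F) (fr2 F) z)) = t * cf1 (fr1 F) (fr2 F) z).
    { transitivity (t * hfst (fr2 F z) (horiz (fr1 F) (fr2 F) z)); [unfold hfst, hscal; cbn [fst snd]; ring |].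
      unfold horiz. rewrite hfst_comb, hfst_sg, S0, u2, Cconj_0. ring. }
    assert (k2 : hsnd (fr2 F z) (hscal t (horiz (fr1 F) (fr2 F) z)) = t * cf2 (fr1 F) (fr2 F) z).
    { transitivity (t * hsnd (fr2 F z) (horiz (fr1 F) (fr2 F) z)); [unfold hsnd, hscal; cbn [fst snd]; ring |].
      unfold horiz. rewrite hsnd_comb, hsnd_sg, S0, u2. ring. }
    rewrite k1 in e1. rewrite k2 in e2.
    apply (Cmult_eq0_r t).
    + intros t0. rewrite t0 in e2. apply C1_nz. transitivity (0 * 0 + 1 * 1); [ring |]. rewrite e2; ring.
    + rewrite <- e1. ring.
Qed.

Lemma locally_continuous_neq0 (f : C -> C) (z : C) : continuous f z -> f z <> 0 -> locally z (fun u => f u <> 0).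
Proof.
  intros hf h0. assert (h : (0 < Cmod (f z))%R) by now apply Cmod_gt_0.
  assert (hc : continuous (fun u => Cmod (f u)) z) by (apply (continuous_comp f Cmod); [exact hf | apply continuous_Cmod]).
  assert (hl := hc _ (open_gt 0 _ h)). unfold filtermap in hl. apply filter_imp with (2 := hl).
  intros u hu e. rewrite e, Cmod_0 in hu. lra.
Qed.

(** Otherwise [I_1] or [I_2] would vanish on an open set. *)
Lemma adapted_dense X k U F z : pseudoholomorphic X -> ~ vertical X -> ~ horizontal X -> adapted_frame X (lineL X) k U F ->
  forall P : C -> Prop, locally z (fun u => U u /\ P u) -> exists u, U u /\ P u /\ cf2 (fr1 F) (fr2 F) u <> 0 /\ bef (fr1 F) u <> 0.
Proof.
  intros hX hv hh hF P hP. assert (hm := psh_moving_frame X k U F hX (proj1 hF)). assert (hU := proj1 (proj1 hF)).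
  assert (H1 : exists u, locally u (fun u => (U u /\ P u) /\ cf2 (fr1 F) (fr2 F) u <> 0)).
  { apply NNPP; intro hno. apply (I1_propagation X hX hv k z).
    apply filter_imp with (2 := locally_locally _ _ hP). intros u hu.
    destruct (locally_singleton _ _ hu) as [uU _].
    apply (I1_zero_frame X k U F u hX (proj1 hF) uU). split; [now apply (adapted_cf1 X k U F) |].
    apply NNPP; intro hne. apply hno. exists u. apply filter_and; [exact hu |].
    apply locally_continuous_neq0; [| exact hne]. apply (smoothC_continuous U); auto. now apply smooth_cf2. }
  destruct H1 as [u hu].
  apply NNPP; intro hno. apply (I2_propagation X hX hh k u). apply filter_imp with (2 := hu).
  intros y [[y1 y2] y3]. apply (I2_zero_frame X k U F y hX (proj1 hF) y1).
  apply NNPP; intro hne. apply hno. exists y; auto.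
Qed.

Lemma continuous_zero_dense (f : C -> C) (z : C) : continuous f z ->
  (forall P : C -> Prop, locally z P -> exists u, P u /\ f u = 0) -> f z = 0.
Proof.
  intros hf hd. apply NNPP; intro hne.
  destruct (hd _ (locally_continuous_neq0 f z hf hne)) as [u [u1 u2]]. auto.
Qed.

(** On the dense set where [I_1] and [I_2] are nonzero, [quartic_adapted] kills the (1,0) part of [kappa_12]; the (0,1) part vanishes because [omega_1] vanishes identically in the frame, by the equation for [dbar cf1]. *)
Lemma lineL_II X : pseudoholomorphic X -> ~ vertical X -> ~ horizontal X -> II_zero X (lineL X).
Proof.
  intros hX hv hh k U F hF z hu v.
  assert (hm := psh_moving_frame X k U F hX (proj1 hF)). assert (hU := proj1 (proj1 hF)).
  assert (c0 : forall u, U u -> cf1 (fr1 F) (fr2 F) u = 0) by (intros; now apply (adapted_cf1 X k U F)).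
  set (w := fr2 F).
  assert (off : forall u, U u -> cf2 (fr1 F) w u <> 0 -> bef (fr1 F) u <> 0 -> hsnd (w u) (DzbH w u) = 0 /\ hsnd (w u) (DzH w u) = 0).
  { intros u hu' h2 hb. split.
    - assert (e := quartic_adapted U (fr1 F) w u hm c0 hu').
      assert (e0 : quartic (fun i u => hopf i (fr1 F u)) u = 0).
      { rewrite <- (quartic_zero X k u hX). unfold quartic, G5.
        assert (D : forall i, Dz (Dz (fun u => hopf i (fr1 F u))) u = Dz (Dz (hopfX X k i)) u).
        { intros i. apply Dz_ext_loc. apply filter_imp with (2 := hU u hu'). intros y hy.
          apply Dz_ext_loc. apply filter_imp with (2 := hU y hy). intros x hx. symmetry. exact (hopfX_frame X k U F x i (proj1 hF) hx). }
        cbv beta. rewrite !D. reflexivity. }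
      rewrite e0 in e.
      assert (b0 : Cconj (bef (fr1 F) u) <> 0).
      { intros eb. apply hb. apply (f_equal Cconj) in eb. now rewrite Cconj_conj, Cconj_0 in eb. }
      assert (q0 : Cconj (hsnd (w u) (DzbH w u)) = 0).
      { apply (Cmult_eq0_r (- (4) * (cf2 (fr1 F) w u * cf2 (fr1 F) w u) * Cconj (bef (fr1 F) u))).
        - repeat apply Cmult_neq_0; auto. intros e4; apply (f_equal fst) in e4; simpl in e4; lra.
        - rewrite e. ring. }
      apply (f_equal Cconj) in q0. now rewrite Cconj_conj, Cconj_0 in q0.
    - assert (e := dbar_cf1 U (fr1 F) w u hm hu').
      assert (e0 : Dzb (cf1 (fr1 F) w) u = 0).
      { transitivity (Dzb (fun _ => RtoC 0) u); [| apply (is_W_Dzb _ _ _ _ (is_W_const 0 u))].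
        apply Dzb_ext_loc. apply filter_imp with (2 := hU u hu'). intros y hy; now apply c0. }
      rewrite e0 in e. change (cf1 (fr1 F) w u) with (cf1 (fr1 F) (fr2 F) u) in e. rewrite (c0 u hu') in e.
      assert (q0 : Cconj (hsnd (w u) (DzH w u)) = 0).
      { apply (Cmult_eq0_r (cf2 (fr1 F) w u)); auto. rewrite <- (Cplus_0_r 0), e at 1. ring. }
      apply (f_equal Cconj) in q0. now rewrite Cconj_conj, Cconj_0 in q0. }
  assert (hw : smoothH2 U w) by apply hm.
  assert (z1 : hsnd (w z) (DzbH w z) = 0 /\ hsnd (w z) (DzH w z) = 0).
  { split.
    - apply (continuous_zero_dense (fun u => hsnd (w u) (DzbH w u))).
      + apply (smoothC_continuous U); auto. apply smoothC_hsnd; auto. now apply smoothH2_DzbH.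
      + intros P hP. destruct (adapted_dense X k U F z hX hv hh hF P (filter_and _ _ (hU z hu) hP)) as [u [u1 [u2 [u3 u4]]]].
        exists u. split; auto. now apply off.
    - apply (continuous_zero_dense (fun u => hsnd (w u) (DzH w u))).
      + apply (smoothC_continuous U); auto. apply smoothC_hsnd; auto. now apply smoothH2_DzH.
      + intros P hP. destruct (adapted_dense X k U F z hX hv hh hF P (filter_and _ _ (hU z hu) hP)) as [u [u1 [u2 [u3 u4]]]].
        exists u. split; auto. now apply off. }
  destruct (psh_pullbacks X k U F z v hX (proj1 hF) hu) as [_ [_ [_ [p4 _]]]]. fold w in p4.
  rewrite p4, (proj1 z1), (proj2 z1), Cconj_0. ring.
Qed.

Lemma null_torsion_of_not_vertical_horizontal X : pseudoholomorphic X -> ~ vertical X -> ~ horizontal X -> null_torsion X.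
Proof.
  intros hX hv hh. split; [exact hv |]. exists (lineL X).
  split; [now apply lineL_holomorphic |]. split; [now apply lineL_I1 | now apply lineL_II].
Qed.

(** * Vertical curves *)

(** [sphere_liouville] gives that both local expressions are equal to their values at the two poles. *)
Lemma sphere_constant (h : bool -> C -> C) :
  (forall k, smoothC (fun _ => True) (h k)) -> (forall k z, Dzb (h k) z = 0) ->
  (forall k (w : C), w <> 0 -> h (negb k) w = h k (/ w)) ->
  forall k z k' z', h k z = h k' z'.
Proof.
  intros hs hd hf.
  assert (A : forall k z, h k z = h (negb k) 0).
  { intros k z. apply (sphere_liouville (h k) (h (negb k))); auto.
    apply (smoothC_continuous (fun _ => True)); auto using open_true. }
  assert (B : forall k, h k 0 = h (negb k) 0) by (intros k; apply A).
  intros k z k' z'. rewrite (A k z), (A k' z').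
  destruct k, k'; simpl; auto.
Qed.

(** Complex conjugation on the coordinates of [R^5]. *)
Definition bar5 (i : I5) : I5 := match i with i0 => i0 | i1 => i1b | i1b => i1 | i2 => i2b | i2b => i2 end.

Lemma hopf_conj i v : Cconj (hopf i v) = hopf (bar5 i) v.
Proof.
  destruct v as [[[? ?] [? ?]] [[? ?] [? ?]]], i; unfold hopf, L5, sg, bar5;
  apply injective_projections; simpl; ring.
Qed.

Lemma vertical_zero X k z : pseudoholomorphic X -> vertical X -> I1_zero X k z.
Proof.
  intros hX hv U F hF hu. destruct (hv k U F hF z hu 1) as [h1 h2].
  destruct (psh_pullbacks X k U F z 1 hX hF hu) as [p1 [p2 _]]. rewrite p1, Cmult_1_r in h1. rewrite p2, Cmult_1_r in h2.
  split; [apply (Cmult_eq0_r _ _ sqrt2_neq0 h1) | apply (Cmult_eq0_r _ _ sqrt2_neq0 h2)].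
Qed.

Lemma vertical_Dz_hopfX X k i z : pseudoholomorphic X -> vertical X -> Dz (hopfX X k i) z = 0.
Proof.
  intros hX hv. destruct (local_frame_exists X k z (proj1 hX)) as [U [F [hF hu]]].
  assert (hm := psh_moving_frame X k U F hX hF).
  transitivity (Dz (fun u => hopf i (fr1 F u)) z).
  { apply Dz_ext_loc. apply filter_imp with (2 := proj1 hF z hu). intros u hu'. exact (hopfX_frame X k U F u i hF hu'). }
  rewrite (dz_hopf U _ _ z i hm hu).
  rewrite (proj2 (horiz_zero U _ _ z hm hu) (vertical_zero X k z hX hv U F hF hu)).
  unfold hzero. destruct (sg (fr1 F z)) as [[y1 y2] [y3 y4]]; destruct i; unfold L5; cbn [fst snd]; ring.
Qed.

(** Since [horiz] vanishes, the Hopf coordinates are antiholomorphic, and so their conjugates are holomorphic on the sphere. *)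
Lemma vertical_hopfX X : pseudoholomorphic X -> vertical X -> forall i k z k' z', hopfX X k i z = hopfX X k' i z'.
Proof.
  intros hX hv i. apply (sphere_constant (fun k z => hopfX X k i z)).
  - intros k; apply hopfX_smooth, hX.
  - intros k z.
    assert (W := smoothC_W (fun _ => True) _ z open_true (hopfX_smooth X k (bar5 i) (proj1 hX)) I).
    rewrite (vertical_Dz_hopfX X k (bar5 i) z hX hv) in W.
    apply is_W_conj in W. rewrite Cconj_0 in W.
    apply (is_W_ext_loc _ (hopfX X k i)) in W; [exact (is_W_Dzb _ _ _ _ W) |].
    apply filter_forall; intros u. unfold hopfX. rewrite hopf_conj. now destruct i.
  - intros k w hw. now apply hopfX_flip.
Qed.

(** The orthogonal projection to [a H] is [(1 + S) / 2], where [S] is the reflection whose entries are the Hopf coordinates of [a]. *)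
Lemma hmulr_herm_hopf a y : hfst a a = 1 -> hmulr a (herm a y) =
  (( / 2 * ((hopf i0 a + 1) * fst (fst y) + hopf i1 a * fst (snd y) - hopf i2b a * snd (snd y)),
     / 2 * ((hopf i0 a + 1) * snd (fst y) + hopf i2 a * fst (snd y) + hopf i1b a * snd (snd y))),
   ( / 2 * ((1 - hopf i0 a) * fst (snd y) + hopf i1b a * fst (fst y) + hopf i2b a * snd (fst y)),
     / 2 * ((1 - hopf i0 a) * snd (snd y) - hopf i2 a * fst (fst y) + hopf i1 a * snd (fst y)))).
Proof.
  intros ha. rewrite <- !ha. rewrite hmulr_eq, herm_eq.
  destruct a as [[a1 a2] [a3 a4]], y as [[y1 y2] [y3 y4]].
  apply H2_ext; unfold hopf, L5, hadd, hscal, qadd, sg, hfst, hsnd; cbn [fst snd]; field.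
Qed.

(** By [hmulr_herm_hopf] the Hopf coordinates determine the projection to [a H], hence this line. *)
Lemma hopf_same_fiber a b : hfst a a = 1 -> hfst b b = 1 -> (forall i, hopf i a = hopf i b) -> b = hmulr a (herm a b).
Proof.
  intros ha hb h. transitivity (hmulr b (herm b b)).
  - rewrite herm_eq, hb. replace (hsnd b b) with (RtoC 0) by (unfold hsnd; ring). symmetry; exact (hmulr_1 b).
  - rewrite !hmulr_herm_hopf by assumption. now rewrite !h.
Qed.

Lemma Hspan_eq a b q q' : b = hmulr a q -> a = hmulr b q' -> Hspan a = Hspan b.
Proof.
  intros h h'. apply functional_extensionality; intros w; apply propositional_extensionality; split; intros [r ->].
  - exists (qmul q' r). now rewrite hmulr_assoc, <- h'.
  - exists (qmul q r). now rewrite hmulr_assoc, <- h.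
Qed.

Lemma twistor_unit_rep p : proj1_sig (twistor p) = Hspan (unit_rep p).
Proof. exact (eq_trans (f_equal Hsaturate (proj2 (unit_rep_spec p))) (Hsaturate_Cspan _)). Qed.

Lemma hadd_unit_expand e f : hfst e e = 1 -> Hspan e f -> f = hadd (hscal (hfst e f) e) (hscal (hsnd e f) (sg e)).
Proof.
  intros he [q ->]. rewrite hmulr_eq, hfst_comb, hsnd_comb, hfst_sg, hsnd_sg, he.
  replace (hsnd e e) with (RtoC 0) by (unfold hsnd; ring). rewrite Cconj_0. apply H2_ext; unfold hadd, hscal, qadd; cbn [fst snd]; ring.
Qed.

(** Suppose that the image misses the point [e C] of the fiber.  A vertical vector [v] moves by multiples of itself in the direction [z], so the
    affine coordinate [hfst e v / hsnd e v] is antiholomorphic: the almost complex structure is the opposite of the usual one on the fibers.  Its conjugate is holomorphic on the sphere,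
    hence constant, and [X] would be constant. *)
Lemma vertical_surjective X : pseudoholomorphic X -> vertical X ->
  forall e : H2, hfst e e = 1 -> (forall x, Hspan e (unit_rep (X x))) -> exists x, hsnd e (unit_rep (X x)) = 0.
Proof.
  intros hX hv e he hsp. apply NNPP; intro hno.
  assert (hne : forall x, hsnd e (unit_rep (X x)) <> 0) by (intros x hx; apply hno; now exists x).
  set (g := fun k z => Cconj (hfst e (unit_rep (X (chart k z))) / hsnd e (unit_rep (X (chart k z))))).
  assert (hl : forall k z, exists U F, local_frame X k U F /\ U z /\ (forall u, U u -> hsnd e (fr1 F u) <> 0) /\
     (forall u, U u -> g k u = Cconj (hfst e (fr1 F u) * / hsnd e (fr1 F u)))).
  { intros k z. destruct (local_frame_exists X k z (proj1 hX)) as [U [F [hF hu]]]. exists U, F.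
    split; [exact hF |]. split; [exact hu |].
    assert (hs : forall u, U u -> exists l, unit_rep (X (chart k u)) = hscal l (fr1 F u)).
    { intros u hu'. destruct (unit_rep_spec (X (chart k u))) as [h1 h2].
      destruct (proj2 (proj2 (proj2 hF)) u hu') as [_ h4].
      assert (hc : Cspan (fr1 F u : H2_C) (unit_rep (X (chart k u)))) by (unfold fr1; rewrite <- h4, h2; apply Cspan_self).
      destruct hc as [l hc]. rewrite scal_H2 in hc. now exists l. }
    assert (n : forall u, U u -> hsnd e (fr1 F u) <> 0).
    { intros u hu' e0. destruct (hs u hu') as [l hl']. apply (hne (chart k u)). rewrite hl'.
      transitivity (l * hsnd e (fr1 F u)); [unfold hsnd, hscal; cbn [fst snd]; ring | rewrite e0; ring]. }
    split; [exact n |].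
    intros u hu'. unfold g. f_equal. assert (n' := hne (chart k u)). destruct (hs u hu') as [l hl']. rewrite hl' in n' |- *.
    assert (e1 : hfst e (hscal l (fr1 F u)) = l * hfst e (fr1 F u)) by (unfold hfst, hscal; cbn [fst snd]; ring).
    assert (e2 : hsnd e (hscal l (fr1 F u)) = l * hsnd e (fr1 F u)) by (unfold hsnd, hscal; cbn [fst snd]; ring).
    rewrite e2 in n'. rewrite e1, e2. field. split; [now apply n |].
    intros l0. apply n'. rewrite l0; ring. }
  assert (hconst : forall h : H2, forall U : C -> Prop, open U -> smoothH2 U (fun _ => h)).
  { intros h U hU; apply smoothH2_comps; refine (conj _ (conj _ (conj _ _))); now apply smoothC_const. }
  assert (hc : forall k z k' z', g k z = g k' z').
  { apply sphere_constant.
    - intros k. apply smoothC_loc; [apply open_true |]. intros z _. destruct (hl k z) as [U [F [hF [hu [n he']]]]].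
      assert (hU := proj1 hF).
      exists U. split; [exact hU |]. split; [exact hu |].
      apply (smoothC_ext U (fun u => Cconj (hfst e (fr1 F u) * / hsnd e (fr1 F u)))); auto.
      + intros u hu'; symmetry; auto.
      + apply smoothC_conj; auto. apply smoothC_mult; auto.
        * apply smoothC_hfst; auto. apply hF.
        * apply smoothC_inv; auto. apply smoothC_hsnd; auto. apply hF.
    - intros k z. destruct (hl k z) as [U [F [hF [hu [n he']]]]]. assert (hU := proj1 hF).
      assert (hm := psh_moving_frame X k U F hX hF).
      transitivity (Dzb (fun u => Cconj (hfst e (fr1 F u) * / hsnd e (fr1 F u))) z).
      { apply Dzb_ext_loc. apply filter_imp with (2 := hU z hu). exact he'. }
      assert (We := smoothH2_WH U _ z hU (hconst e U hU) hu).
      assert (Wv := smoothH2_WH U _ z hU (mf_v _ _ _ hm) hu).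
      assert (eA := expand_A U _ _ z hm hu).
      rewrite (proj2 (horiz_zero U _ _ z hm hu) (vertical_zero X k z hX hv U F hF hu)) in eA.
      assert (D0 : is_WH (fun _ : C => e) z hzero hzero).
      { constructor; cbn [hzero fst snd]; apply is_W_const. }
      assert (W1 := is_W_hfst _ _ _ _ _ _ _ D0 Wv). assert (W2 := is_W_hsnd _ _ _ _ _ _ _ D0 Wv).
      assert (W3 := is_W_conj _ _ _ _ (is_W_mult _ _ _ _ _ _ _ W1 (is_W_inv (fun u => hsnd e (fr1 F u)) z _ _ (n z hu) W2))).
      etransitivity; [exact (is_W_Dzb _ _ _ _ W3) |]. rewrite <- Cconj_0. f_equal. rewrite eA.
      assert (q1 : hfst hzero (fr1 F z) = 0) by (unfold hfst, hzero; cbn [fst snd]; rewrite Cconj_0; ring).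
      assert (q2 : hsnd hzero (fr1 F z) = 0) by (unfold hsnd, hzero; cbn [fst snd]; ring).
      set (al := - Cconj (alf (fr1 F) z)).
      assert (q3 : hfst e (hadd (hscal al (fr1 F z)) hzero) = al * hfst e (fr1 F z)) by (unfold hfst, hadd, hscal, qadd, hzero; cbn [fst snd]; ring).
      assert (q4 : hsnd e (hadd (hscal al (fr1 F z)) hzero) = al * hsnd e (fr1 F z)) by (unfold hsnd, hadd, hscal, qadd, hzero; cbn [fst snd]; ring).
      rewrite q1, q2, q3, q4. field. now apply n.
    - intros k w hw. unfold g. rewrite (chart_flip k (/ w)) by now apply Cinv_neq0. now rewrite Cinv_inv. }
  destruct hX as [_ [[x [y hxy]] _]]. apply hxy.
  set (c := Cconj (g false 0)).
  assert (hx : forall x, proj1_sig (X x) = Cspan (hadd (hscal c e) (sg e) : H2_C)).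
  { intros x'. destruct (chart_surj x') as [k [z ->]].
    rewrite (proj2 (unit_rep_spec (X (chart k z)))).
    assert (n := hne (chart k z)). set (u := unit_rep (X (chart k z))) in *.
    rewrite <- (Cspan_scal (hadd (hscal c e) (sg e) : H2_C) (hsnd e u) n), scal_H2. f_equal.
    rewrite (hadd_unit_expand e u he (hsp _)) at 1.
    assert (ec : hfst e u = hsnd e u * c).
    { unfold c. rewrite (hc false (RtoC 0) k z). unfold g. rewrite Cconj_conj. fold u. field. exact n. }
    rewrite ec. apply H2_ext; unfold hadd, hscal, qadd; cbn [fst snd]; ring. }
  apply Projective_ext. now rewrite !hx.
Qed.

Lemma vertical_fiber X : pseudoholomorphic X -> vertical X -> image_is_twistor_fiber X.
Proof.
  intros hX hv. set (x0 := chart false 0). exists (twistor (X x0)).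
  assert (hsame : forall x y, Hspan (unit_rep (X x)) = Hspan (unit_rep (X y))).
  { intros x y. assert (h : forall x y, unit_rep (X y) = hmulr (unit_rep (X x)) (herm (unit_rep (X x)) (unit_rep (X y)))).
    { intros x' y'. destruct (chart_surj x') as [k [z ->]], (chart_surj y') as [k' [z' ->]].
      apply hopf_same_fiber; try apply unit_rep_spec. intros i. exact (vertical_hopfX X hX hv i k z k' z'). }
    exact (Hspan_eq _ _ _ _ (h x y) (h y x)). }
  intros p. split.
  - intros [x <-]. apply HP1_ext. rewrite !twistor_unit_rep. apply hsame.
  - intros e. apply (f_equal (@proj1_sig _ _)) in e. rewrite !twistor_unit_rep in e.
    destruct (unit_rep_spec p) as [p1 p2].
    assert (hsp : forall x, Hspan (unit_rep p) (unit_rep (X x))).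
    { intros x. rewrite e, (hsame x0 x). exists qone. symmetry; apply hmulr_1. }
    destruct (vertical_surjective X hX hv (unit_rep p) p1 hsp) as [x hx].
    exists x. apply Projective_ext. destruct (unit_rep_spec (X x)) as [u1 u2]. rewrite u2, p2.
    assert (ex := hadd_unit_expand _ _ p1 (hsp x)). rewrite hx, add_hscal0 in ex.
    rewrite ex at 1. rewrite <- scal_H2. apply Cspan_scal.
    intros c0. rewrite ex, c0 in u1. apply C1_nz. rewrite <- u1. rewrite hfst_scal_scal. ring.
Qed.

Theorem theorem3p4 (X : CP1 -> CP3) (hX : pseudoholomorphic X) :
  (vertical X /\ image_is_twistor_fiber X) \/ horizontal X \/ null_torsion X.
Proof.
  destruct (classic (vertical X)) as [hv|hv].
  - left. split; [exact hv | now apply vertical_fiber].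
  - right. destruct (classic (horizontal X)) as [hh|hh];
      [now left | right; now apply null_torsion_of_not_vertical_horizontal].
Qed.
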